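(* Let $\lambda,\mu\in\mathbb R$ with $\lambda+\mu\notin\mathbb Z$ and let $\phi\in\Phi$ (the Lizorkin space). Then the crossed composition of Riemann–Liouville operators satisfies $$W_+^{\lambda}W_-^{\mu}\phi(x)=\frac{\sin(\mu\pi)}{\sin((\lambda+\mu)\pi)}\,W_-^{\lambda+\mu}\phi(x)+\frac{\sin(\lambda\pi)}{\sin((\lambda+\mu)\pi)}\,W_+^{\lambda+\mu}\phi(x).$$
   Context: Lizorkin space: let $\Psi=\{\psi\in\mathcal S(\mathbb R):\psi^{(j)}(0)=0\text{ for all }j=0,1,2,\dots\}$ and $\Phi=\{\phi\in\mathcal S(\mathbb R):\mathcal F[\phi]\in\Psi\}$, where $\mathcal S(\mathbb R)$ is the Schwartz space and $\mathcal F[\phi](u)=\int_{\mathbb R}\phi(x)e^{iux}dx$. Riemann–Liouville operators $W_\pm^{\alpha}$, $\alpha\in\mathbb R$: $W_\pm^0\varphi=\varphi$. For $\alpha>0$, $W_-^\alpha\varphi(x)=\frac1{\Gamma(\alpha)}\int_{-\infty}^x(x-t)^{\alpha-1}\varphi(t)\,dt$ and $W_+^\alpha\varphi(x)=\frac1{\Gamma(\alpha)}\int_x^\infty(t-x)^{\alpha-1}\varphi(t)\,dt$. For $n-1<\alpha\le n$ with $n\in\mathbb N$, $n\geq 1$, $W_-^{-\alpha}\varphi(x)=\frac{d^n}{dx^n}W_-^{n-\alpha}\varphi(x)$ and $W_+^{-\alpha}\varphi(x)=(-1)^n\frac{d^n}{dx^n}W_+^{n-\alpha}\varphi(x)$.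 These operators map $\Phi$ into $\Phi$. *)

(* Defs.v *)
From mathcomp Require Import all_boot all_order all_algebra.
From mathcomp Require Import all_classical all_reals all_analysis.
From mathcomp Require Import complex.

Set Implicit Arguments.
Unset Strict Implicit.
Unset Printing Implicit Defensive.

Import Order.TTheory GRing.Theory Num.Theory.
Import numFieldNormedType.Exports.

Local Open Scope classical_set_scope.
Local Open Scope ring_scope.
Local Open Scope complex_scope.

(* R[i] is not a normed module over R in the libraries, so derivatives and
   integrals of functions R -> R[i] are taken componentwise. *)

Definition cderivn (R : realType) (n : nat) (f : R -> R[i]) (x : R) : R[i] :=
  (derive1n n (fun t => complex.Re (f t)) x) +i*
  (derive1n n (fun t => complex.Im (f t)) x).

Definition csmooth (R : realType) (f : R -> R[i]) : Prop :=
  forall (n : nat) (x : R),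
    derivable (derive1n n (fun t => complex.Re (f t))) x 1 /\
    derivable (derive1n n (fun t => complex.Im (f t))) x 1.

Definition cintegral (R : realType) (D : set R) (f : R -> R[i]) : R[i] :=
  (\int[@lebesgue_measure R]_(x in D) complex.Re (f x)) +i*
  (\int[@lebesgue_measure R]_(x in D) complex.Im (f x)).

Definition schwartz (R : realType) (f : R -> R[i]) : Prop :=
  csmooth f /\
  forall k n : nat, exists M : R, forall x : R,
    `|x| ^+ k * Normc.normc (cderivn n f x) <= M.

Definition fourier (R : realType) (f : R -> R[i]) (u : R) : R[i] :=
  cintegral setT (fun x => f x * (cos (u * x) +i* sin (u * x))).

Definition lizorkin_dual (R : realType) (psi : R -> R[i]) : Prop :=
  schwartz psi /\ forall j : nat, cderivn j psi 0 = 0.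

Definition lizorkin (R : realType) (phi : R -> R[i]) : Prop :=
  schwartz phi /\ lizorkin_dual (fourier phi).

Definition Gamma (R : realType) (a : R) : R :=
  \int[@lebesgue_measure R]_(t in `]0, +oo[) (t `^ (a - 1) * expR (- t)).

(* Only meaningful for a >= 0; [W_minus] and [W_plus] cover all real orders. *)
Definition RL_integral_minus (R : realType) (a : R) (f : R -> R[i]) (x : R) :
    R[i] :=
  if a == 0 then f x
  else ((Gamma a)^-1)%:C *
       cintegral `]-oo, x] (fun t => ((x - t) `^ (a - 1))%:C * f t).

Definition RL_integral_plus (R : realType) (a : R) (f : R -> R[i]) (x : R) :
    R[i] :=
  if a == 0 then f x
  else ((Gamma a)^-1)%:C *
       cintegral `[x, +oo[ (fun t => ((t - x) `^ (a - 1))%:C * f t).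

(* For a < 0, [RL_degree a] is the n >= 1 with n - 1 < - a <= n. *)
Definition RL_degree (R : realType) (a : R) : nat := `|Num.ceil (- a)|%N.

Definition W_minus (R : realType) (a : R) (f : R -> R[i]) : R -> R[i] :=
  if 0 <= a then RL_integral_minus a f
  else let n := RL_degree a in cderivn n (RL_integral_minus (n%:R + a) f).

Definition W_plus (R : realType) (a : R) (f : R -> R[i]) : R -> R[i] :=
  if 0 <= a then RL_integral_plus a f
  else let n := RL_degree a in
    fun x => (- 1) ^+ n * cderivn n (RL_integral_plus (n%:R + a) f) x.

(* Main.v *)
Require Import Defs.
From mathcomp Require Import all_boot all_order all_algebra.
From mathcomp Require Import all_classical all_reals all_analysis.
From mathcomp Require Import complex.
From mathcomp Require Import measurable_realfun zify ring lra.

(* Real and imaginary parts are treated separately. If 0 < a, 0 < b and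
   a + b < 1, Fubini turns the composition of the two kernels of orders a and b
   into an integral against Beta constants times |r| ^ (a + b - 1); these become
   sines by Euler's reflection formula. If 1 < a + b < 2, apply the right-sided
   operator of order a to the identity for the orders (1 - a, a + b - 1).
   All other orders are reduced to [0, 1[ ^ 2 because differentiation is a
   bijection of the Lizorkin space (its moments vanish) and shifts the orders
   by one. The left-sided integral M of a Lizorkin function f decays rapidly also
   to the right: x * M f = M (x f + b g) with g' = f stays in the same class, so
   only boundedness of M f is needed.
   Reflection formula: rotating the ray of integration of t ^ (a - 1) / (1 + t)
   gives sin (a pi / 2) F(a) = F((a + 1) / 2) / 2 for F(a) = Gamma a Gamma (1 - a),
   so F(a) sin (a pi) is unchanged under a -> a / 2, and its limit at 0 is pi. *)

Set Implicit Arguments.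
Unset Strict Implicit.
Unset Printing Implicit Defensive.

Import Order.TTheory GRing.Theory Num.Theory.
Import numFieldNormedType.Exports.

Local Open Scope classical_set_scope.
Local Open Scope ring_scope.

(** * Derivatives, changes of variables, improper integrals *)

(** The obstacle is convergence. The product of two opposite kernels decays only like t ^ (a + b -
    2), so it is integrable, and Fubini applies, only for a + b < 1; all other orders have to be
    reached without composing kernels directly. For 1 < a + b < 2 the auxiliary orders 1 - a and a +
    b - 1 are positive with sum b < 1, and the outer operator of order a completes 1 - a to a plain
    integration. Shifting an order by one is consistent because two kinds of signs match: sin ((c -
    1) pi) = - sin (c pi), and a right-sided operator applied to a derivative loses one order and
    changes sign, whereas a left-sided one keeps its sign. A right-sided operator sees its argument
    only to the right. Hence the inner left-sided integral has to decay rapidly at +oo only, which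
    is the class [right_schwartz]; this decay is not automatic there and is where the vanishing
    moments are used. Fourier enters once, to translate the Lizorkin condition into these
    moments. *)

Section pointwise_derivatives.
Context {R : realType}.
Implicit Types (f g : R -> R) (x a b : R).

Lemma is_derive_idf x : is_derive x 1 (fun y : R => y) 1.
Proof. exact: is_derive_id. Qed.

Lemma is_derive_cstf (c x : R) : is_derive x 1 (fun _ : R => c) 0.
Proof. exact: is_derive_cst. Qed.

Lemma is_derive_addf f g x a b : is_derive x 1 f a -> is_derive x 1 g b ->
  is_derive x 1 (fun y => f y + g y) (a + b).
Proof. by move=> df dg; exact: is_deriveD. Qed.

Lemma is_derive_oppf f x a : is_derive x 1 f a ->
  is_derive x 1 (fun y => - f y) (- a).
Proof. by move=> df; exact: is_deriveN. Qed.

Lemma is_derive_mulf f g x a b : is_derive x 1 f a -> is_derive x 1 g b ->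
  is_derive x 1 (fun y => f y * g y) (f x * b + g x * a).
Proof. by move=> df dg; exact: is_deriveM. Qed.

Lemma is_derive_mulcf (c : R) f x a : is_derive x 1 f a ->
  is_derive x 1 (fun y => c * f y) (c * a).
Proof.
move=> df; apply: is_derive_eq (is_derive_mulf (is_derive_cst c x 1) df) _.
by rewrite /cst mulr0 addr0.
Qed.

Lemma is_derive_compf f g x a b : is_derive (g x) 1 f a -> is_derive x 1 g b ->
  is_derive x 1 (fun y => f (g y)) (a * b).
Proof. by move=> df dg; exact: is_derive1_comp. Qed.

Lemma is_derive_invf f x a : f x != 0 -> is_derive x 1 f a ->
  is_derive x 1 (fun y => (f y)^-1) (- (f x) ^- 2 * a).
Proof. by move=> fx0 df; exact: is_deriveV. Qed.

Lemma is_derive_derivable f x a : is_derive x 1 f a -> derivable f x 1.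
Proof. by move=> df; exact: (@ex_derive _ _ _ _ _ _ _ df). Qed.

Lemma is_derive_derive1 f x a : is_derive x 1 f a -> derive1 f x = a.
Proof. by move=> df; rewrite derive1E; exact: derive_val. Qed.

Lemma derivable_is_derive f x : derivable f x 1 -> is_derive x 1 f (derive1 f x).
Proof. by move=> df; rewrite derive1E; exact: derivableP. Qed.

Lemma derivable_continuous f x : derivable f x 1 -> {for x, continuous f}.
Proof.
by move=> df; apply: differentiable_continuous; exact/derivable1_diffP.
Qed.

End pointwise_derivatives.

(** * Affine changes of variables for the Lebesgue integral *)

Section affine.
Context {R : realType}.
Local Notation mu := (@lebesgue_measure R).

(** Lebesgue measure is determined by its values on the intervals ]a, b], so it is compared there
    with [|c|] times its pushforward under x -> c x + d. For c < 0 the preimage is half-open on the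
    other side, which does not change its length. *)
Lemma ge0_integral_affine (c d : R) (f : R -> \bar R) : c != 0 ->
  measurable_fun setT f -> (forall x, (0 <= f x)%E) ->
  (\int[mu]_x f x = `|c|%:E * \int[mu]_x f (c * x + d)%R)%E.
Proof.
move=> c0 mf f0.
pose phi : measurableTypeR R -> measurableTypeR R := fun x => c * x + d.
have mphi : measurable_fun setT phi.
  by apply: measurable_funD => //; exact: measurable_funM.
have nc0 : 0 <= `|c| by [].
pose nu0 : {measure set (measurableTypeR R) -> \bar R} :=
  @measure_function_pushforward__canonical__measure_function_Measure _ _ _ _ _ mu
    phi mphi.
pose nu : {measure set (measurableTypeR R) -> \bar R} := mscale (NngNum nc0) nu0.
transitivity (\int[nu]_x f x)%E.
  apply: eq_measure_integral => A mA _.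
  apply: (@lebesgue_measure_unique R nu) => // X [[a b]] /= _ <-.
  rewrite /nu /mscale /= /pushforward /=.
  rewrite lebesgue_measure_itv/= lte_fin; case: (ltP 0 c) => [cgt0|cle0].
    have -> : phi @^-1` `]a, b]%classic = `](a - d) / c, (b - d) / c]%classic.
      apply/seteqP; split => x; rewrite /phi /= !in_itv/=;
        by rewrite ltr_pdivrMr// ler_pdivlMr// !(mulrC x) ltrBlDr lerBrDr.
    rewrite lebesgue_measure_itv/= lte_fin ltr_pM2r ?invr_gt0// ltrD2r.
    case: ifPn => _; last by rewrite mule0.
    by rewrite -!EFinB -EFinM gtr0_norm//; congr (_%:E); field.
  have cn : c < 0 by rewrite lt_neqAle c0.
  have -> : phi @^-1` `]a, b]%classic = `[(b - d) / c, (a - d) / c[%classic.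
    apply/seteqP; split => x; rewrite /phi /= !in_itv/=;
      by rewrite ler_ndivrMr// ltr_ndivlMr// !(mulrC x) ltrBlDr lerBrDr andbC.
  rewrite lebesgue_measure_itv/= lte_fin ltr_nM2r ?invr_lt0// ltrD2r.
  case: ifPn => _; last by rewrite mule0.
  by rewrite -!EFinB -EFinM ltr0_norm//; congr (_%:E); field.
rewrite /nu ge0_integral_mscale//=.
by rewrite ge0_integral_pushforward.
Qed.

Lemma measurable_affine (c d : R) (f : R -> \bar R) :
  measurable_fun setT f -> measurable_fun setT (fun x => f (c * x + d)%R).
Proof.
by move=> mf; apply: (measurableT_comp mf); apply: measurable_funD => //;
  exact: measurable_funM.
Qed.

(** For translations and reflections: with no factor in front, positive and negative parts can be
    transformed separately and subtracted even when both are infinite. *)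
Lemma integral_affine1 (c d : R) (f : R -> \bar R) : `|c| = 1 ->
  measurable_fun setT f -> (\int[mu]_x f (c * x + d)%R = \int[mu]_x f x)%E.
Proof.
move=> c1 mf; have c0 : c != 0 by rewrite -normr_eq0 c1 oner_eq0.
rewrite [RHS]integralE [LHS]integralE; congr (_ - _)%E.
  rewrite [RHS](@ge0_integral_affine c d)// ?c1 ?mul1e//.
    by apply: eq_integral => x _; rewrite !funeposE.
  exact: measurable_funepos.
rewrite [RHS](@ge0_integral_affine c d)// ?c1 ?mul1e//.
  by apply: eq_integral => x _; rewrite !funenegE.
exact: measurable_funeneg.
Qed.

Lemma integrable_affine (c d : R) (f : R -> \bar R) : c != 0 ->
  mu.-integrable setT f -> mu.-integrable setT (fun x => f (c * x + d)%R).
Proof.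
move=> c0 /integrableP[mf fi]; apply/integrableP; split.
  exact: measurable_affine.
have nc : (0 < `|c|%:E)%E by rewrite lte_fin normr_gt0.
move: fi; rewrite (@ge0_integral_affine c d)//; last exact: measurableT_comp.
by rewrite -[X in (_ < X)%E -> _](gt0_muley nc) lte_pmul2l.
Qed.
End affine.

(** * The fundamental theorem of calculus on ]0, +oo[ *)

Section improper_FTC.
Context {R : realType}.
Local Notation mu := (@lebesgue_measure R).
Variables (f F : R -> R) (m l : R).
Hypothesis cf : forall x : R, 0 < x -> {for x, continuous f}.
Hypothesis dF : forall x : R, 0 < x -> is_derive x 1 F (f x).
Hypothesis F0 : F x @[x --> 0^'+] --> m.
Hypothesis Fy : F x @[x --> +oo] --> l.

(** The offset 2 makes the left end strictly smaller than the right end already for n = 0, as the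
    theorem on a segment requires. *)
Let J (n : nat) : set R := `[(n.+2%:R)^-1, n.+2%:R]%classic.

Let Jab n : (n.+2%:R)^-1 < n.+2%:R :> R.
Proof.
by rewrite (@lt_trans _ _ 1)// ?invf_lt1 ?ltr1n// ltr0n.
Qed.

Let J_gt0 n x : J n x -> 0 < x.
Proof.
by rewrite /J/= in_itv/= => /andP[+ _]; apply: lt_le_trans; rewrite invr_gt0.
Qed.

Let ndJ : nondecreasing_seq J.
Proof.
move=> p q pq; rewrite subsetEset => x; rewrite /J/= !in_itv/= => /andP[px xp].
apply/andP; split.
  by apply: le_trans px; rewrite lef_pV2 ?posrE// ler_nat !ltnS.
by apply: le_trans xp _; rewrite ler_nat !ltnS.
Qed.

Let bigcupJ : \bigcup_n J n = `]0, +oo[%classic.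
Proof.
apply/seteqP; split => [x [n _ /J_gt0]|x /=]; first by rewrite /= in_itv/= andbT.
rewrite in_itv/= andbT => x0.
near \oo => n; exists n => //; rewrite /J/= in_itv/=; apply/andP; split.
  apply: (@le_trans _ _ (n.+1%:R^-1)).
    by rewrite lef_pV2 ?posrE// ler_nat.
  apply: ltW; near: n; exact: near_infty_natSinv_lt (PosNum x0).
apply: (@le_trans _ _ n%:R); last by rewrite ler_nat; lia.
by near: n; exact: nbhs_infty_ger.
Unshelve. all: by end_near. Qed.

Let cfw n : {within J n, continuous f}.
Proof.
apply: continuous_in_subspaceT => x; rewrite inE => /J_gt0; exact: cf.
Qed.

Let intJ n : (\int[mu]_(x in J n) (f x)%:E)%E = (F n.+2%:R - F (n.+2%:R)^-1)%:E.
Proof.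
have Fc x : 0 < x -> {for x, continuous F}.
  move=> x0; apply: differentiable_continuous; apply/derivable1_diffP.
  exact: (@ex_derive _ _ _ _ _ _ _ (dF x0)).
have n0 : 0 < (n.+2%:R)^-1 :> R by rewrite invr_gt0.
rewrite (@continuous_FTC2 _ f F)//.
- exact: cfw n.
- split.
  + move=> x; rewrite in_itv/= => /andP[/(lt_trans n0) x0 _].
    exact: (@ex_derive _ _ _ _ _ _ _ (dF x0)).
  + by apply: cvg_at_right_filter; exact: Fc.
  + by apply: cvg_at_left_filter; apply: Fc; rewrite ltr0n.
- move=> x; rewrite in_itv/= => /andP[/(lt_trans n0) x0 _].
by rewrite derive1E; have [_ ->] := dF x0.
Qed.

Let cvgJ : (\int[mu]_(x in J n) (f x)%:E)%E @[n --> \oo] --> (l - m)%:E.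
Proof.
under eq_fun do rewrite intJ.
apply: cvg_EFin; first exact: nearW.
apply: cvgB.
  move/cvg_pinftyP : Fy; apply.
  apply/cvgryPge => M; near=> n.
  by apply: (@le_trans _ _ n%:R); [near: n;
    exact: nbhs_infty_ger|rewrite ler_nat; lia].
move/cvg_at_rightP : F0; apply; split; first by move=> n; rewrite invr_gt0.
by have := @cvg_harmonic R; rewrite -cvg_shiftS.
Unshelve. all: by end_near. Qed.

Lemma measurable_gt0_continuous : measurable_fun `](0 : R), +oo[%classic f.
Proof.
apply: open_continuous_measurable_fun; first exact: interval_open.
by move=> x; rewrite inE/= in_itv/= andbT; exact: cf.
Qed.

Lemma ge0_integral0y_FTC2 : (forall x, 0 < x -> 0 <= f x) ->
  (\int[mu]_(x in `]0%R, +oo[) (f x)%:E)%E = (l - m)%:E.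
Proof.
move=> f0.
have mf := measurable_gt0_continuous.
have /cvg_lim <- // := @cvgJ; apply/esym/cvg_lim => //.
rewrite -bigcupJ; apply: ge0_nondecreasing_set_cvg_integral => //.
- by move=> n; exact: measurable_itv.
- move=> n; apply/measurable_EFinP; apply: measurable_funS mf => //.
  by rewrite -bigcupJ; exact: bigcup_sup.
- by move=> n x /J_gt0 x0; rewrite lee_fin f0.
Qed.

(** For a signed [f], monotone convergence along [J] is applied to both parts; integrability keeps
    the difference of the two limits away from oo - oo. *)
Lemma Rintegral0y_FTC2 : mu.-integrable `](0 : R), +oo[ (EFin \o f) ->
  \int[mu]_(x in `]0%R, +oo[) f x = l - m.
Proof.
move=> fi.
have mJ n : measurable (J n) by exact: measurable_itv.
have sJ n : J n `<=` `]0, +oo[ by rewrite -bigcupJ; exact: bigcup_sup.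
rewrite /Rintegral; suff ->
  : (\int[mu]_(x in `]0%R, +oo[) (f x)%:E)%E = (l - m)%:E by [].
have /cvg_lim <- // := @cvgJ; apply/esym/cvg_lim => //.
have mf := measurable_int _ fi.
have mfJ n : measurable_fun (J n) (EFin \o f) by apply: measurable_funS mf => //.
rewrite integralE. under eq_fun do rewrite integralE.
have fp : mu.-integrable `](0 : R),
  +oo[ ((EFin \o f)^\+)%E by exact: integrable_funepos.
have fn : mu.-integrable `](0 : R),
  +oo[ ((EFin \o f)^\-)%E by exact: integrable_funeneg.
have mp n : measurable_fun (J n) ((EFin \o f)^\+)%E by exact: measurable_funepos.
have mn n : measurable_fun (J n) ((EFin \o f)^\-)%E by exact: measurable_funeneg.
apply: cvgeB.
- by apply: fin_num_adde_defr; exact: integrable_fin_num.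
- by rewrite -bigcupJ; apply: ge0_nondecreasing_set_cvg_integral => // n; exact: mp.
- by rewrite -bigcupJ; apply: ge0_nondecreasing_set_cvg_integral => // n; exact: mn.
Qed.

End improper_FTC.

(** * Composition of two kernels by Fubini *)

Section convolution.
Context {R : realType}.
Local Notation mu := (@lebesgue_measure R).
Local Notation L1 f := (mu.-integrable setT (EFin \o f)).

Lemma integral_eq_off (c : R) (f g : R -> \bar R) :
  measurable_fun setT f -> measurable_fun setT g ->
  (forall x, x != c -> f x = g x) -> (\int[mu]_x f x = \int[mu]_x g x)%E.
Proof.
move=> mf mg fg; apply: ae_eq_integral => //.
exists [set c]; split => //=; first exact: lebesgue_measure_set1.
move=> x /=; apply: contra_notP => /eqP xc _; exact: fg.
Qed.

(* [r = 0] is excluded because the crossed kernels have a divergent integral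
   there. *)
Lemma convolution_assoc (k l m f : R -> R) :
  measurable_fun setT k -> measurable_fun setT l -> measurable_fun setT f ->
  (forall x, 0 <= k x) -> (forall x, 0 <= l x) ->
  (forall r, r != 0 -> (\int[mu]_t (k t * l (r - t))%:E)%E = (m r)%:E) ->
  L1 (fun r => m r * f r) -> (forall t, L1 (fun u => l u * f (t + u))) ->
  L1 (fun t => k t * \int[mu]_u (l u * f (t + u))) /\
  \int[mu]_t (k t * \int[mu]_u (l u * f (t + u))) = \int[mu]_r (m r * f r).
Proof.
move=> mk ml mf k0 l0 klm mi li.
(* The coordinates are t and r = t + u, so that [f] depends on the second one only. *)
pose h (p : R * R) := k p.1 * l (p.2 - p.1) * f p.2.
have mh : measurable_fun setT (EFin \o h).
  apply/measurable_EFinP; apply: measurable_funM; last exact: measurableT_comp.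
  apply: measurable_funM; first exact: measurableT_comp.
  by apply: measurableT_comp => //; exact: measurable_funB.
have mkl r : measurable_fun setT (fun t => (k t * l (r - t))%:E).
  apply/measurable_EFinP; apply: measurable_funM => //.
  by apply: measurableT_comp => //; exact: measurable_funB.
have ikl r : r != 0 -> L1 (fun t => k t * l (r - t)).
  move=> r0; apply/integrableP; split; first exact: mkl.
  under eq_integral do rewrite /= ger0_norm ?mulr_ge0//.
  by rewrite klm// ltry.
have mht t : measurable_fun setT (fun u => (h (t, u))%:E).
  by apply: (measurableT_comp mh); exact: measurable_pair1.
have hL t : (\int[mu]_u (h (t, u))%:E)%E = (k t * \int[mu]_u (l u * f (t + u)))%:E.
  rewrite -(@integral_affine1 R 1 t (fun u => (h (t, u))%:E)) ?normr1//.
  transitivity (\int[mu]_u ((k t)%:E * (l u * f (t + u))%:E))%E.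
    apply: eq_integral => u _; rewrite /h /= -EFinM mul1r -mulrA.
    by rewrite [u + t]addrC addrAC subrr add0r.
  rewrite integralZl//; last exact: li.
  by rewrite EFinM fineK//; exact: integrable_fin_num (li t).
have hR u : u != 0 -> (\int[mu]_t (h (t, u))%:E)%E = (m u * f u)%:E.
  move=> u0; under eq_integral do rewrite /h /= EFinM.
  by rewrite integralZr//; [rewrite klm// -EFinM|exact: ikl].
have hi : (mu \x mu)%E.-integrable setT (EFin \o h).
  apply/integrable21ltyP => //.
  (* For fixed r the t-integral of |h| is m r * |f r|, where m r >= 0 as the integral of a
     nonnegative function; the exceptional point r = 0 is a null set. *)
  have -> : (\int[mu]_y \int[mu]_x `|(EFin \o h) (x, y)|)%E =
            (\int[mu]_u `|(m u * f u)%:E|)%E.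
    apply: (@integral_eq_off 0).
    - have mah : measurable_fun setT (fun p => `|(EFin \o h) p|)%E by exact:
      measurableT_comp.
      exact: (@measurable_fun_fubini_tonelli_G _ _ _ _ R mu _ mah).
    - by apply: measurableT_comp => //; exact: measurable_int mi.
    move=> u u0 /=.
    transitivity (\int[mu]_t ((k t * l (u - t))%:E * `|f u|%:E))%E.
      apply: eq_integral => t _; rewrite /h/= normrM ger0_norm ?mulr_ge0//.
    rewrite integralZr//; last exact: ikl.
    by rewrite klm// -EFinM normrM ger0_norm// -lee_fin -klm// integral_ge0// =>
      t _;
      rewrite lee_fin mulr_ge0.
  by have /integrableP[] := mi.
have := integrable_fubini_F hi; rewrite /fubini_F /= => iF.
split.
  by apply: eq_integrable iF => // t _ /=; rewrite hL.
have := Fubini hi => /=.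
under eq_integral do rewrite hL.
rewrite (@integral_eq_off 0 (fun y => \int[mu]_x (h (x,
  y))%:E)%E (fun u => (m u * f u)%:E))//.
- by rewrite /Rintegral => ->.
- by have := measurable_fubini_G hi.
- exact: measurable_int mi.
Qed.

End convolution.

(** * Power kernels, Gamma and Beta *)

Section kernel.
Context {R : realType}.
Local Notation mu := (@lebesgue_measure R).
Local Notation L1 f := (mu.-integrable setT (EFin \o f)).
Implicit Types a b p r t : R.

(** Extending the power by zero puts all integrals on the whole line, where Fubini and affine
    substitutions apply, and hides the conventional values of [powR] at t <= 0. The factor 1 / Gamma
    a is added only in [rlop]. *)
Definition rlker a t : R := if 0 < t then t `^ (a - 1) else 0.

Lemma rlker_gt0E a t : 0 < t -> rlker a t = t `^ (a - 1).
Proof. by rewrite /rlker => ->. Qed.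

Lemma rlker_le0E a t : t <= 0 -> rlker a t = 0.
Proof. by rewrite /rlker ltNge => ->. Qed.

Lemma rlker_ge0 a t : 0 <= rlker a t.
Proof. by rewrite /rlker; case: ifP => // _; exact: powR_ge0. Qed.

Lemma rlker_patch a (f : R -> R) :
  (fun t => rlker a t * f t) = (fun t => t `^ (a - 1) * f t) \_ `](0 : R), +oo[.
Proof.
apply/funext => t; rewrite patchE /rlker; case: ifPn => [t0|/negbTE t0].
  by rewrite ifT// inE/= in_itv/= t0.
by rewrite mul0r ifF//; apply/negbTE; rewrite notin_setE/= in_itv/= t0.
Qed.

Lemma measurable_rlker a : measurable_fun setT (rlker a).
Proof.
have -> : rlker a = (fun y : R => y `^ (a - 1)) \_ `](0 : R), +oo[.
  transitivity (fun t => rlker a t * (cst 1) t).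
    by apply/funext => t; rewrite /cst mulr1.
  by rewrite rlker_patch; congr (_ \_ _); apply/funext => t; rewrite /cst mulr1.
apply/(measurable_restrictT _ (measurable_itv _)).
apply: measurable_funTS; exact: measurable_powR.
Qed.

Lemma rlkerZ a c t : 0 < c -> rlker a (c * t) = c `^ (a - 1) * rlker a t.
Proof.
move=> c0; rewrite /rlker pmulr_rgt0//; case: ifP => [t0|]; last by rewrite mulr0.
by rewrite powRM// ltW.
Qed.

Lemma rlkerM a b t : rlker a t * t `^ b = rlker (a + b) t.
Proof.
rewrite /rlker; case: ifPn => [t0|]; last by rewrite mul0r.
by rewrite -powRD ?(gt_eqF t0) ?implybT//; congr (_ `^ _); ring.
Qed.

Lemma integral_rlker a (f : R -> R) :
  (\int[mu]_(t in `]0%R, +oo[) (t `^ (a - 1) * f t)%:E =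
    \int[mu]_t (rlker a t * f t)%:E)%E.
Proof.
rewrite integral_mkcond; apply: eq_integral => t _.
by have := congr1 (fun g => g t) (rlker_patch a f) => ->; rewrite restrict_EFin.
Qed.

Lemma measurable_rlkerM a (f : R -> R) : measurable_fun setT f ->
  measurable_fun setT (fun t => (rlker a t * f t)%:E).
Proof.
move=> mf; apply/measurable_EFinP; apply: measurable_funM => //.
exact: measurable_rlker.
Qed.

Lemma measurable_1Dpow p : measurable_fun setT (fun t : R => (1 + t) `^ p).
Proof.
by apply: (measurableT_comp (measurable_powR p)); exact: measurable_funD.
Qed.

Lemma cvg_div1D : x / (1 + x) @[x --> (+oo : set_system R)] --> (1 : R).
Proof.
have H : (fun x : R => 1 - (1 + x)^-1) x @[x --> +oo] --> (1 : R).
  rewrite -[X in _ --> X]subr0; apply: cvgB; first exact: cvg_cst.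
  apply/gtr0_cvgV0; first by near=> x; apply: addr_gt0 => //; near: x;
    exact: nbhs_pinfty_gt.
  apply/cvgryPge => M; near=> x.
  have xM : M <= x by near: x; apply: nbhs_pinfty_ge; exact: num_real.
  by lra.
apply: cvg_trans H; apply: near_eq_cvg; near=> x.
have x0 : 0 < x by near: x; exact: nbhs_pinfty_gt.
by field; lra.
Unshelve. all: by end_near. Qed.

(** A Beta integral with an elementary primitive, (x / (1 + x)) ^ a / a. It is available before
    anything is known about Gamma and supplies the integrable majorant for the domination arguments
    on [rlker] below. *)
Lemma integral_rlker_base a : 0 < a ->
  (\int[mu]_t (rlker a t * (1 + t) `^ (- (a + 1)))%:E)%E = a^-1%:E.
Proof.
move=> a0; rewrite -integral_rlker.
have x1 (x : R) : 0 < x -> 0 < 1 + x by lra.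
pose F (x : R) := a^-1 * (x / (1 + x)) `^ a.
pose f (x : R) := x `^ (a - 1) * (1 + x) `^ (- (a + 1)).
have ac (x : R) : 0 < x -> {for x, continuous (fun y : R => y `^ (a - 1))}.
  move=> x0; apply: differentiable_continuous; apply/derivable1_diffP.
  by apply: derivable_powR; rewrite in_itv/= andbT.
have -> : a^-1%:E = (a^-1 - 0)%:E :> \bar R by rewrite subr0.
apply: (@ge0_integral0y_FTC2 R f F).
- move=> x x0; apply: cvgM; first exact: ac.
  apply: (@continuous_comp _ _ _ (fun x : R => 1 + x) (fun y : R => y `^ (- (a +
    1)))).
    by apply: cvgD; [exact: cvg_cst|exact: cvg_id].
  apply: differentiable_continuous; apply/derivable1_diffP.
  by apply: derivable_powR; rewrite in_itv/= andbT x1.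
- move=> x x0; have xx := x1 _ x0.
  have q0 : 0 < x / (1 + x) by exact: divr_gt0.
  have dq : is_derive x 1 (fun y : R => y / (1 + y)) ((1 + x) ^- 2).
    have d1 := is_derive_addf (is_derive_cstf 1 x) (is_derive_idf x).
    apply: is_derive_eq (is_derive_mulf (is_derive_idf x) (is_derive_invf _ d1)) _.
      by rewrite gt_eqF.
    by field; lra.
  have d2 := @is_derive_compf R (fun y => y `^ a) (fun y => y / (1 +
    y)) x _ _ (is_derive1_powR a q0) dq.
  rewrite /F /f; apply: is_derive_eq (is_derive_mulcf a^-1 d2) _.
  have -> : (x / (1 + x)) `^ (a - 1) = x `^ (a - 1) * (1 + x) `^ (- (a - 1)).
    by rewrite powRM ?invr_ge0 ?(ltW x0) ?(ltW xx)// -powR_inv1 ?(ltW xx)//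
      -powRrM mulN1r.
  rewrite -powR_invn ?(ltW xx)// !mulrA mulVf ?gt_eqF// mul1r -mulrA.
  by rewrite -powRD ?(gt_eqF xx) ?implybT//; congr (_ * _ `^ _); ring.
- rewrite -[X in _ --> X](mulr0 a^-1); apply: cvgM; first exact: cvg_cst.
  suff : (fun x : R => x `^ a * (1 + x) `^ (- a)) x @[x --> 0^'+] --> (0 * 1 : R).
    rewrite mul0r; apply: cvg_trans.
    apply: near_eq_cvg; near=> x.
    have x0 : 0 < x by near: x; exact: nbhs_right_gt.
    by rewrite powRM ?invr_ge0 ?(ltW x0) ?(ltW (x1 _ _))// -powR_inv1 ?(ltW (x1 _
      _))// -powRrM mulN1r.
  apply: cvgM; first exact: powR_cvg0.
  have C : {for (0 : R), continuous (fun x : R => (1 + x) `^ (- a))}.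
    apply: (@continuous_comp _ _ _ (fun x : R => 1 + x) (fun y : R => y `^ (- a))).
      by apply: cvgD; [exact: cvg_cst|exact: cvg_id].
    apply: derivable_continuous; apply: derivable_powR.
    by rewrite in_itv/= andbT addr0.
  by have := cvg_at_right_filter C; rewrite addr0 powR1.
- rewrite -[X in _ --> X]mulr1; apply: cvgM; first exact: cvg_cst.
  have C : {for (1 : R), continuous (fun y : R => y `^ a)}.
    by apply: derivable_continuous; apply: derivable_powR; rewrite in_itv/= andbT.
  by have := cvg_comp _ _ cvg_div1D C; rewrite powR1.
- by move=> x _; rewrite mulr_ge0 ?powR_ge0.
Unshelve. all: by end_near. Qed.

End kernel.

(** * The Gamma integral and its Laplace form *)

Section gamma.
Context {R : realType}.
Local Notation mu := (@lebesgue_measure R).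
Local Notation L1 f := (mu.-integrable setT (EFin \o f)).
Implicit Types a b c p r t : R.

Lemma powR_le_expR p : 0 <= p -> exists2 C : R, 0 < C &
  forall t, 0 <= t -> expR (- t) <= C * (1 + t) `^ (- p).
Proof.
move=> p0; pose n := (Num.truncn p).+1.
have pn : p <= n%:R by apply: ltW; exact: truncnS_gt.
(* From one term of the exponential series: (1 + t) ^ n / n! <= expR (1 + t) = e * expR t. *)
exists (n`!%:R * expR 1); first by rewrite mulr_gt0 ?expR_gt0// ltr0n fact_gt0.
move=> t t0; have t1 : 0 < 1 + t by lra.
rewrite powRN ler_pdivlMr ?powR_gt0//.
have : (1 + t) `^ p <= (1 + t) ^+ n.
  by rewrite -powR_mulrn ?(ltW t1)//; apply: ler_powR => //; lra.
move=> /(ler_wpM2l (expR_ge0 (- t))) /le_trans; apply.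
have := @expR_ge1Dxn R (1 + t) n.-1 (ltW t1); rewrite /n /= -/n => H.
have {}H : (1 + t) ^+ n / n`!%:R <= expR (1 + t) by apply: le_trans H; lra.
rewrite ler_pdivrMr ?ltr0n ?fact_gt0// in H.
rewrite mulrC; apply: (le_trans (ler_wpM2r (expR_ge0 (- t)) H)).
by rewrite mulrAC -expRD addrK mulrC.
Qed.

Lemma integrable_rlker_base a : 0 < a ->
  L1 (fun t => rlker a t * (1 + t) `^ (- (a + 1))).
Proof.
move=> a0; apply/integrableP; split.
  by apply: measurable_rlkerM; exact: measurable_1Dpow.
under eq_integral do rewrite /= ger0_norm ?mulr_ge0 ?rlker_ge0 ?powR_ge0//.
by rewrite integral_rlker_base// ltry.
Qed.

Lemma integrable_rlkerM a (f : R -> R) (C : R) : 0 < a -> measurable_fun setT f ->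
  (forall t, 0 < t -> `|f t| <= C * (1 + t) `^ (- (a + 1))) ->
  L1 (fun t => rlker a t * f t).
Proof.
move=> a0 mf fC.
have := integrableZl measurableT C (integrable_rlker_base a0).
apply: le_integrable => //; first exact: measurable_rlkerM.
move=> t _ /=; rewrite lee_fin; case: (ltP 0 t) => [t0|t0]; last first.
  by rewrite !rlker_le0E// !mul0r normr0.
rewrite mulrCA !normrM ler_wpM2l// -normrM; apply: (le_trans (fC _ t0)).
exact: ler_norm.
Qed.

Lemma integrable_rlker_exp a : 0 < a -> L1 (fun t => rlker a t * expR (- t)).
Proof.
move=> a0; have [|C C0 HC] := @powR_le_expR (a + 1); first by lra.
apply: (@integrable_rlkerM _ _ C) => //; first exact: measurableT_comp.
by move=> t /ltW t0; rewrite ger0_norm ?expR_ge0// HC.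
Qed.

Lemma integral_rlker_exp a : 0 < a ->
  (\int[mu]_t (rlker a t * expR (- t))%:E)%E = (Gamma a)%:E.
Proof.
move=> a0; rewrite /Gamma /Rintegral integral_rlker fineK//.
exact: integrable_fin_num (integrable_rlker_exp a0).
Qed.

Lemma Gamma_gt0 a : 0 < a -> 0 < Gamma a.
Proof.
move=> a0; rewrite -lte_fin -integral_rlker_exp//.
(* A lower bound of the integrand on [1, 2]: there t ^ (a - 1) >= t ^ (-1) >= 1 / 2, because a >
   0. *)
pose c : R := expR (- 2) / 2.
have c0 : 0 < c by rewrite divr_gt0 ?expR_gt0.
apply: (@lt_le_trans _ _ (\int[mu]_(t in `[1%R, 2%R]) c%:E)%E).
  rewrite integral_cst//= lebesgue_measure_itv/= lte_fin ltr1n -EFinB -EFinM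
    lte_fin.
  by rewrite mulr_gt0//; lra.
have me : measurable_fun setT (fun t => (rlker a t * expR (- t))%:E).
  by apply: measurable_rlkerM; exact: measurableT_comp.
apply: (@le_trans _ _ (\int[mu]_(t in `[1%R, 2%R]) (rlker a t * expR (- t))%:E)%E).
  apply: ge0_le_integral => //.
  - by move=> t _; rewrite lee_fin ltW.
  - exact: measurable_funTS.
  move=> t /=; rewrite in_itv/= => /andP[t1 t2].
  rewrite lee_fin rlker_gt0E; last by lra.
  rewrite /c mulrC; apply: ler_pM; rewrite ?invr_ge0 ?expR_ge0//.
    apply: (@le_trans _ _ t^-1); first by rewrite lef_pV2 ?posrE//; lra.
    by rewrite -powR_inv1 ?ler_powR//; lra.
  by rewrite ler_expR; lra.
apply: ge0_subset_integral => // t _;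
  rewrite lee_fin mulr_ge0 ?rlker_ge0 ?expR_ge0//.
Qed.

Lemma integral_rlker_expM a c : 0 < a -> 0 < c ->
  (\int[mu]_t (rlker a t * expR (- (c * t)))%:E)%E = (c `^ (- a) * Gamma a)%:E.
Proof.
move=> a0 c0.
have mc : measurable_fun setT (fun t => (rlker a t * expR (- (c * t)))%:E).
  apply: measurable_rlkerM; apply: measurableT_comp => //.
  by apply: measurableT_comp => //; exact: measurable_funM.
have : ((Gamma a)%:E = (c `^ a)%:E * (\int[mu]_t (rlker a t * expR (- (c *
  t)))%:E))%E.
  rewrite -integral_rlker_exp// (@ge0_integral_affine R c 0)//=; last 3 first.
  - by rewrite gt_eqF.
  - by apply: measurable_rlkerM; exact: measurableT_comp.
  - by move=> t; rewrite lee_fin mulr_ge0 ?rlker_ge0 ?expR_ge0.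
  under eq_integral do rewrite addr0 rlkerZ// -mulrA EFinM.
  rewrite ge0_integralZl//; last 2 first.
  - by move=> t _; rewrite lee_fin mulr_ge0 ?rlker_ge0 ?expR_ge0.
  - by rewrite lee_fin powR_ge0.
  rewrite muleA -EFinM gtr0_norm//; congr (_%:E * _)%E.
  by rewrite mulr_powRB1// ltW.
move=> H; rewrite powRN EFinM H muleA -EFinM mulVf ?mul1e//.
by rewrite gt_eqF// powR_gt0.
Qed.

(** Gamma p * (1 + t) ^ (- p) is the integral over s > 0 of s ^ (p - 1) * exp (- (1 + t) s). After
    exchanging the integrals, the one in t gives Gamma a * s ^ (- a), and what remains is the
    integral for Gamma (p - a). *)
Lemma integral_rlker_1Dpow a p : 0 < a -> a < p ->
  (\int[mu]_t (rlker a t * (1 + t) `^ (- p))%:E)%E =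
  (Gamma a * Gamma (p - a) / Gamma p)%:E.
Proof.
move=> a0 ap; have p0 : 0 < p by exact: lt_trans ap.
pose h (z : R * R) := rlker a z.1 * (rlker p z.2 * expR (- ((1 + z.1) * z.2))).
have h0 z : 0 <= h z by rewrite /h !mulr_ge0 ?rlker_ge0 ?expR_ge0.
have mr q : measurable_fun setT (rlker q : R -> R) by exact: measurable_rlker.
have mh : measurable_fun setT (EFin \o h).
  apply/measurable_EFinP; apply: measurable_funM; first exact: measurableT_comp.
  apply: measurable_funM; first exact: measurableT_comp.
  apply: measurableT_comp => //; apply: measurableT_comp => //.
  by apply: measurable_funM => //; exact: measurable_funD.
have mp : measurable_fun setT (fun t => (rlker a t * (1 + t) `^ (- p))%:E).
  by apply: measurable_rlkerM; exact: measurable_1Dpow.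
suff : ((Gamma p)%:E * \int[mu]_t (rlker a t * (1 + t) `^ (- p))%:E)%E =
  (Gamma a * Gamma (p - a))%:E.
  move=> H; rewrite mulrC EFinM -H muleA -EFinM mulVf ?mul1e//.
  by rewrite gt_eqF// Gamma_gt0.
rewrite -ge0_integralZl//; last 2 first.
  by move=> t _; rewrite lee_fin mulr_ge0 ?rlker_ge0 ?powR_ge0.
  by rewrite lee_fin ltW// Gamma_gt0.
transitivity (\int[mu]_t \int[mu]_s (h (t, s))%:E)%E.
  apply: eq_integral => t _; case: (ltP 0 t) => t0; last first.
    rewrite rlker_le0E// mul0r mule0 integral0_eq// => s _.
    by rewrite /h /= rlker_le0E// mul0r.
  under eq_integral do rewrite /h /= EFinM.
  rewrite ge0_integralZl//; last 3 first.
  - apply: measurable_rlkerM; apply: measurableT_comp => //.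
    by apply: measurableT_comp => //; exact: measurable_funM.
  - by move=> s _; rewrite lee_fin mulr_ge0 ?rlker_ge0 ?expR_ge0.
  - by rewrite lee_fin rlker_ge0.
  by rewrite integral_rlker_expM//; [rewrite -!EFinM; congr (_%:E); ring|lra].
rewrite (@fubini_tonelli _ _ _ _ _ mu mu (EFin \o h))//.
transitivity (\int[mu]_s ((Gamma a)%:E * (rlker (p - a) s * expR (- s))%:E))%E.
  apply: eq_integral => s _; case: (ltP 0 s) => s0; last first.
    rewrite rlker_le0E// mul0r mule0 integral0_eq// => t _.
    by rewrite /h /= (@rlker_le0E _ p)// mul0r mulr0.
  transitivity (\int[mu]_t ((rlker p s * expR (- s))%:E * (rlker a t * expR (- (s
    * t)))%:E))%E.
    apply: eq_integral => t _; rewrite /h /= -EFinM; congr (_%:E).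
    by rewrite mulrDl mul1r opprD expRD [t * s]mulrC; ring.
  rewrite ge0_integralZl//; last 3 first.
  - apply: measurable_rlkerM; apply: measurableT_comp => //.
    by apply: measurableT_comp => //; exact: measurable_funM.
  - by move=> t _; rewrite lee_fin mulr_ge0 ?rlker_ge0 ?expR_ge0.
  - by rewrite lee_fin mulr_ge0 ?rlker_ge0 ?expR_ge0.
  by rewrite integral_rlker_expM// -!EFinM -rlkerM; congr (_%:E); ring.
rewrite ge0_integralZl//; last 3 first.
- by apply: measurable_rlkerM; exact: measurableT_comp.
- by move=> t _; rewrite lee_fin mulr_ge0 ?rlker_ge0 ?expR_ge0.
- by rewrite lee_fin ltW// Gamma_gt0.
by rewrite integral_rlker_exp ?EFinM// subr_gt0.
Qed.

End gamma.

(* Otherwise unification unfolds the integral defining [Gamma]. *)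
Opaque Gamma rlker.

(** * The Beta integral and convolutions of power kernels *)

Section beta.
Context {R : realType}.
Local Notation mu := (@lebesgue_measure R).
Local Notation L1 f := (mu.-integrable setT (EFin \o f)).
Implicit Types a b c p r t : R.

Lemma ge0_EFin_integralZl c (f : R ->
  R) : measurable_fun setT (fun t => (f t)%:E) ->
  (forall t, 0 <= f t) -> 0 <= c ->
  (\int[mu]_t (c%:E * (f t)%:E) = c%:E * \int[mu]_t (f t)%:E)%E.
Proof. by move=> mf f0 c0; rewrite ge0_integralZl// => t _; rewrite lee_fin. Qed.

Lemma measurable_rlker_affine a c r : measurable_fun setT (fun t => rlker a (c *
  t + r)).
Proof.
apply: (measurableT_comp (measurable_rlker a)).
by apply: measurable_funD => //; exact: measurable_funM.
Qed.

Lemma measurable_rlkerMM a b c r :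
  measurable_fun setT (fun t => (rlker a t * rlker b (c * t + r))%:E).
Proof. by apply: measurable_rlkerM; exact: measurable_rlker_affine. Qed.

(** Homogeneity: t = r t' pulls out r * r ^ (a - 1) * r ^ (b - 1). The coefficient [c] covers two
    cases, -1 for kernels pointing the same way and 1 for opposite ones. *)
Lemma integral_rlkerMM a b c r : 0 < r ->
  (\int[mu]_t (rlker a t * rlker b (c * t + r))%:E =
   (r `^ (a + b - 1))%:E * \int[mu]_t (rlker a t * rlker b (c * t + 1))%:E)%E.
Proof.
move=> r0; have rn0 : r != 0 by rewrite gt_eqF.
have h0 t : (0 <= (rlker a t * rlker b (c * t + r))%:E)%E.
  by rewrite lee_fin mulr_ge0 ?rlker_ge0.
rewrite [LHS](@ge0_integral_affine R r 0 _ rn0 (measurable_rlkerMM a b c r) h0).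
transitivity (`|r|%:E * \int[mu]_t ((r `^ (a - 1) * r `^ (b - 1))%:E *
    (rlker a t * rlker b (c * t + 1))%:E))%E.
  congr (_ * _)%E; apply: eq_integral => t _; rewrite addr0 -EFinM; congr (_%:E).
  have -> : c * (r * t) + r = r * (c * t + 1) by ring.
  by rewrite !rlkerZ//; ring.
rewrite ge0_EFin_integralZl; last 3 first.
- exact: measurable_rlkerMM.
- by move=> t; rewrite mulr_ge0 ?rlker_ge0.
- by rewrite mulr_ge0 ?powR_ge0.
rewrite muleA -EFinM; congr (_%:E * _)%E.
rewrite gtr0_norm// mulrA -[X in X * _ * _](@powRr1 _ r) ?(ltW r0)//.
by rewrite -!powRD ?(gt_eqF r0) ?implybT//; congr (_ `^ _); ring.
Qed.

(** Both sides are the integral of t ^ (a - 1) * (u - t) ^ (b - 1) * exp (- u) over 0 < t < u,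
    computed in the two orders. The product form avoids dividing while the Beta integral may still
    be infinite. *)
Lemma integral_beta_mul a b : 0 < a -> 0 < b ->
  ((Gamma (a + b))%:E * \int[mu]_t (rlker a t * rlker b (-1 * t + 1))%:E)%E =
  (Gamma a * Gamma b)%:E.
Proof.
move=> a0 b0; have ab0 : 0 < a + b by exact: addr_gt0.
have mr q : measurable_fun setT (rlker q : R -> R) by exact: measurable_rlker.
have me q : measurable_fun setT (fun t => (rlker q t * expR (- t))%:E).
  by apply: measurable_rlkerM; exact: measurableT_comp.
have e0 q t : 0 <= rlker q t * expR (- t) by rewrite mulr_ge0 ?rlker_ge0 ?expR_ge0.
pose h (z : R * R) := rlker a z.1 * (rlker b (z.2 - z.1) * expR (- z.2)).
have h0 z : (0 <= (EFin \o h) z)%E.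
  by rewrite lee_fin /h !mulr_ge0 ?rlker_ge0 ?expR_ge0.
have mh : measurable_fun setT (EFin \o h).
  apply/measurable_EFinP; apply: measurable_funM; first exact: measurableT_comp.
  apply: measurable_funM; first by apply: measurableT_comp => //;
    exact: measurable_funB.
  by do 2 apply: measurableT_comp => //.
transitivity (\int[mu]_u \int[mu]_t (h (t, u))%:E)%E.
  rewrite -(integral_rlker_exp ab0) -ge0_integralZr; last 4 first.
  - exact: measurableT.
  - exact: me.
  - by move=> t _; rewrite lee_fin e0.
  - by apply: integral_ge0 => t _; rewrite lee_fin mulr_ge0 ?rlker_ge0.
  apply: eq_integral => u _; case: (ltP 0 u) => u0; last first.
    rewrite (rlker_le0E _ u0) mul0r mul0e integral0_eq// => t _; rewrite /h /=.
    case: (ltP 0 t) => t0; last by rewrite (rlker_le0E _ t0) mul0r.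
    by rewrite (@rlker_le0E _ b) ?mul0r ?mulr0//; lra.
  transitivity (\int[mu]_t ((expR (- u))%:E * (rlker a t * rlker b (-1 * t +
    u))%:E))%E.
    rewrite ge0_EFin_integralZl; last 3 first.
    - exact: measurable_rlkerMM.
    - by move=> t; rewrite mulr_ge0 ?rlker_ge0.
    - exact: expR_ge0.
    rewrite (integral_rlkerMM a b (-1) u0) muleA -EFinM (rlker_gt0E _ u0).
    by rewrite mulrC.
  apply: eq_integral => t _; rewrite /h /= -EFinM; congr (_%:E).
  by rewrite mulN1r [- t + u]addrC; ring.
transitivity (\int[mu]_t \int[mu]_u (h (t, u))%:E)%E.
  exact/esym/(@fubini_tonelli _ _ _ _ R mu mu (EFin \o h) mh h0).
transitivity (\int[mu]_t ((rlker a t * expR (- t))%:E * (Gamma b)%:E))%E.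
  apply: eq_integral => t _.
  rewrite -(integral_rlker_exp b0) -ge0_EFin_integralZl;
    [|exact: me|exact: e0|exact: e0].
  have mht : measurable_fun setT (fun u => (h (t, u))%:E).
    by apply: (measurableT_comp mh); exact: measurable_pair1.
  rewrite -[LHS](@integral_affine1 R 1 t _ (normr1 _) mht).
  apply: eq_integral => u _; rewrite /h /= -EFinM mul1r addrK opprD expRD.
  by congr (_%:E); ring.
rewrite ge0_integralZr; last 4 first.
- exact: measurableT.
- exact: me.
- by move=> t _; rewrite lee_fin e0.
- by rewrite lee_fin ltW// Gamma_gt0.
by rewrite (integral_rlker_exp a0) -EFinM.
Qed.

Lemma integral_beta a b : 0 < a -> 0 < b ->
  (\int[mu]_t (rlker a t * rlker b (-1 * t + 1))%:E)%E =
  (Gamma a * Gamma b / Gamma (a + b))%:E.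
Proof.
move=> a0 b0; have G0 : Gamma (a + b) != 0.
  by apply: lt0r_neq0; apply: Gamma_gt0; exact: addr_gt0.
rewrite mulrC EFinM -(integral_beta_mul a0 b0) muleA -EFinM (mulVf G0).
by rewrite mul1e.
Qed.

Lemma integral_rlker_convolution a b r : 0 < a -> 0 < b -> r != 0 ->
  (\int[mu]_t (rlker a t * rlker b (r - t))%:E)%E =
  (Gamma a * Gamma b / Gamma (a + b) * rlker (a + b) r)%:E.
Proof.
move=> a0 b0 _; case: (ltP 0 r) => r0; last first.
  rewrite [in RHS]rlker_le0E// mulr0 integral0_eq// => t _.
  case: (ltP 0 t) => t0; last by rewrite rlker_le0E// mul0r.
  by rewrite (@rlker_le0E _ b) ?mulr0//; lra.
under eq_integral do rewrite [r - _]addrC -mulN1r.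
by rewrite (integral_rlkerMM a b (-1) r0) integral_beta// -EFinM (rlker_gt0E _
  r0) mulrC.
Qed.

(** For r = 1 the integrand is t ^ (a - 1) * (1 + t) ^ (- (1 - b)), so [integral_rlker_1Dpow]
    applies with p = 1 - b. Its condition a < p is a + b < 1, the convergence at infinity. *)
Lemma integral_rlker_shift a b r : 0 < a -> a + b < 1 -> 0 < r ->
  (\int[mu]_t (rlker a t * rlker b (t + r))%:E)%E =
  (Gamma a * Gamma (1 - (a + b)) / Gamma (1 - b) * rlker (a + b) r)%:E.
Proof.
move=> a0 ab r0; under eq_integral do rewrite -[X in rlker b (X + _)]mul1r.
rewrite integral_rlkerMM//.
transitivity ((r `^ (a + b - 1))%:E * \int[mu]_t (rlker a t * (1 +
  t) `^ (- (1 - b)))%:E)%E.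
  congr (_ * _)%E; apply: eq_integral => t _; case: (ltP 0 t) => t0; last first.
    by rewrite rlker_le0E// !mul0r.
  rewrite [X in _ * X]rlker_gt0E ?mul1r; last by lra.
  by rewrite opprB [1 + t]addrC.
rewrite integral_rlker_1Dpow//; last by lra.
have -> : 1 - b - a = 1 - (a + b) by ring.
rewrite -EFinM (rlker_gt0E _ r0) mulrC; exact: erefl.
Qed.

(** For r < 0 the singularity of the second kernel lies left of the origin and the previous lemma
    applies. For r > 0 the integral starts at r, and t -> t + r exchanges the roles of a and b. At r
    = 0 the integrand is t ^ (a + b - 2), which diverges. *)
Lemma integral_rlker_crossed a b r : 0 < a -> 0 < b -> a + b < 1 -> r != 0 ->
  (\int[mu]_t (rlker a t * rlker b (- (r - t)))%:E)%E =
  (Gamma a * Gamma (1 - (a + b)) / Gamma (1 - b) * rlker (a + b) (- r) +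
   Gamma b * Gamma (1 - (a + b)) / Gamma (1 - a) * rlker (a + b) r)%:E.
Proof.
move=> a0 b0 ab; rewrite neq_lt => /orP[r0|r0].
  have Nr0 : 0 < - r by rewrite oppr_gt0.
  under eq_integral do rewrite opprB.
  rewrite (integral_rlker_shift a0 ab Nr0) (rlker_le0E _ (ltW r0)) mulr0 addr0.
  exact: erefl.
have Nr0 : - r <= 0 by rewrite oppr_le0 ltW.
have ba : b + a < 1 by rewrite addrC.
rewrite (rlker_le0E _ Nr0) mulr0 add0r [a +
  b]addrC -(integral_rlker_shift b0 ba r0).
have m : measurable_fun setT (fun t => (rlker a t * rlker b (- (r - t)))%:E).
  have := @measurable_rlkerMM a b 1 (- r).
  by under eq_fun do rewrite mul1r -opprB.
rewrite -(@integral_affine1 R 1 r _ (normr1 _) m).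
by apply: eq_integral => t _; rewrite mul1r opprB addrK mulrC.
Qed.

End beta.

(** * Euler's reflection formula *)

Lemma cvg_powR_lt0 (R : realType) (k : R) : k < 0 -> t `^ k @[t --> +oo] --> 0.
Proof.
move=> k0; apply/cvgr0Pnorm_le => e e0; near=> t.
have M0 : 0 < e `^ k^-1 by exact: powR_gt0.
have tM : e `^ k^-1 <= t by near: t; apply: nbhs_pinfty_ge; exact: num_real.
have t0 : 0 < t := lt_le_trans M0 tM.
rewrite ger0_norm ?powR_ge0// -[k]opprK powRN -[leRHS]invrK.
rewrite lef_pV2 ?posrE ?powR_gt0 ?invr_gt0//.
have -> : e^-1 = (e `^ k^-1) `^ (- k).
  by rewrite -powRrM mulrN mulVf ?lt_eqF// powR_inv1// ltW.
by apply: ge0_ler_powR => //; rewrite ?nnegrE ?oppr_ge0 ltW.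
Unshelve. all: by end_near. Qed.

(** * Rotating the ray of integration *)

Section rotation.
Context {R : realType}.
Local Notation mu := (@lebesgue_measure R).
Variable a : R.
Hypothesis a01 : 0 < a < 1.
Let c := 1 - a.
Implicit Types s t : R.

(** The squared modulus of t + i e^(-is), whose parts are t + sin s and cos s. It runs from 1 + t ^
    2 at s = 0 to (1 + t) ^ 2 at s = pi / 2. *)
Definition rot_den s t : R := t ^+ 2 + 2 * t * sin s + 1.
(* With c = 1 - a, [q s t] and [- p s t] are the real part of
   e^(-ics) t^(a-1) / (t + i e^(-is)) and the imaginary part of
   e^(-ics) t^a / (t + i e^(-is)); [dq] is both dq/ds and dp/dt. *)
Let q s t : R := t `^ (a - 1) * ((t * cos (c * s) + sin (a * s)) / rot_den s t).
Let dq s t : R := t `^ (a - 1) *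
  (((- c * t * sin (c * s) + a * cos (a * s)) * rot_den s t -
    (t * cos (c * s) + sin (a * s)) * (2 * t * cos s)) / rot_den s t ^+ 2).
Let p s t : R := t `^ a * ((t * sin (c * s) + cos (a * s)) / rot_den s t).

(** With sin s >= -1/2 the denominator is at least t ^ 2 - t + 1, which exceeds (1 + t) ^ 2 / 4 by 3
    (t - 1) ^ 2 / 4. Allowing negative sines leaves room for an open interval of angles around 0. *)
Lemma rot_den_ge s t : - 2^-1 <= sin s -> 0 < t -> (1 + t) ^+ 2 / 4 <= rot_den s t.
Proof.
move=> s1 t0; have h1 : 0 <= t * (sin s + 2^-1) by rewrite mulr_ge0 ?(ltW t0)//;
  lra.
by have h2 : 0 <= (t - 1) ^+ 2 := sqr_ge0 _; rewrite /rot_den; nra.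
Qed.

Lemma rot_den_gt0 s t : - 2^-1 <= sin s -> 0 < t -> 0 < rot_den s t.
Proof.
move=> s1 t0; apply: lt_le_trans (rot_den_ge s1 t0).
by rewrite divr_gt0// exprn_gt0//; lra.
Qed.

Let is_derive_sinM (k s : R) : is_derive s 1 (fun x => sin (k * x)) (k * cos (k *
  s)).
Proof.
apply: is_derive_eq (@is_derive_compf _ sin (fun x => k * x) s _ _ (is_derive_sin _)
  (is_derive_mulcf k (is_derive_idf s))) _.
by rewrite mulr1 mulrC.
Qed.

Let is_derive_cosM (k s : R) : is_derive s 1 (fun x => cos (k * x)) (- k * sin (k
  * s)).
Proof.
apply: is_derive_eq (@is_derive_compf _ cos (fun x => k * x) s _ _ (is_derive_cos _)
  (is_derive_mulcf k (is_derive_idf s))) _.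
by rewrite mulr1 mulrC mulrN mulNr.
Qed.

Let is_derive_q s t : - 2^-1 <= sin s -> 0 < t -> is_derive s 1 (q ^~ t) (dq s t).
Proof.
move=> s1 t0; have D0 := lt0r_neq0 (rot_den_gt0 s1 t0).
have d1 := is_derive_addf (is_derive_mulcf t (is_derive_cosM c s))
  (is_derive_sinM a s).
have d2 : is_derive s 1 (rot_den ^~ t) (2 * t * cos s).
  apply: is_derive_eq (is_derive_addf (is_derive_addf (is_derive_cstf (t ^+ 2) s)
    (is_derive_mulcf (2 * t) (is_derive_sin s))) (is_derive_cstf 1 s)) _.
  by rewrite add0r addr0.
have d3 := @is_derive_invf _ (rot_den ^~ t) _ _ D0 d2.
apply: is_derive_eq (is_derive_mulcf (t `^ (a - 1)) (is_derive_mulf d1 d3)) _.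
by rewrite /dq; field.
Qed.

Let is_derive_p s t : - 2^-1 <= sin s -> 0 < t -> is_derive t 1 (p s) (dq s t).
Proof.
move=> s1 t0; have D0 := lt0r_neq0 (rot_den_gt0 s1 t0).
have d1 : is_derive t 1 (fun t => t * sin (c * s) + cos (a * s)) (sin (c * s)).
  apply: is_derive_eq (is_derive_addf (is_derive_mulf (is_derive_idf t)
    (is_derive_cstf (sin (c * s)) t)) (is_derive_cstf (cos (a * s)) t)) _.
  by ring.
have d2 : is_derive t 1 (rot_den s) (2 * t + 2 * sin s).
  apply: is_derive_eq (is_derive_addf (is_derive_addf (is_derive_mulf
    (is_derive_idf t) (is_derive_idf t))
    (is_derive_mulf (is_derive_mulcf 2 (is_derive_idf t)) (is_derive_cstf (sin s)
      t))) (is_derive_cstf 1 t)) _.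
  by ring.
have d3 := @is_derive_invf _ (rot_den s) _ _ D0 d2.
apply: is_derive_eq (is_derive_mulf (is_derive1_powR a t0) (is_derive_mulf d1
  d3)) _.
have /andP[a0 _] := a01; rewrite /dq -(mulr_powRB1 (ltW t0) a0).
(* Since a s = s - c s, everything becomes a rational identity in the sines and cosines of s and c
   s, valid modulo cos ^ 2 + sin ^ 2 = 1. *)
have -> : cos (a * s) = cos s * cos (c * s) + sin s * sin (c * s).
  by rewrite -cosB; congr cos; rewrite /c; ring.
have -> : sin (a * s) = sin s * cos (c * s) - cos s * sin (c * s).
  by rewrite -sinB; congr sin; rewrite /c; ring.
have e : cos s ^+ 2 = 1 - sin s ^+ 2 by exact: cos2sin2.
set P := t `^ (a - 1); set S := sin (c * s); set C := cos (c * s).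
move: D0; rewrite /rot_den /c => D0.
by field: e.
Qed.

Let rot_den_cont s t : {for t, continuous (rot_den s)}.
Proof.
apply: cvgD; last exact: cvg_cst.
apply: cvgD; first by apply: cvgM; exact: cvg_id.
by apply: cvgM; last exact: cvg_cst; apply: cvgM; [exact: cvg_cst|exact: cvg_id].
Qed.

Let powR_cont (k t : R) : 0 < t -> {for t, continuous (fun x : R => x `^ k)}.
Proof.
move=> t0; apply: derivable_continuous; apply: is_derive_derivable.
exact: is_derive1_powR.
Qed.

Let dq_cont s t : - 2^-1 <= sin s -> 0 < t -> {for t, continuous (dq s)}.
Proof.
move=> s1 t0; have D0 := lt0r_neq0 (rot_den_gt0 s1 t0).
have ct : cvg_to (nbhs (fmap (fun x : R => x) (nbhs t))) (nbhs t) by exact: cvg_id.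
have cD : rot_den s x @[x --> t] --> rot_den s t := @rot_den_cont s t.
apply: cvgM; first exact: powR_cont.
apply: cvgM; last first.
  by apply: cvgV; [rewrite expf_neq0|exact: cvgM].
apply: cvgB.
  apply: cvgM; last exact: cD.
  apply: cvgD; last exact: cvg_cst.
  by apply: cvgM; last exact: cvg_cst; apply: cvgM; first exact: cvg_cst.
apply: cvgM.
  by apply: cvgD; last exact: cvg_cst; apply: cvgM; last exact: cvg_cst.
by apply: cvgM; last exact: cvg_cst; apply: cvgM; first exact: cvg_cst.
Qed.

Let q_cont s t : - 2^-1 <= sin s -> 0 < t -> {for t, continuous (q s)}.
Proof.
move=> s1 t0; have D0 := lt0r_neq0 (rot_den_gt0 s1 t0).
have cD : rot_den s x @[x --> t] --> rot_den s t := @rot_den_cont s t.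
apply: cvgM; first exact: powR_cont.
apply: cvgM; last exact: cvgV.
by apply: cvgD; last exact: cvg_cst; apply: cvgM; [exact: cvg_id|exact: cvg_cst].
Qed.

Let inv_den_le s t : - 2^-1 <= sin s -> 0 < t ->
  (rot_den s t)^-1 <= 4 / (1 + t) ^+ 2.
Proof.
move=> s1 t0; have t1 : 0 < 1 + t by lra.
rewrite -[X in _ <= X]invrK lef_pV2 ?posrE ?rot_den_gt0//; last first.
  by rewrite invr_gt0 divr_gt0 ?exprn_gt0.
by rewrite invf_div rot_den_ge.
Qed.

Let normM1 (x y : R) : `|y| <= 1 -> `|x * y| <= `|x|.
Proof. by move=> y1; rewrite normrM ler_piMr. Qed.

Let q_le s t : - 2^-1 <= sin s -> 0 < t -> `|q s t| <= 4 * (t `^ (a - 1) / (1 + t)).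
Proof.
move=> s1 t0; have t1 : 0 < 1 + t by lra.
have D0 := rot_den_gt0 s1 t0.
rewrite /q normrM ger0_norm ?powR_ge0// mulrCA ler_wpM2l ?powR_ge0//.
rewrite normrM [X in _ * X]gtr0_norm ?invr_gt0//.
have n1 : `|t * cos (c * s) + sin (a * s)| <= 1 + t.
  rewrite addrC; apply: le_trans (ler_normD _ _) _; apply: lerD;
    first exact: sin_max.
  by apply: le_trans (normM1 _ (cos_max _)) _; rewrite gtr0_norm.
apply: (le_trans (ler_pM _ _ n1 (inv_den_le s1 t0))); rewrite ?invr_ge0 ?(ltW D0)//.
by rewrite le_eqVlt; apply/orP; left; apply/eqP; field; lra.
Qed.

(** The bound tends to 0 at 0 because a > 0 and at +oo because a < 1; this removes the boundary
    terms in [integral_dq]. *)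
Let p_le s t : - 2^-1 <= sin s -> 0 < t -> `|p s t| <= 4 * (t `^ a / (1 + t)).
Proof.
move=> s1 t0; have t1 : 0 < 1 + t by lra.
have D0 := rot_den_gt0 s1 t0.
rewrite /p normrM ger0_norm ?powR_ge0// mulrCA ler_wpM2l ?powR_ge0//.
rewrite normrM [X in _ * X]gtr0_norm ?invr_gt0//.
have n1 : `|t * sin (c * s) + cos (a * s)| <= 1 + t.
  rewrite addrC; apply: le_trans (ler_normD _ _) _; apply: lerD;
    first exact: cos_max.
  by apply: le_trans (normM1 _ (sin_max _)) _; rewrite gtr0_norm.
apply: (le_trans (ler_pM _ _ n1 (inv_den_le s1 t0))); rewrite ?invr_ge0 ?(ltW D0)//.
by rewrite le_eqVlt; apply/orP; left; apply/eqP; field; lra.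
Qed.

(** 36 = 4 + 32: the derivative of the numerator contributes 4 / (1 + t), that of the denominator 32
    / (1 + t) ^ 2. *)
Let dq_le s t : - 2^-1 <= sin s -> 0 < t ->
  `|dq s t| <= 36 * (t `^ (a - 1) / (1 + t)).
Proof.
move=> s1 t0; have t1 : 0 < 1 + t by lra.
have /andP[a0 a1] := a01.
have D0 := rot_den_gt0 s1 t0;
  have iD0 : 0 <= (rot_den s t)^-1 by rewrite invr_ge0 ltW.
rewrite /dq normrM ger0_norm ?powR_ge0// [leRHS]mulrCA ler_wpM2l ?powR_ge0//.
have -> : ((- c * t * sin (c * s) + a * cos (a * s)) * rot_den s t -
    (t * cos (c * s) + sin (a * s)) * (2 * t * cos s)) / rot_den s t ^+ 2 =
  (- c * t * sin (c * s) + a * cos (a * s)) / rot_den s t -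
  (t * cos (c * s) + sin (a * s)) * (2 * t * cos s) * (rot_den s t)^-1 ^+ 2.
  by field; exact: lt0r_neq0.
have n1 : `|t * cos (c * s) + sin (a * s)| <= 1 + t.
  rewrite addrC; apply: le_trans (ler_normD _ _) _; apply: lerD;
    first exact: sin_max.
  by apply: le_trans (normM1 _ (cos_max _)) _; rewrite gtr0_norm.
have n2 : `|2 * t * cos s| <= 2 * (1 + t).
  by apply: le_trans (normM1 _ (cos_max _)) _; rewrite gtr0_norm; lra.
have n3 : `|- c * t * sin (c * s) + a * cos (a * s)| <= 1 + t.
  rewrite addrC; apply: le_trans (ler_normD _ _) _; apply: lerD.
    by apply: le_trans (normM1 _ (cos_max _)) _; rewrite gtr0_norm// ltW.
  apply: le_trans (normM1 _ (sin_max _)) _; rewrite normrM normrN.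
  by rewrite gtr0_norm ?subr_gt0// gtr0_norm// /c; nra.
have iD := inv_den_le s1 t0.
apply: le_trans (ler_normB _ _) _; rewrite normrM (ger0_norm iD0).
rewrite 2!normrM (ger0_norm (exprn_ge0 2 iD0)).
apply: (@le_trans _ _ ((1 + t) * (4 / (1 + t) ^+ 2) +
    (1 + t) * (2 * (1 + t)) * (4 / (1 + t) ^+ 2) ^+ 2)).
  apply: lerD; first by apply: ler_pM.
  apply: ler_pM; [by rewrite mulr_ge0|exact: exprn_ge0|by apply: ler_pM|].
  by rewrite ler_pXn2r// nnegrE; apply: le_trans iD.
have -> : (1 + t) * (4 / (1 + t) ^+ 2) + (1 + t) * (2 * (1 + t)) * (4 / (1 +
  t) ^+ 2) ^+ 2 =
   4 / (1 + t) + 32 * (1 + t)^-1 ^+ 2 by field; lra.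
have : (1 + t)^-1 ^+ 2 <= (1 + t)^-1.
  by rewrite expr2 ler_piMr ?invr_ge0 ?(ltW t1)// invf_le1//; lra.
by lra.
Qed.

Let J : set R := `](0 : R), +oo[%classic.
(** One majorant for [q] and [dq], uniform in s. Written with [rlker], its integrability is the case
    p = 1 of [integral_rlker_1Dpow], which is where a < 1 is used. *)
Let G t : R := 36 * (rlker a t * (1 + t) `^ (- 1)).

Let J_gt0 t : J t -> 0 < t.
Proof. by rewrite /J/= in_itv/= andbT. Qed.

Let GE t : 0 < t -> G t = 36 * (t `^ (a - 1) / (1 + t)).
Proof.
by move=> t0; rewrite /G rlker_gt0E// powR_inv1//; lra.
Qed.

Let G_ge0 t : 0 <= G t.
Proof. by rewrite /G !mulr_ge0 ?rlker_ge0 ?powR_ge0. Qed.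

Let mJ : measurable J. Proof. exact: measurable_itv. Qed.

Let intG : mu.-integrable J (EFin \o G).
Proof.
have /andP[a0 a1] := a01.
have H : mu.-integrable setT (EFin \o G).
  apply: (@integrableZl _ _ _ mu _ measurableT 36 (fun t => (rlker a t * (1 +
    t) `^ (- 1))%:E)).
  apply/integrableP; split.
    by apply: measurable_rlkerM; exact: measurable_1Dpow.
  under eq_integral do rewrite /= ger0_norm ?mulr_ge0 ?rlker_ge0 ?powR_ge0//.
  by rewrite (integral_rlker_1Dpow a0 a1) ltry.
by apply: integrableS H.
Qed.

Let good s := - 2^-1 <= sin s.

Let int_le (f : R -> R) : (forall t, 0 < t -> {for t, continuous f}) ->
  (forall t, 0 < t -> `|f t| <= G t) -> mu.-integrable J (EFin \o f).
Proof.
move=> fc fG; apply: le_integrable intG => //.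
  apply/measurable_EFinP; apply: open_continuous_measurable_fun;
    first exact: interval_open.
  by move=> t; rewrite inE => /J_gt0; exact: fc.
by move=> t /J_gt0 t0; rewrite /= lee_fin (ger0_norm (G_ge0 t)) fG.
Qed.

Let intq s : good s -> mu.-integrable J (EFin \o q s).
Proof.
move=> s1; apply: int_le => t t0; first exact: q_cont.
apply: le_trans (q_le s1 t0) _; rewrite GE//.
by rewrite ler_wpM2r ?divr_ge0 ?powR_ge0//; lra.
Qed.

Let intdq s : good s -> mu.-integrable J (EFin \o dq s).
Proof.
move=> s1; apply: int_le => t t0; first exact: dq_cont.
by rewrite GE//; exact: dq_le.
Qed.

Let cvg_p0 s : good s -> p s t @[t --> 0^'+] --> 0.
Proof.
move=> s1; have /andP[a0 _] := a01.
have H : (fun t : R => 4 * t `^ a) t @[t --> 0^'+] --> (0 : R).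
  by rewrite -[X in _ --> X](mulr0 4); apply: cvgM;
    [exact: cvg_cst|exact: powR_cvg0].
apply/cvgr0Pnorm_le => e e0.
move/cvgr0Pnorm_le : H => /(_ e e0) H; near=> t.
have t0 : 0 < t by near: t; exact: nbhs_right_gt.
have He : `|4 * t `^ a| <= e by near: t.
apply: le_trans (p_le s1 t0) _; apply: le_trans He.
apply: le_trans (ler_norm _); rewrite ler_wpM2l// ler_piMr ?powR_ge0//.
by rewrite invf_le1//; lra.
Unshelve. all: by end_near. Qed.

Let cvg_py s : good s -> p s t @[t --> +oo] --> 0.
Proof.
move=> s1; have /andP[a0 a1] := a01.
have H : (fun t : R => 4 * t `^ (a - 1)) t @[t --> +oo] --> (0 : R).
  rewrite -[X in _ --> X](mulr0 4); apply: cvgM; first exact: cvg_cst.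
  by apply: cvg_powR_lt0; lra.
apply/cvgr0Pnorm_le => e e0.
move/cvgr0Pnorm_le : H => /(_ e e0) H; near=> t.
have t0 : 0 < t by near: t; apply: nbhs_pinfty_gt; exact: num_real.
have He : `|4 * t `^ (a - 1)| <= e by near: t.
apply: le_trans (p_le s1 t0) _; apply: le_trans He.
apply: le_trans (ler_norm _); rewrite ler_wpM2l// -(mulr_powRB1 (ltW t0) a0) mulrAC.
rewrite ler_piMl ?powR_ge0// ler_pdivrMr; last by lra.
by lra.
Unshelve. all: by end_near. Qed.

Let integral_dq s : good s -> \int[mu]_(t in J) dq s t = 0.
Proof.
move=> s1; rewrite -[RHS](subr0 0); apply: (@Rintegral0y_FTC2 R (dq s) (p s)).
- by move=> t t0; exact: dq_cont.
- by move=> t t0; exact: is_derive_p.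
- exact: cvg_p0.
- exact: cvg_py.
- exact: intdq.
Qed.

(** Two-sided derivatives at s = 0 call for an open interval around [0, pi / 2]. Its right end 2 is
    beyond pi / 2, and the sine is still positive on ]0, 2[. *)
Let good_near0 : exists2 d : R, 0 < d & forall s, - d < s < 2 -> good s.
Proof.
have : {for (0 : R), continuous (@sin R)} by exact: continuous_sin.
move=> /cvgrPdist_lt /(_ 2^-1); rewrite sin0 => /(_ ltac:(by rewrite invr_gt0)).
move=> [d /= d0 Hd]; exists d => // s /andP[s1 s2]; rewrite /good.
case: (ltP 0 s) => s0.
  have sg : 0 < sin s by apply: sin2_gt0; rewrite s0 s2.
  by lra.
have /Hd : ball_ Num.norm 0 d s by rewrite /ball_/= sub0r normrN ler0_norm//; lra.
by rewrite sub0r normrN ltr_norml => /andP[]; lra.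
Qed.

(** Differentiating under the integral sign gives the integral of [dq], a t-derivative of [p]
    without boundary terms. This is Cauchy's theorem for the rotated ray. *)
Let derive_integral_q : exists2 d : R, 0 < d & forall s, - d < s < 2 ->
  is_derive s 1 (fun s => \int[mu]_(t in J) q s t) 0.
Proof.
have [d d0 dg] := good_near0; exists d => // s s1.
have ds : `](- d), (2 : R)[%classic s by rewrite /= in_itv.
have gI x : `](- d), (2 : R)[%classic x -> good x by rewrite /= in_itv; exact: dg.
have dE x t : `](- d), (2 : R)[%classic x -> J t -> partial1of2 q x t = dq x t.
  by move=> /gI gx /J_gt0 t0; rewrite /partial1of2;
    exact/is_derive_derive1/is_derive_q.
have der : derivable (fun s => \int[mu]_(t in J) q s t) s 1.
  apply: (@derivable_under_integral R _ _ mu q J mJ s (- d) 2 ds _ _ G G_ge0 intG).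
  - by move=> x /gI; exact: intq.
  - by move=> x t /gI gx /J_gt0 t0; exact: is_derive_derivable (is_derive_q gx t0).
  - by move=> x t xI Jt; rewrite dE// GE ?J_gt0//; apply: dq_le;
    [exact: gI|exact: J_gt0].
apply: DeriveDef => //; rewrite -derive1E.
rewrite (@differentiation_under_integral R _ _ mu q J mJ s (- d) 2 ds _ _ G G_ge0
  intG).
- rewrite -(integral_dq (gI _ ds)); apply: eq_Rintegral => t; rewrite inE => Jt.
  exact: dE.
- by move=> x /gI; exact: intq.
- by move=> x t /gI gx /J_gt0 t0; exact: is_derive_derivable (is_derive_q gx t0).
- by move=> x t xI Jt; rewrite dE// GE ?J_gt0//; apply: dq_le;
  [exact: gI|exact: J_gt0].
Qed.

Let integral_q_const : \int[mu]_(t in J) q 0 t = \int[mu]_(t in J) q (pi / 2) t.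
Proof.
have [d d0 dI] := derive_integral_q.
have pi0 : 0 < pi / 2 :> R by rewrite divr_gt0 ?pi_gt0.
have pi2 : pi / 2 < 2 :> R := pihalf_lt2 R.
have dI' x : x \in `]0, (pi / 2 : R)[%R ->
  is_derive x 1 (fun s => \int[mu]_(t in J) q s t) ((fun=> 0) x).
  by rewrite in_itv/= => /andP[x0 x1]; apply: dI; lra.
have [|x _] := @MVT R _ (fun=> 0) 0 (pi / 2) pi0 dI'.
  apply: derivable_within_continuous => x; rewrite in_itv/= => /andP[x0 x1].
  by apply: is_derive_derivable (dI x _); lra.
by rewrite mul0r => /eqP; rewrite subr_eq0 => /eqP.
Qed.

Lemma rotation_identity :
  \int[mu]_(t in J) (t `^ a / (1 + t ^+ 2)) =
  sin (a * (pi / 2)) * \int[mu]_(t in J) (t `^ (a - 1) / (1 + t)).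
Proof.
have /andP[a0 a1] := a01.
transitivity (\int[mu]_(t in J) q 0 t).
  apply: eq_Rintegral => t; rewrite inE => /J_gt0 t0.
  rewrite /q /rot_den !mulr0 cos0 sin0 mulr1 !addr0 mulr0 addr0 -(mulr_powRB1
    (ltW t0) a0).
  by rewrite [1 + _]addrC mulrAC mulrC !mulrA mulrC.
rewrite integral_q_const -RintegralZl//; last first.
  apply: int_le => t t0.
    apply: cvgM; first exact: powR_cont.
    apply: cvgV; first by rewrite gt_eqF//; lra.
    by apply: cvgD; [exact: cvg_cst|exact: cvg_id].
  by rewrite GE// ger0_norm ?ler_peMl ?divr_ge0 ?powR_ge0//; lra.
apply: eq_Rintegral => t; rewrite inE => /J_gt0 t0.
rewrite /q /rot_den sin_pihalf.
have -> : cos (c * (pi / 2)) = sin (a * (pi / 2)).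
  by rewrite -cosBpihalf -cosN; congr cos; rewrite /c; field.
by field; apply/andP; split; nra.
Qed.

End rotation.

(** * Quadratic substitution and the functional equation of Gamma *)

Section reflection.
Context {R : realType}.
Local Notation mu := (@lebesgue_measure R).
Implicit Types a b c p r t : R.
Local Notation J := (`](0 : R), +oo[%classic).

Lemma nondecreasing_rays (u : nat -> R) : {homo u : m n / (m <= n)%N >-> n <= m} ->
  nondecreasing_seq (fun n => `[u n, +oo[%classic : set R).
Proof.
move=> hu m n mn; rewrite subsetEset => x; rewrite /= !in_itv/= !andbT.
by apply: le_trans; exact: hu.
Qed.

Lemma bigcup_rays (u : nat -> R) : (forall n, 0 < u n) -> u n @[n --> \oo] --> 0 ->
  \bigcup_n `[u n, +oo[%classic = J.
Proof.
move=> u0 cu; apply/seteqP; split => [x [n _]|x] /=; rewrite !in_itv/= !andbT.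
  exact: lt_le_trans.
move=> x0; have : \forall n \near \oo, u n <= x by exact: cvgr_le cu _ x0.
by move=> [N _ /(_ N (leqnn N)) uN]; exists N => //=; rewrite in_itv/= andbT.
Qed.

Lemma cvg_integral_rays (u : nat -> R) (f : R -> R) :
  {homo u : m n / (m <= n)%N >-> n <= m} -> (forall n, 0 < u n) ->
    u n @[n --> \oo] --> 0 ->
  (forall t, 0 < t -> {for t, continuous f}) -> (forall t, 0 < t -> 0 <= f t) ->
  (\int[mu]_(t in `[u n, +oo[) (f t)%:E @[n --> \oo] --> \int[mu]_(t in J) (f
    t)%:E)%E.
Proof.
move=> hu u0 cu cf f0; rewrite -(bigcup_rays u0 cu).
apply: ge0_nondecreasing_set_cvg_integral.
- exact: nondecreasing_rays.
- by move=> n; exact: measurable_itv.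
- move=> n; apply/measurable_EFinP.
  apply: (@measurable_funS _ _ _ _ J); first exact: measurable_itv.
    by move=> x /=; rewrite !in_itv/= !andbT; exact: lt_le_trans.
  apply: open_continuous_measurable_fun; first exact: interval_open.
  by move=> t; rewrite inE/= in_itv/= andbT; exact: cf.
- move=> n x; rewrite /= in_itv/= andbT => ux; rewrite lee_fin f0//.
  exact: lt_le_trans ux.
Qed.

(** The substitution t = sqrt u. Its derivative is unbounded at 0, so it is carried out on rays [u
    n, +oo[ with u n -> 0, followed by monotone convergence on both sides. *)
Lemma integral_square a : 0 < a < 1 ->
  (\int[mu]_(t in J) (t `^ a / (1 + t ^+ 2))%:E =
   \int[mu]_(t in J) (2^-1 * (t `^ ((a + 1) / 2 - 1) / (1 + t)))%:E)%E.
Proof.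
move=> /andP[a0 a1].
pose F t := t `^ 2^-1.
pose g t := t `^ a / (1 + t ^+ 2).
pose h t := 2^-1 * (t `^ ((a + 1) / 2 - 1) / (1 + t)).
pose u (n : nat) : R := n.+1%:R^-1.
have u0 n : 0 < u n by rewrite invr_gt0 ltr0n.
have hu : {homo u : m n / (m <= n)%N >-> n <= m}.
  by move=> m n mn; rewrite /u lef_pV2 ?posrE ?ltr0n// ler_nat.
have cu : u n @[n --> \oo] --> 0 by exact: cvg_harmonic.
have Fhomo x y : 0 <= x -> x <= y -> F x <= F y.
  by move=> x0 xy; apply: ge0_ler_powR; rewrite ?nnegrE ?invr_ge0//; lra.
have Fhomo' x y : 0 <= x -> x < y -> F x < F y.
  by move=> x0 xy; apply: gt0_ltr_powR; rewrite ?nnegrE ?invr_gt0//; lra.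
have cpow k t : 0 < t -> {for t, continuous (fun x : R => x `^ k)}.
  move=> t0; apply: derivable_continuous; apply: is_derive_derivable.
  exact: is_derive1_powR.
have F'E t : 0 < t -> derive1 F t = 2^-1 * t `^ (- 2^-1).
  move=> t0; rewrite (is_derive_derive1 (is_derive1_powR 2^-1 t0)).
  by congr (_ * _ `^ _); field.
have near0 t : 0 < t -> \forall x \near t, 2^-1 * x `^ (- 2^-1) = derive1 F x.
  by move=> t0; near=> x; rewrite F'E//; near: x; exact: lt_nbhsr.
have cF' t : 0 < t -> {for t, continuous (derive1 F)}.
  move=> t0; suff : derive1 F x @[x --> t] --> derive1 F t by [].
  rewrite (F'E t t0).
  have : (fun x : R => 2^-1 * x `^ (- 2^-1)) x @[x --> t] --> 2^-1 * t `^ (- 2^-1).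
    by apply: cvgM; [exact: cvg_cst|exact: cpow].
  by apply: cvg_trans; apply: near_eq_cvg; exact: near0.
have cg t : 0 < t -> {for t, continuous g}.
  move=> t0; apply: cvgM; first exact: cpow.
  apply: cvgV; first by rewrite gt_eqF// ltr_wpDr ?sqr_ge0.
  by apply: cvgD; [exact: cvg_cst|apply: cvgM; exact: cvg_id].
have ch t : 0 < t -> {for t, continuous h}.
  move=> t0; apply: cvgM; first exact: cvg_cst.
  apply: cvgM; first exact: cpow.
  apply: cvgV; first by rewrite gt_eqF//; lra.
  by apply: cvgD; [exact: cvg_cst|exact: cvg_id].
have g0 t : 0 < t -> 0 <= g t.
  by move=> t0; rewrite divr_ge0 ?powR_ge0// addr_ge0 ?sqr_ge0.
have h0 t : 0 < t -> 0 <= h t.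
  by move=> t0; rewrite mulr_ge0 ?invr_ge0// divr_ge0 ?powR_ge0//; lra.
have Fu0 n : 0 < F (u n) by exact: powR_gt0.
have Fhu : {homo (F \o u) : m n / (m <= n)%N >-> n <= m}.
  by move=> m n mn /=; apply: Fhomo; [exact: ltW|exact: hu].
have Fy : F x @[x --> +oo] --> (+oo : set_system R).
  apply/cvgryPge => M; near=> x.
  have M1 : M <= `|M| := ler_norm _.
  have xM : `|M| ^+ 2 <= x by near: x; apply: nbhs_pinfty_ge; exact: num_real.
  apply: le_trans M1 _; have := Fhomo _ _ (sqr_ge0 _) xM.
  by rewrite /F -powR_mulrn// -powRrM mulfV// powRr1.
have cFu : F (u n) @[n --> \oo] --> 0.
  apply/cvgr0Pnorm_le => e e0; near=> n.
  have : u n <= e ^+ 2.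
    by near: n; apply: (cvgr_le _ cu); rewrite exprn_gt0.
  move=> /(Fhomo _ _ (ltW (u0 n))); rewrite ger0_norm ?(ltW (Fu0 _))//.
  by rewrite {2}/F -powR_mulrn ?(ltW e0)// -powRrM mulfV// powRr1 ?(ltW e0).
have E n : (\int[mu]_(t in `[F (u n), +oo[) (g t)%:E = \int[mu]_(t in `[u n,
  +oo[) (h t)%:E)%E.
  rewrite (@increasing_ge0_integration_by_substitutiony R F g (u n)).
  - apply: eq_integral => t; rewrite inE/= in_itv/= andbT => ut.
    have t0 : 0 < t by exact: lt_le_trans ut.
    congr (_%:E); change (g (F t) * derive1 F t = h t);
      rewrite (F'E t t0) /g /h /F -powRrM -powR_mulrn ?powR_ge0// -powRrM.
    rewrite mulVf// powRr1 ?(ltW t0)//.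
    have -> : t `^ ((a + 1) / 2 - 1) = t `^ (2^-1 * a) * t `^ (- 2^-1).
      by rewrite -powRD ?(gt_eqF t0) ?implybT//; congr (_ `^ _); field.
    by field; lra.
  - move=> x y; rewrite !in_itv/= !andbT => ux _ xy.
    by apply: Fhomo' => //; apply: le_trans ux; exact: ltW.
  - by move=> x; rewrite in_itv/= andbT => ux; apply: cF'; exact: lt_trans ux.
  - apply/cvg_ex; exists (derive1 F (u n)); apply: cvg_at_right_filter; exact: cF'.
  - apply/cvg_ex; exists (2^-1 * 0).
    have H : (fun x : R => 2^-1 * x `^ (- 2^-1)) x @[x --> +oo] --> 2^-1 * (0 : R).
      by apply: cvgM; [exact: cvg_cst|apply: cvg_powR_lt0; lra].
    apply: cvg_trans H; apply: near_eq_cvg; near=> x.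
    by rewrite F'E//; near: x; apply: nbhs_pinfty_gt; exact: num_real.
  - split.
      move=> x; rewrite in_itv/= andbT => ux; apply: is_derive_derivable.
      by apply: is_derive1_powR; exact: lt_trans ux.
    by apply: cvg_at_right_filter; exact: cpow.
  - exact: Fy.
  - apply: continuous_in_subspaceT => x; rewrite inE/= in_itv/= andbT => ux.
    by apply: cg; exact: lt_le_trans ux.
  - by move=> x; rewrite in_itv/= andbT => ux; apply: g0; exact: lt_trans ux.
have L1 := cvg_integral_rays Fhu Fu0 cFu cg g0.
have L2 := cvg_integral_rays hu u0 cu ch h0.
have <- := cvg_lim (@ereal_hausdorff R) L1.
have <- := cvg_lim (@ereal_hausdorff R) L2.
by congr (limn _); apply/funext => n; exact: E.
Unshelve. all: by end_near. Qed.

Lemma Gamma1 : Gamma (1 : R) = 1.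
Proof.
have dN (x : R) : is_derive x 1 (fun t => expR (- t)) (- expR (- x)).
  apply: is_derive_eq (@is_derive_compf _ expR (fun x => - x) x _ _
    (is_derive_expR _) (is_derive_oppf (is_derive_idf x))) _.
  by rewrite mulrN1.
have cN (x : R) : {for x, continuous (fun t => expR (- t))}.
  by apply: derivable_continuous; exact: is_derive_derivable (dN x).
have H : (\int[mu]_(t in J) (expR (- t))%:E)%E = (0 - - 1)%:E.
  apply: (@ge0_integral0y_FTC2 R (fun t => expR (- t)) (fun t => - expR (- t))).
  - by move=> x _; exact: cN.
  - by move=> x _; rewrite -[X in is_derive _ _ _ X]opprK; apply: is_derive_oppf.
  - apply: cvgN; have := cvg_at_right_filter (cN 0).
    by rewrite oppr0 expR0.
  - by rewrite -oppr0; apply: cvgN; exact: cvgr_expR.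
  - by move=> x _; exact: expR_ge0.
apply: EFin_inj; rewrite -(integral_rlker_exp ltr01) -integral_rlker.
transitivity (\int[mu]_(t in J) (expR (- t))%:E)%E.
  by apply: eq_integral => t _; rewrite subrr powRr0 mul1r.
by rewrite H sub0r opprK.
Qed.

(** For p = a + 1 the same integral has been computed twice: elementarily as 1 / a, and as Gamma a *
    Gamma 1 / Gamma (a + 1). *)
Lemma GammaS a : 0 < a -> Gamma (a + 1) = a * Gamma a.
Proof.
move=> a0; have a1 : a < a + 1 by lra.
have := integral_rlker_1Dpow a0 a1; rewrite integral_rlker_base// => -[].
have -> : a + 1 - a = 1 by ring.
rewrite Gamma1 mulr1 => H.
have G0 : Gamma (a + 1) != 0 by rewrite gt_eqF// Gamma_gt0//; lra.
have : a * (a^-1 * Gamma (a + 1)) =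
  a * (Gamma a / Gamma (a + 1) * Gamma (a + 1)) by rewrite H.
by rewrite (mulfVK G0) mulrA mulfV ?mul1r ?gt_eqF.
Qed.

End reflection.

(** * The halving argument for the reflection formula *)

Section reflection_formula.
Context {R : realType}.
Local Notation mu := (@lebesgue_measure R).
Implicit Types a b c e p r t : R.
Local Notation J := (`](0 : R), +oo[%classic).

Let rf a : R := Gamma a * Gamma (1 - a).

Let integral_rf a : 0 < a < 1 ->
  (\int[mu]_t (rlker a t * (1 + t) `^ (- 1))%:E)%E = (rf a)%:E.
Proof. by move=> /andP[a0 a1];
  rewrite (integral_rlker_1Dpow a0 a1) Gamma1 divr1. Qed.

Let integral_rfJ a : 0 < a < 1 ->
  (\int[mu]_(t in J) (t `^ (a - 1) / (1 + t))%:E)%E = (rf a)%:E.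
Proof.
move=> a01; rewrite -(integral_rf a01) -integral_rlker; apply: eq_integral => t.
rewrite inE/= in_itv/= andbT => t0; congr (_%:E); rewrite powR_inv1//; lra.
Qed.

Let rf_half a : 0 < a < 1 -> rf ((a + 1) / 2) = 2 * (sin (a * (pi / 2)) * rf a).
Proof.
move=> a01; have b01 : 0 < (a + 1) / 2 < 1.
  by move/andP: a01 => [a0 a1]; rewrite ltr_pdivlMr// ltr_pdivrMr//; lra.
have := rotation_identity a01.
rewrite /Rintegral (integral_rfJ a01) (integral_square a01).
have H : (\int[mu]_(t in J) (2^-1 * (t `^ ((a + 1) / 2 - 1) / (1 + t)))%:E =
   2^-1%:E * \int[mu]_(t in J) (t `^ ((a + 1) / 2 - 1) / (1 + t))%:E)%E.
  rewrite -ge0_integralZl; last 4 first.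
  - exact: measurable_itv.
  - apply/measurable_EFinP; apply: open_continuous_measurable_fun;
    first exact: interval_open.
    move=> t; rewrite inE/= in_itv/= andbT => t0.
    have ck : {for t, continuous (fun x : R => x `^ ((a + 1) / 2 - 1))}.
      by apply: derivable_continuous; apply: is_derive_derivable;
        exact: is_derive1_powR.
    apply: cvgM; first exact: ck.
    apply: cvgV; first by rewrite gt_eqF//; lra.
    by apply: cvgD; [exact: cvg_cst|exact: cvg_id].
  - move=> t; rewrite /= in_itv/= andbT => t0.
    by rewrite lee_fin divr_ge0 ?powR_ge0//; lra.
  - by rewrite lee_fin invr_ge0.
  by apply: eq_integral => t _; rewrite EFinM.
rewrite H (integral_rfJ b01) -EFinM /= => <-.
by rewrite mulrA mulfV// mul1r.
Qed.

Let h a : R := rf a * sin (a * pi).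

Let h_sym a : h (1 - a) = h a.
Proof.
rewrite /h /rf opprB [1 + (a - 1)]addrC subrK [Gamma _ * _]mulrC; congr (_ * _).
by rewrite mulrBl mul1r addrC sinDpi sinN opprK.
Qed.

(** With b = 1 - a, [rf_half] and the double-angle formula give h ((b + 1) / 2) = 2 sin (b pi / 2)
    cos (b pi / 2) * rf b = h b. The symmetry [h_sym] then turns (b + 1) / 2 = 1 - a / 2 into a /
    2. *)
Let h_half a : 0 < a < 1 -> h a = h (a / 2).
Proof.
move=> /andP[a0 a1]; rewrite -(h_sym (a / 2)) -h_sym.
have -> : 1 - a / 2 = ((1 - a) + 1) / 2 by field.
have b01 : 0 < 1 - a < 1 by apply/andP; split; lra.
rewrite {2}/h (rf_half b01) /h; set b := 1 - a.
have -> : b * pi = (b * (pi / 2)) *+ 2 by rewrite -mulr_natr; field.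
have -> : (b + 1) / 2 * pi = b * (pi / 2) + pi / 2 by field.
by rewrite sin_mulr2n sinDpihalf -mulr_natr; ring.
Qed.

Let h_iter a n : 0 < a < 1 -> h a = h (a * 2^-1 ^+ n).
Proof.
move=> a01; elim: n => [|n IH]; first by rewrite mulr1.
rewrite IH exprSr mulrA h_half//; move/andP: a01 => [a0 a1]; apply/andP; split.
  by rewrite mulr_gt0// exprn_gt0// invr_gt0.
apply: le_lt_trans a1; rewrite ler_piMr ?(ltW a0)//.
by apply: exprn_ile1; [rewrite invr_ge0|rewrite invf_le1// ler1n].
Qed.

(** (1 + t) ^ (-1) dominates (1 + t) ^ (- (e + 1)), whose integral is 1 / e. *)
Let rf_lower e : 0 < e < 1 -> 1 <= e * rf e.
Proof.
move=> e01; have /andP[e0 e1] := e01.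
rewrite mulrC -ler_pdivrMr// div1r -lee_fin -(integral_rf e01)
  -(integral_rlker_base e0).
apply: ge0_le_integral => //.
- by move=> t _; rewrite lee_fin mulr_ge0 ?rlker_ge0 ?powR_ge0.
- by apply: measurable_rlkerM; exact: measurable_1Dpow.
- by apply: measurable_rlkerM; exact: measurable_1Dpow.
move=> t _; rewrite lee_fin; case: (ltP 0 t) => t0;
  last by rewrite !(rlker_le0E _ t0) !mul0r.
rewrite ler_wpM2l ?rlker_ge0//; apply: ler_powR; lra.
Qed.

(** Split (1 + t) ^ (-1) = (1 + t) ^ (-2) + t (1 + t) ^ (-2). The first part is at most (1 + t) ^ (-
    (e + 1)) and contributes at most 1 / e; the second contributes e * rf e. So rf e <= 1 / e + e *
    rf e, which is solved for e * rf e. *)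
Let rf_upper e : 0 < e < 1 -> e * rf e <= (1 - e)^-1.
Proof.
move=> e01; have /andP[e0 e1] := e01.
have e2 : e + 1 < 2 by lra.
have e10 : 0 < e + 1 by lra.
have G2 : Gamma (2 : R) = 1.
  by have -> : 2 = 1 + 1 :> R by []; rewrite GammaS// Gamma1 mulr1.
have I2 : (\int[mu]_t (rlker (e + 1) t * (1 + t) `^ (- 2))%:E)%E = (e * rf e)%:E.
  rewrite (integral_rlker_1Dpow e10 e2) G2 divr1 (GammaS e0) /rf mulrA.
  by congr (_ * Gamma _)%:E; ring.
have H : rf e <= e^-1 + e * rf e.
  rewrite -lee_fin EFinD -I2 -(integral_rf e01) -(integral_rlker_base e0).
  have mm q s : measurable_fun setT (fun t : R => (rlker q t * (1 + t) `^ s)%:E).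
    by apply: measurable_rlkerM; exact: measurable_1Dpow.
  have mm0 q s t : (0 <= (rlker q t * (1 + t) `^ s)%:E)%E.
    by rewrite lee_fin mulr_ge0 ?rlker_ge0 ?powR_ge0.
  rewrite -ge0_integralD//; last 2 first.
  - exact: mm.
  - exact: mm.
  apply: ge0_le_integral => //.
  - exact: mm.
  - by apply: emeasurable_funD; exact: mm.
  move=> t _; rewrite -EFinD lee_fin; case: (ltP 0 t) => t0; last first.
    by rewrite !(rlker_le0E _ t0) !mul0r addr0.
  have t1 : 0 < 1 + t by lra.
  rewrite -rlkerM -mulrA -mulrDr ler_wpM2l ?rlker_ge0// powRr1 ?(ltW t0)//.
  have -> : (1 + t) `^ (-1) = (1 + t) `^ (-2) + t * (1 + t) `^ (-2).
    have -> : -2 = (-1) + (-1) :> R by ring.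
    rewrite powRD ?(gt_eqF t1) ?implybT// powR_inv1 ?(ltW t1)//.
    by field; lra.
  by rewrite lerD2r; apply: ler_powR; lra.
rewrite -[leRHS]mul1r ler_pdivlMr ?subr_gt0//.
have := ler_wpM2l (ltW e0) H; rewrite mulrDr mulfV ?gt_eqF//; lra.
Qed.

Lemma Gamma_reflection a : 0 < a < 1 -> Gamma a * Gamma (1 - a) * sin (a * pi) = pi.
Proof.
move=> a01; have /andP[a0 a1] := a01; rewrite -/(rf a) -/(h a).
pose u n : R := a * 2^-1 ^+ n.
have u0 n : 0 < u n by rewrite mulr_gt0// exprn_gt0// invr_gt0.
have u1 n : u n < 1.
  apply: le_lt_trans a1; rewrite ler_piMr ?(ltW a0)//.
  by apply: exprn_ile1; [rewrite invr_ge0|rewrite invf_le1// ler1n].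
have u01 n : 0 < u n < 1 by rewrite u0 u1.
have cu : u n @[n --> \oo] --> 0.
  apply: cvg_geometric; rewrite ger0_norm ?invr_ge0// invf_lt1// ltr1n//.
have c1 : u n * rf (u n) @[n --> \oo] --> (1 : R).
  apply: (@squeeze_cvgr _ _ _ _ (fun=> 1) (fun n => (1 - u n)^-1)).
  - by apply: nearW => n; rewrite rf_lower//= rf_upper.
  - exact: cvg_cst.
  - have c1 : 1 - u n @[n --> \oo] --> (1 - 0 : R) by apply: cvgB => //;
    exact: cvg_cst.
    by have := cvgV _ c1; rewrite subr0 invr1; apply; exact: oner_neq0.
have ds : is_derive (0 : R) 1 (fun x => sin (x * pi)) pi.
  apply: is_derive_eq (@is_derive_compf _ sin (fun x => x * pi) 0 _ _
    (is_derive_sin _)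
    (is_derive_mulf (is_derive_idf 0) (is_derive_cstf pi 0))) _.
  by rewrite mul0r cos0; ring.
(* The difference quotient of x -> sin (x pi) at 0, sampled along [u]. *)
have c2 : (u n)^-1 * sin (u n * pi) @[n --> \oo] --> pi.
  have cd := is_derive_derivable ds.
  have dv : 'D_1 (fun x : R => sin (x * pi)) 0 = pi by exact: derive_val.
  have : h^-1 *: (sin ((h *: 1 + 0) * pi) - sin (0 * pi)) @[h --> 0^'] -->
    'D_1 (fun x : R => sin (x * pi)) 0 by exact: cd.
  rewrite dv.
  have un0 n : u n != 0 by rewrite gt_eqF.
  move=> /cvgr_dnbhsP H; apply: cvg_trans (H u (conj un0 cu)).
  apply: near_eq_cvg; apply: nearW => n /=.
  by rewrite mul0r sin0 subr0 addr0 [_ *: 1]mulr1.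
have c3 : h a @[n --> \oo] --> (1 * pi : R).
  apply: cvg_trans (cvgM c1 c2); apply: near_eq_cvg; apply: nearW => n.
  rewrite (h_iter n a01) -/(u n) /h.
  change (u n * rf (u n) * ((u n)^-1 * sin (u n * pi)) = rf (u n) * sin (u n * pi)).
  by field; rewrite gt_eqF.
have := cvg_unique _ (@cvg_cst _ (h a) nat \oo _) c3.
by rewrite mul1r; apply.
Qed.

End reflection_formula.

(** * One-sided fractional integrals of rapidly decaying functions *)

Section rapid_right_decay.
Context {R : realType}.
Local Notation mu := (@lebesgue_measure R).
Local Notation L1 f := (mu.-integrable setT (EFin \o f)).
Implicit Types (a b x s t : R) (f g h : R -> R).

(* Decay towards +oo only: [C] may depend on the left end [A]. *)
Definition right_decay f := forall (A : R) (k : nat), exists C : R,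
  forall x, A <= x -> (1 + `|x|) ^+ k * `|f x| <= C.

(** A domain stable under the right-sided integrals of all positive orders, with no growth condition
    at -oo. *)
Definition right_schwartz f := forall n : nat,
  (forall x, derivable (derive1n n f) x 1) /\ right_decay (derive1n n f).

(** A coinduction principle: a family closed under differentiation, whose members are derivable and
    decay, lies in the class. Stability proofs then need a first derivative only, never a formula
    for the n-th one. *)
Lemma right_schwartz_coind (Q : (R -> R) -> Prop) :
  (forall f, Q f -> [/\ forall x, derivable f x 1,
    right_decay f & Q (derive1 f)]) ->
  forall f, Q f -> right_schwartz f.
Proof.
move=> HQ f Qf n; have : Q (derive1n n f).
  by elim: n => [//|n IH]; rewrite derive1nS; have [] := HQ _ IH.
by move=> /HQ[].
Qed.

Lemma right_schwartz_derivable f : right_schwartz f -> forall x, derivable f x 1.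
Proof. by move=> Ef; exact: (Ef 0%N).1. Qed.

Lemma right_schwartz_continuous f : right_schwartz f -> continuous f.
Proof. by move=> Ef x; apply: derivable_continuous;
  exact: right_schwartz_derivable. Qed.

Lemma right_schwartz_measurable f : right_schwartz f -> measurable_fun setT f.
Proof. by move=> Ef; apply: continuous_measurable_fun;
  exact: right_schwartz_continuous. Qed.

Lemma right_schwartz_right_decay f : right_schwartz f -> right_decay f.
Proof. by move=> Ef; exact: (Ef 0%N).2. Qed.

Lemma right_schwartz_derive1 f : right_schwartz f -> right_schwartz (derive1 f).
Proof. by move=> Ef n; rewrite -derive1Sn; exact: Ef. Qed.

Lemma right_schwartz_derive1n n f : right_schwartz f ->
  right_schwartz (derive1n n f).
Proof. by elim: n => [//|n IH] Ef; rewrite derive1nS;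
  apply: right_schwartz_derive1; exact: IH. Qed.

Lemma right_decayD f g : right_decay f -> right_decay g ->
  right_decay (fun x => f x + g x).
Proof.
move=> df dg A k; have [C HC] := df A k; have [D HD] := dg A k.
exists (C + D) => x Ax; apply: le_trans (lerD (HC x Ax) (HD x Ax)).
by rewrite -mulrDr ler_wpM2l ?exprn_ge0 ?addr_ge0// ler_normD.
Qed.

Lemma right_decayZ (c : R) f : right_decay f -> right_decay (fun x => c * f x).
Proof.
move=> df A k; have [C HC] := df A k; exists (`|c| * C) => x Ax.
by rewrite normrM mulrCA ler_wpM2l// HC.
Qed.

Lemma right_decayX f : right_decay f -> right_decay (fun x => x * f x).
Proof.
move=> df A k; have [C HC] := df A k.+1; exists C => x Ax;
  apply: le_trans (HC x Ax).
rewrite normrM exprSr -mulrA ler_wpM2l ?exprn_ge0 ?addr_ge0//.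
by rewrite ler_wpM2r// lerDr.
Qed.

Lemma derive1_addf f g : (forall x, derivable f x 1) ->
  (forall x, derivable g x 1) ->
  derive1 (fun x => f x + g x) = (fun x => derive1 f x + derive1 g x).
Proof.
move=> df dg; apply/funext => x; apply: is_derive_derive1.
by apply: is_derive_addf; exact: derivable_is_derive.
Qed.

Lemma derive1_mulcf (c : R) f : (forall x, derivable f x 1) ->
  derive1 (fun x => c * f x) = (fun x => c * derive1 f x).
Proof.
move=> df; apply/funext => x; apply: is_derive_derive1.
by apply: is_derive_mulcf; exact: derivable_is_derive.
Qed.

Lemma derive1_mulXf f : (forall x, derivable f x 1) ->
  derive1 (fun x => x * f x) = (fun x => x * derive1 f x + f x).
Proof.
move=> df; apply/funext => x; apply: is_derive_derive1.
apply: is_derive_eq (is_derive_mulf (is_derive_idf x) (derivable_is_derive (df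
  x))) _.
by rewrite mulr1.
Qed.

Lemma right_schwartzD f g : right_schwartz f -> right_schwartz g ->
  right_schwartz (fun x => f x + g x).
Proof.
move=> Ef Eg; apply: (@right_schwartz_coind (fun h => exists f g,
  [/\ right_schwartz f, right_schwartz g & h = (fun x => f x + g x)]));
    last by exists f, g.
move=> _ [{}f [{}g [{}Ef {}Eg ->]]]; have df := right_schwartz_derivable Ef.
have dg := right_schwartz_derivable Eg; split.
- by move=> x; apply: derivableD.
- by apply: right_decayD; exact: right_schwartz_right_decay.
- by exists (derive1 f), (derive1 g); split;
  [exact: right_schwartz_derive1..|exact: derive1_addf].
Qed.

Lemma right_schwartzZ (c : R) f : right_schwartz f ->
  right_schwartz (fun x => c * f x).
Proof.
move=> Ef; apply: (@right_schwartz_coind (fun h => exists f,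
  right_schwartz f /\ h = (fun x => c * f x))); last by exists f.
move=> _ [{}f [{}Ef ->]]; have df := right_schwartz_derivable Ef; split.
- by move=> x; apply: is_derive_derivable (is_derive_mulcf c (derivable_is_derive
  (df x))).
- by apply: right_decayZ; exact: right_schwartz_right_decay.
- by exists (derive1 f); split;
  [exact: right_schwartz_derive1|exact: derive1_mulcf].
Qed.

Lemma right_schwartzX f : right_schwartz f -> right_schwartz (fun x => x * f x).
Proof.
(* The products x * f are not closed under differentiation; the sums x * f + g are, with derivative
   x * f' + (f + g'). *)
move=> Ef; apply: (@right_schwartz_coind (fun h => exists f g,
    [/\ right_schwartz f, right_schwartz g & h = (fun x => x * f x + g x)]));
      last first.
  exists f, (fun x => 0 * f x); split => //; first exact: right_schwartzZ.
  by apply/funext => x; rewrite mul0r addr0.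
move=> _ [{}f [{}g [{}Ef {}Eg ->]]]; have df := right_schwartz_derivable Ef.
have dg := right_schwartz_derivable Eg.
have dXf x : derivable (fun x => x * f x) x 1.
  exact: is_derive_derivable (is_derive_mulf (is_derive_idf x)
    (derivable_is_derive (df x))).
split.
- by move=> x; apply: derivableD.
- by apply: right_decayD; [apply: right_decayX|]; exact: right_schwartz_right_decay.
- exists (derive1 f), (fun x => f x + derive1 g x); split;
  first exact: right_schwartz_derive1.
    exact: right_schwartzD Ef (right_schwartz_derive1 Eg).
  rewrite derive1_addf// derive1_mulXf//; apply/funext => x.
  by rewrite -addrA.
Qed.

(** One bound for both integrability in s and decay in x. For x >= A and s > 0, each of 1 + |x| and
    1 + s is at most (1 + |A|) (1 + |x + s|), so k + m powers of decay of [f] can be shared out, k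
    to x and m >= a + 1 to s. *)
Lemma right_decay_dom a f (A : R) (k : nat) : 0 < a -> right_decay f ->
  exists2 C : R, 0 <= C & forall x s, A <= x -> 0 < s ->
    `|f (x + s)| <= C / (1 + `|x|) ^+ k * (1 + s) `^ (- (a + 1)).
Proof.
move=> a0 df; pose m := (Num.truncn (a + 1)).+1.
have [C HC] := df A (k + m)%N.
exists (`|C| * (1 + `|A|) ^+ (k + m));
  first by rewrite mulr_ge0 ?exprn_ge0 ?addr_ge0.
move=> x s Ax s0; have s1 : 0 < 1 + s by lra.
have A1 : 0 <= 1 + `|A| by rewrite addr_ge0.
have x1 : 0 < 1 + `|x| by rewrite ltr_wpDr.
have y1 : 0 < 1 + `|x + s| by rewrite ltr_wpDr.
have Hx : 1 + `|x| <= (1 + `|A|) * (1 + `|x + s|).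
  have [x0|x0] := leP 0 x.
    have -> : `|x| = x by rewrite ger0_norm.
    have -> : `|x + s| = x + s by rewrite ger0_norm// addr_ge0// ltW.
    have := normr_ge0 A; nra.
  have -> : `|x| = - x by rewrite ltr0_norm.
  have A0 : `|A| = - A by rewrite ltr0_norm//; exact: le_lt_trans x0.
  have := normr_ge0 (x + s); rewrite A0; nra.
have Hs : 1 + s <= (1 + `|A|) * (1 + `|x + s|).
  have H1 : x + s <= `|x + s| := ler_norm _.
  have H2 : - A <= `|A| by rewrite -normrN ler_norm.
  by have := normr_ge0 (x + s); have := normr_ge0 A; nra.
have Hm : (1 + s) `^ (a + 1) <= (1 + s) ^+ m.
  rewrite -powR_mulrn ?(ltW s1)//; apply: ler_powR; first by lra.
  by apply: ltW; exact: truncnS_gt.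
rewrite powRN -mulrA -invfM ler_pdivlMr;
  last by rewrite mulr_gt0 ?exprn_gt0 ?powR_gt0.
apply: (@le_trans _ _ (`|f (x + s)| * ((1 + `|A|) ^+ (k + m) * (1 + `|x +
  s|) ^+ (k + m)))).
  rewrite ler_wpM2l// -exprMn exprD; apply: ler_pM;
    rewrite ?exprn_ge0 ?powR_ge0 ?(ltW x1)//.
    by apply: lerXn2r => //; rewrite nnegrE ?mulr_ge0// ?(ltW x1)// ltW.
  apply: le_trans Hm _; apply: lerXn2r => //;
    rewrite nnegrE ?mulr_ge0// ?(ltW s1)//.
rewrite mulrCA mulrC [X in X * _]mulrC ler_wpM2r ?exprn_ge0//.
by apply: le_trans (ler_norm C); apply: HC; lra.
Qed.

(** The substitution t = x + s frees the singular kernel from x, so that x-derivatives fall on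
    [f]. *)
Definition rlint a f x : R := \int[mu]_s (rlker a s * f (x + s)).

Lemma measurable_shift f x : measurable_fun setT f ->
  measurable_fun setT (fun s => f (x + s)).
Proof. by move=> mf; apply: (measurableT_comp mf); exact: measurable_funD. Qed.

Lemma integrable_rlint a f x : 0 < a -> measurable_fun setT f -> right_decay f ->
  L1 (fun s => rlker a s * f (x + s)).
Proof.
move=> a0 mf df; have [C _ HC] := right_decay_dom x 0 a0 df.
apply: (@integrable_rlkerM _ _ _ (C / (1 + `|x|) ^+ 0) a0).
  exact: measurable_shift.
by move=> s s0; exact: HC.
Qed.

Lemma Rintegral_le_integral f g (c : R) : L1 f -> measurable_fun setT g ->
  (forall t, `|f t| <= g t) -> (\int[mu]_t (g t)%:E)%E = c%:E ->
    `|\int[mu]_t f t| <= c.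
Proof.
move=> fi mg fg gc; apply: le_trans (le_normr_Rintegral measurableT fi) _.
rewrite /Rintegral -[leRHS]/(fine c%:E) -gc; apply: fine_le.
- by apply: integrable_fin_num => //; exact: integrable_norm fi.
- by rewrite gc.
apply: ge0_le_integral => //.
- apply/measurable_EFinP; apply: measurableT_comp => //.
  by apply/measurable_EFinP; exact: measurable_int fi.
- by apply/measurable_EFinP.
- by move=> t _; rewrite lee_fin fg.
Qed.

Lemma right_decay_rlint a f : 0 < a -> measurable_fun setT f -> right_decay f ->
  right_decay (rlint a f).
Proof.
move=> a0 mf df A k; have [C C0 HC] := right_decay_dom A k a0 df.
exists (C / a) => x Ax; rewrite mulrC -ler_pdivlMr;
  last by rewrite exprn_gt0// ltr_wpDr.
rewrite -mulrAC.
apply: (@Rintegral_le_integral _ (fun s => C / (1 +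
  `|x|) ^+ k * (rlker a s * (1 + s) `^ (- (a + 1))))).
- exact: integrable_rlint.
- by apply: measurable_funM => //; apply: measurable_funM;
  [exact: measurable_rlker|exact: measurable_1Dpow].
- move=> s; rewrite normrM (ger0_norm (rlker_ge0 _ _)) mulrCA.
  case: (ltP 0 s) => s0; last by rewrite (rlker_le0E _ s0) !mul0r.
  by rewrite ler_wpM2l ?rlker_ge0// HC.
under eq_integral do rewrite EFinM.
rewrite ge0_EFin_integralZl ?integral_rlker_base//.
- by apply: measurable_rlkerM; exact: measurable_1Dpow.
- by move=> s; rewrite mulr_ge0 ?rlker_ge0 ?powR_ge0.
- by rewrite divr_ge0 ?exprn_ge0 ?addr_ge0.
Qed.

Lemma is_derive_rlint a f : 0 < a -> (forall x, derivable f x 1) -> right_decay f ->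
  right_decay (derive1 f) ->
    forall x, is_derive x 1 (rlint a f) (rlint a (derive1 f) x).
Proof.
move=> a0 fd df df' x.
have mf : measurable_fun setT f.
  by apply: continuous_measurable_fun => y; exact: derivable_continuous.
(* The bound with A = x - 1 is uniform over the window ]x - 1, x + 1[ in which the parameter
   varies. *)
have [C C0 HC] := right_decay_dom (x - 1) 0 a0 df'.
pose F x s := rlker a s * f (x + s).
pose G s := C * (rlker a s * (1 + s) `^ (- (a + 1))).
have dF (y s : R) : is_derive y 1 (F ^~ s) (rlker a s * derive1 f (y + s)).
  have d1 := is_derive_addf (is_derive_idf y) (is_derive_cstf s y).
  have d2 := @is_derive_compf _ f (fun z => z +
    s) y _ _ (derivable_is_derive (fd (y + s))) d1.
  by apply: is_derive_eq (is_derive_mulcf (rlker a s) d2) _; rewrite addr0 mulr1.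
have G0 s : 0 <= G s by rewrite /G !mulr_ge0 ?rlker_ge0 ?powR_ge0.
have iG : L1 G by apply: (integrableZl measurableT C (integrable_rlker_base a0)).
have xI : `](x - 1), (x + 1)[%classic x by rewrite /= in_itv/=; lra.
have iF (y : R) : `](x - 1), (x + 1)[%classic y -> L1 (F y) by move=> _;
  exact: integrable_rlint.
have dF' (y s : R) : `](x - 1), (x + 1)[%classic y -> setT s ->
  derivable (F ^~ s) y 1.
  by move=> _ _; exact: is_derive_derivable (dF y s).
have GF (y s : R) : `](x - 1), (x + 1)[%classic y -> setT s ->
  `|partial1of2 F y s| <= G s.
  rewrite /= in_itv/= => /andP[xy _] _;
    rewrite /partial1of2 (is_derive_derive1 (dF y s)) /G.
  rewrite normrM (ger0_norm (rlker_ge0 _ _)) mulrCA.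
  case: (ltP 0 s) => s0; last by rewrite (rlker_le0E _ s0) !mul0r.
  by rewrite ler_wpM2l ?rlker_ge0//; have := HC y s (ltW xy) s0;
    rewrite expr0 divr1.
have der := @derivable_under_integral R _ _ mu F setT measurableT x _ _ xI iF dF'
  G G0 iG GF.
have := @differentiation_under_integral R _ _ mu F setT measurableT x _ _ xI iF
  dF' G G0 iG GF.
rewrite derive1E => dE; apply: DeriveDef; first exact: der.
apply: etrans dE _; apply: eq_Rintegral => s _.
exact: is_derive_derive1 (dF x s).
Qed.

Lemma derive1_rlint a f : 0 < a -> right_schwartz f ->
  derive1 (rlint a f) = rlint a (derive1 f).
Proof.
move=> a0 Ef; apply/funext => x; apply: is_derive_derive1;
  apply: (is_derive_rlint a0).
- exact: right_schwartz_derivable.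
- exact: right_schwartz_right_decay.
- exact: right_schwartz_right_decay (right_schwartz_derive1 Ef).
Qed.

Lemma right_schwartz_rlint a f : 0 < a -> right_schwartz f ->
  right_schwartz (rlint a f).
Proof.
move=> a0 Ef; apply: (@right_schwartz_coind (fun h => exists f,
  right_schwartz f /\ h = rlint a f)); last by exists f.
move=> _ [{}f [{}Ef ->]]; split.
- move=> x; apply: is_derive_derivable (is_derive_rlint a0 _ _ _ x).
  + exact: right_schwartz_derivable.
  + exact: right_schwartz_right_decay.
  + exact: right_schwartz_right_decay (right_schwartz_derive1 Ef).
- by apply: right_decay_rlint a0 _ (right_schwartz_right_decay Ef);
  exact: right_schwartz_measurable.
- by exists (derive1 f); split;
  [exact: right_schwartz_derive1|exact: derive1_rlint].
Qed.

(** Both kernels point to the right, so their convolution is the Beta kernel for all positive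
    orders, without the restriction a + b < 1 of the crossed case. *)
Lemma rlint_rlint a b f x : 0 < a -> 0 < b -> right_schwartz f ->
  rlint a (rlint b f) x = Gamma a * Gamma b / Gamma (a + b) * rlint (a + b) f x.
Proof.
move=> a0 b0 Ef; have ab0 : 0 < a + b by exact: addr_gt0.
have mf := measurable_shift x (right_schwartz_measurable Ef).
pose m r := Gamma a * Gamma b / Gamma (a + b) * rlker (a + b) r.
have i1 := integrable_rlint x ab0 (right_schwartz_measurable Ef)
  (right_schwartz_right_decay Ef).
have i2 : L1 (fun r => m r * f (x + r)).
  have := integrableZl measurableT (Gamma a * Gamma b / Gamma (a + b)) i1.
  by apply: eq_integrable => // t _ /=; rewrite -EFinM /m mulrA.
have i3 t : L1 (fun u => rlker b u * f (x + (t + u))).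
  have := integrable_rlint (x +
    t) b0 (right_schwartz_measurable Ef) (right_schwartz_right_decay Ef).
  by apply: eq_integrable => // s _ /=; rewrite addrA.
have [_ H] := @convolution_assoc R (rlker a) (rlker b) m (fun t => f (x + t))
  (measurable_rlker a) (measurable_rlker b) mf (rlker_ge0 a) (rlker_ge0 b)
  (fun r => @integral_rlker_convolution R a b r a0 b0) i2 i3.
rewrite [rlint (a + b) f x]/rlint -RintegralZl//.
transitivity (\int[mu]_r (m r * f (x + r))).
  rewrite -H /rlint; apply: eq_Rintegral => t _; congr (_ * _).
  by apply: eq_Rintegral => s _; rewrite addrA.
by apply: eq_Rintegral => s _; exact: esym (mulrA _ _ _).
Qed.

End rapid_right_decay.

(** * Left-sided integrals by reflection, and the crossed kernels *)

Section lizorkin_real.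
Context {R : realType}.
Local Notation mu := (@lebesgue_measure R).
Local Notation L1 f := (mu.-integrable setT (EFin \o f)).
Implicit Types (a b x s t : R) (f g h : R -> R).

(** Conjugation by this reflection exchanges right- and left-sided operators, so the results above
    also serve the left side. *)
Definition refl f x : R := f (- x).

Lemma reflK f : refl (refl f) = f.
Proof. by apply/funext => x; rewrite /refl opprK. Qed.

Lemma integrable_mulcf (c : R) f : L1 f -> L1 (fun t => c * f t).
Proof.
by move=> /(integrableZl measurableT c); apply: eq_integrable.
Qed.

Lemma integrable_addf f g : L1 f -> L1 g -> L1 (fun t => f t + g t).
Proof. by move=> fi gi; have := integrableD measurableT fi gi;
  apply: eq_integrable. Qed.

Lemma cvg_right_decay f : right_decay f -> f x @[x --> +oo] --> (0 : R).
Proof.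
move=> df; have [C HC] := df 0 1%N.
apply/cvgr0Pnorm_le => e e0; near=> x.
have x0 : 0 <= x by near: x; apply: nbhs_pinfty_ge; exact: num_real.
have xC : C / e <= x by near: x; apply: nbhs_pinfty_ge; exact: num_real.
have := HC _ x0; rewrite expr1 => H.
have Cx : C <= x * e by rewrite -ler_pdivrMr.
have x1 : 0 < 1 + `|x| by rewrite ltr_wpDr.
rewrite -(ler_pM2l x1); apply: le_trans H _; rewrite (ger0_norm x0); nra.
Unshelve. all: by end_near. Qed.

Lemma rlint1_derive1 f : right_schwartz f -> rlint 1 (derive1 f) = (fun x => - f x).
Proof.
move=> Ef; apply/funext => x.
have Ef' := right_schwartz_derive1 Ef.
have i1 := integrable_rlint x ltr01 (right_schwartz_measurable Ef')
  (right_schwartz_right_decay Ef').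
have mJ : measurable (`](0 : R), +oo[%classic : set R) by exact: measurable_itv.
have iJ : mu.-integrable `](0 : R), +oo[ (EFin \o (fun s => derive1 f (x + s))).
  have iJ1 : mu.-integrable `](0 : R),
    +oo[ (EFin \o (fun s => rlker 1 s * derive1 f (x + s))).
    by apply: integrableS i1.
  apply: eq_integrable iJ1 => // s; rewrite inE/= in_itv/= andbT => s0.
  by rewrite rlker_gt0E// subrr powRr0 mul1r.
transitivity (\int[mu]_(s in `](0 : R), +oo[) derive1 f (x + s)).
  rewrite /rlint /Rintegral -integral_rlker; congr fine; apply: eq_integral => s _.
  by rewrite subrr powRr0 mul1r.
rewrite -[RHS]add0r; apply: (@Rintegral0y_FTC2 R _ (fun s => f (x + s))).
- move=> s _; apply: (@continuous_comp _ _ _ (fun s : R => x + s) (derive1 f)).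
    by apply: cvgD; [exact: cvg_cst|exact: cvg_id].
  exact: right_schwartz_continuous.
- move=> s _; have d1 := is_derive_addf (is_derive_cstf x s) (is_derive_idf s).
  have d2 := @is_derive_compf _ f (fun s => x + s) s _ _
    (derivable_is_derive (@right_schwartz_derivable _ _ Ef (x + s))) d1.
  apply: is_derive_eq d2 _.
  by rewrite add0r mulr1.
- have C : {for (0 : R), continuous (fun s : R => f (x + s))}.
    apply: (@continuous_comp _ _ _ (fun s : R => x + s) f).
      by apply: cvgD; [exact: cvg_cst|exact: cvg_id].
    exact: right_schwartz_continuous.
  by have := cvg_at_right_filter C; rewrite addr0.
- apply/cvgr0Pnorm_le => e e0.
  have := cvg_right_decay (right_schwartz_right_decay Ef) => /cvgr0Pnorm_le /(_ _
    e0) [M [Mr HM]].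
  exists (M - x); split; first exact: num_real.
  by move=> s Ms; apply: HM; lra.
- exact: iJ.
Qed.

(** Integration by parts through the semigroup law: order b + 1 is order b after order 1, and order
    1 undoes the derivative up to sign. No boundary term at the singularity of the kernel has to be
    examined. *)
Lemma rlint_derive1 b f : 0 < b -> right_schwartz f ->
  rlint (b + 1) (derive1 f) = (fun x => - b * rlint b f x).
Proof.
move=> b0 Ef; apply/funext => x.
have := rlint_rlint x b0 ltr01 (right_schwartz_derive1 Ef).
rewrite (rlint1_derive1 Ef) Gamma1 mulr1 (GammaS b0).
have G0 : Gamma b != 0 by rewrite gt_eqF// Gamma_gt0.
have bn : b != 0 by rewrite gt_eqF.
have -> : Gamma b / (b * Gamma b) = b^-1 by field; rewrite bn.
move=> H; rewrite -[LHS](mulVKf bn) -H mulNr -mulrN; congr (_ * _).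
rewrite /rlint -[RHS]mulN1r -RintegralZl//; last first.
  by apply: integrable_rlint => //;
    [exact: right_schwartz_measurable|exact: right_schwartz_right_decay].
by apply: eq_Rintegral => s _; ring.
Qed.

Lemma integrable_refl_rlint b f x : 0 < b -> right_schwartz (refl f) ->
  L1 (fun s => rlker b (- s) * f (x + s)).
Proof.
move=> b0 Ef.
have i1 := integrable_rlint (- x) b0 (right_schwartz_measurable Ef)
  (right_schwartz_right_decay Ef).
have N1 : (-1 : R) != 0 by rewrite oppr_eq0 oner_eq0.
have := integrable_affine 0 N1 i1; apply: eq_integrable => // s _ /=.
by rewrite addr0 mulN1r /refl opprD !opprK.
Qed.

Lemma Rintegral_refl_rlint b f x : 0 < b -> right_schwartz (refl f) ->
  \int[mu]_s (rlker b (- s) * f (x + s)) = refl (rlint b (refl f)) x.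
Proof.
move=> b0 Ef; rewrite /refl /rlint /Rintegral; congr fine.
have N1 : `|-1| = 1 :> R by rewrite normrN normr1.
rewrite -(@integral_affine1 R (-1) 0 (fun s => (rlker b s * f (- (- x +
  s)))%:E) N1).
  by apply: eq_integral => s _; rewrite addr0 mulN1r opprD !opprK.
exact: measurable_int (integrable_rlint (- x) b0 (right_schwartz_measurable Ef)
  (right_schwartz_right_decay Ef)).
Qed.

(** The convolved kernel [m] is two-sided: its half on r < 0 yields the left-sided integral, its
    half on r > 0 the right-sided one. *)
Lemma rlint_crossed a b f x : 0 < a -> 0 < b -> a + b < 1 -> right_schwartz f ->
  right_schwartz (refl f) ->
  rlint a (refl (rlint b (refl f))) x =
  Gamma a * Gamma (1 - (a + b)) / Gamma (1 - b) * refl (rlint (a + b) (refl f)) x +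
  Gamma b * Gamma (1 - (a + b)) / Gamma (1 - a) * rlint (a + b) f x.
Proof.
move=> a0 b0 ab Ef Ef'; have ab0 : 0 < a + b by exact: addr_gt0.
have mf := measurable_shift x (right_schwartz_measurable Ef).
set c1 := Gamma a * _ / _; set c2 := Gamma b * _ / _.
pose m r := c1 * rlker (a + b) (- r) + c2 * rlker (a + b) r.
have i1 := integrable_rlint x ab0 (right_schwartz_measurable Ef)
  (right_schwartz_right_decay Ef).
have i1' := integrable_refl_rlint x ab0 Ef'.
have i2' : L1 (fun r => c1 * (rlker (a + b) (- r) * f (x +
  r))) by exact: integrable_mulcf.
have i2'' : L1 (fun r => c2 * (rlker (a + b) r * f (x +
  r))) by exact: integrable_mulcf.
have mE r : m r * f (x + r) =
    c1 * (rlker (a + b) (- r) * f (x + r)) + c2 * (rlker (a + b) r * f (x + r)).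
  by rewrite /m; ring.
have i2 : L1 (fun r => m r * f (x + r)).
  by apply: eq_integrable (integrable_addf i2' i2'') => // t _ /=; rewrite mE.
have i3 t : L1 (fun u => rlker b (- u) * f (x + (t + u))).
  have := integrable_refl_rlint (x + t) b0 Ef'.
  by apply: eq_integrable => // s _ /=; rewrite addrA.
have mb : measurable_fun setT (fun u : R => rlker b (- u)).
  by apply: (measurableT_comp (measurable_rlker b)).
have [_ H] := @convolution_assoc R (rlker a) (fun u : R => rlker b (- u)) m (fun
  t => f (x + t))
  (measurable_rlker a) mb mf (rlker_ge0 a) (fun u : R => rlker_ge0 b (- u))
  (fun r => @integral_rlker_crossed R a b r a0 b0 ab) i2 i3.
transitivity (\int[mu]_r (m r * f (x + r))).
  rewrite -H /rlint; apply: eq_Rintegral => t _; congr (_ * _).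
  rewrite -Rintegral_refl_rlint//.
  by apply: eq_Rintegral => s _; rewrite addrA.
transitivity (\int[mu]_r (c1 * (rlker (a + b) (- r) * f (x + r)) +
  c2 * (rlker (a + b) r * f (x + r)))).
  by apply: eq_Rintegral => r _; exact: mE.
by rewrite RintegralD// !RintegralZl// Rintegral_refl_rlint.
Qed.

End lizorkin_real.

(** * Real Lizorkin functions *)

Section lizorkin_class.
Context {R : realType}.
Local Notation mu := (@lebesgue_measure R).
Local Notation L1 f := (mu.-integrable setT (EFin \o f)).
Implicit Types (a b x s t : R) (f g h : R -> R).

Definition real_schwartz f := right_schwartz f /\ right_schwartz (refl f).

(** The Lizorkin condition in moment form: up to powers of i, the moments are the derivatives at 0
    of the Fourier transform. *)
Definition real_lizorkin f :=
  real_schwartz f /\ forall j : nat, \int[mu]_x (x ^+ j * f x) = 0.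

Lemma is_derive_refl f x : derivable f (- x) 1 ->
  is_derive x 1 (refl f) (- refl (derive1 f) x).
Proof.
move=> df; apply: is_derive_eq (@is_derive_compf _ f (fun y => - y) x _ _
  (derivable_is_derive df) (is_derive_oppf (is_derive_idf x))) _.
by rewrite mulrN1.
Qed.

Lemma derive1_refl f : (forall x, derivable f x 1) ->
  derive1 (refl f) = (fun x => -1 * refl (derive1 f) x).
Proof.
move=> df; apply/funext => x; rewrite mulN1r.
exact: is_derive_derive1 (is_derive_refl (df (- x))).
Qed.

Lemma refl_derive1 f : (forall x, derivable f x 1) ->
  refl (derive1 f) = (fun x => -1 * derive1 (refl f) x).
Proof. by move=> df; rewrite derive1_refl//; apply/funext => x;
  rewrite mulrA mulrN1 opprK mul1r. Qed.

Lemma real_schwartzD f g : real_schwartz f -> real_schwartz g ->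
  real_schwartz (fun x => f x + g x).
Proof.
move=> [Ef Ef'] [Eg Eg']; split; first exact: right_schwartzD.
exact: (right_schwartzD Ef' Eg').
Qed.

Lemma real_schwartzZ (c : R) f : real_schwartz f ->
  real_schwartz (fun x => c * f x).
Proof. by move=> [Ef Ef']; split;
  [exact: right_schwartzZ|exact: (right_schwartzZ c Ef')]. Qed.

Lemma real_schwartzX f : real_schwartz f -> real_schwartz (fun x => x * f x).
Proof.
move=> [Ef Ef']; split; first exact: right_schwartzX.
have -> : refl (fun x => x * f x) = (fun x => -1 * (x * refl f x)).
  by apply/funext => x; rewrite /refl mulN1r mulNr.
exact: right_schwartzZ (right_schwartzX Ef').
Qed.

Lemma real_schwartzXn (j : nat) f : real_schwartz f ->
  real_schwartz (fun x => x ^+ j * f x).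
Proof.
move=> Sf; elim: j => [|j IH].
  by have -> : (fun x => x ^+ 0 * f x) = f by apply/funext => x; rewrite mul1r.
have -> : (fun x => x ^+ j.+1 * f x) = (fun x => x * (x ^+ j * f x)).
  by apply/funext => x; rewrite exprS mulrA.
exact: real_schwartzX.
Qed.

Lemma real_schwartz_derive1 f : real_schwartz f -> real_schwartz (derive1 f).
Proof.
move=> [Ef Ef']; split; first exact: right_schwartz_derive1.
rewrite refl_derive1; last exact: right_schwartz_derivable.
exact: right_schwartzZ (right_schwartz_derive1 Ef').
Qed.

(** The kernel of order 1 is the indicator of ]0, +oo[, so the two one-sided integrals of order 1
    cut the line at x and lose only that point. *)
Lemma integrable_Rintegral_real_schwartz f x : real_schwartz f -> L1 f /\
  \int[mu]_t f t = rlint 1 f x + refl (rlint 1 (refl f)) x.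
Proof.
move=> [Ef Ef']; have mf := right_schwartz_measurable Ef.
have i1 := integrable_rlint x ltr01 mf (right_schwartz_right_decay Ef).
have i2 := integrable_refl_rlint x ltr01 Ef'.
pose g s := rlker 1 s * f (x + s) + rlker 1 (- s) * f (x + s).
have gE s : s != 0 -> g s = f (x + s).
  rewrite /g neq_lt => /orP[s0|s0].
    by rewrite (rlker_le0E _ (ltW s0)) mul0r add0r rlker_gt0E ?oppr_gt0// subrr
      powRr0 mul1r.
  rewrite rlker_gt0E// subrr powRr0 mul1r rlker_le0E ?mul0r ?addr0//.
  by rewrite oppr_le0 ltW.
have ig : L1 g by exact: integrable_addf.
have mg : measurable_fun setT (fun s => (g s)%:E) by exact: measurable_int ig.
have mfx : measurable_fun setT (fun s => (f (x + s))%:E).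
  by apply/measurable_EFinP; exact: measurable_shift.
have ifx : L1 (fun s => f (x + s)).
  apply/integrableP; split; first exact: mfx.
  have -> : (\int[mu]_s `|(f (x + s)%R)%:E| = \int[mu]_s `|(g s)%:E|)%E.
    apply: (@integral_eq_off R 0); [exact: measurableT_comp..|].
    by move=> s s0 /=; rewrite gE.
  by have /integrableP[] := ig.
have if0 : L1 f.
  have := integrable_affine (- x) (oner_neq0 R) ifx;
    apply: eq_integrable => // s _ /=.
  by rewrite mul1r addrC subrK.
split => //.
transitivity (\int[mu]_s g s).
  rewrite /Rintegral; congr fine.
  rewrite -(@integral_affine1 R 1 x (fun s => (f s)%:E))//; last 2 first.
  - by rewrite normr1.
  - by apply/measurable_EFinP.
  transitivity (\int[mu]_s (f (x + s)%R)%:E)%E.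
    by apply: eq_integral => s _; rewrite mul1r addrC.
  by apply: (@integral_eq_off R 0) => // s s0; rewrite gE.
by rewrite RintegralD// Rintegral_refl_rlint.
Qed.

Lemma integrable_real_schwartz f : real_schwartz f -> L1 f.
Proof. by move=> /(integrable_Rintegral_real_schwartz 0)[]. Qed.

Lemma Rintegral_derive1_real_schwartz f : real_schwartz f ->
  \int[mu]_t derive1 f t = 0.
Proof.
move=> Sf; have [Ef Ef'] := Sf.
have [_ ->] := integrable_Rintegral_real_schwartz 0 (real_schwartz_derive1 Sf).
rewrite (rlint1_derive1 Ef) refl_derive1; last exact: right_schwartz_derivable.
rewrite /refl /rlint.
have -> : \int[mu]_s (rlker 1 s * (-1 * derive1 (refl f) (- 0 + s))) =
   -1 * rlint 1 (derive1 (refl f)) (- 0).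
  have Er := right_schwartz_derive1 Ef'.
  rewrite /rlint -RintegralZl//.
    by apply: eq_Rintegral => s _; rewrite mulrCA.
  exact: integrable_rlint (right_schwartz_measurable Er)
    (right_schwartz_right_decay Er).
by rewrite (rlint1_derive1 Ef') /refl mulN1r oppr0 opprK oppr0 addNr.
Qed.

(** Integration by parts: the derivative of x ^ (j + 1) * f has integral 0. *)
Lemma RintegralXn_derive1 (j : nat) f : real_schwartz f ->
  \int[mu]_x (x ^+ j.+1 * derive1 f x) = - (j.+1%:R * \int[mu]_x (x ^+ j * f x)).
Proof.
move=> Sf; have df := right_schwartz_derivable Sf.1.
have Sj := real_schwartzXn j.+1 Sf; have := Rintegral_derive1_real_schwartz Sj.
have dE x : derive1 (fun x => x ^+ j.+1 * f x) x =
  j.+1%:R * (x ^+ j * f x) + x ^+ j.+1 * derive1 f x.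
  apply: is_derive_derive1.
  have dX : is_derive x 1 (fun y : R => y ^+ j.+1) (j.+1%:R * x ^+ j).
    apply: DeriveDef; first exact: exprn_derivable.
    by rewrite exp_derive /= [_ *: 1]mulr1.
  apply: is_derive_eq (is_derive_mulf dX (derivable_is_derive (df x))) _.
  by ring.
have i1 := integrable_real_schwartz (real_schwartzXn j Sf).
have i2 := integrable_real_schwartz (real_schwartzXn j.+1 (real_schwartz_derive1
  Sf)).
rewrite (_ : \int[mu]_t _ =
  \int[mu]_x (j.+1%:R * (x ^+ j * f x) + x ^+ j.+1 * derive1 f x)).
  rewrite RintegralD//; last exact: integrable_mulcf.
  by rewrite RintegralZl// => /eqP; rewrite addrC addr_eq0 => /eqP.
by apply: eq_Rintegral => x _; exact: dE.
Qed.

Lemma real_lizorkinD f g : real_lizorkin f -> real_lizorkin g ->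
  real_lizorkin (fun x => f x + g x).
Proof.
move=> [Sf f0] [Sg g0]; split; first exact: real_schwartzD.
move=> j; transitivity (\int[mu]_x (x ^+ j * f x + x ^+ j * g x)).
  by apply: eq_Rintegral => x _; rewrite mulrDr.
by rewrite RintegralD ?f0 ?g0 ?addr0//; apply: integrable_real_schwartz;
  exact: real_schwartzXn.
Qed.

Lemma real_lizorkinZ (c : R) f : real_lizorkin f ->
  real_lizorkin (fun x => c * f x).
Proof.
move=> [Sf f0]; split; first exact: real_schwartzZ.
move=> j; transitivity (\int[mu]_x (c * (x ^+ j * f x))).
  by apply: eq_Rintegral => x _; rewrite mulrCA.
by rewrite RintegralZl ?f0 ?mulr0//; apply: integrable_real_schwartz;
  exact: real_schwartzXn.
Qed.

Lemma real_lizorkinX f : real_lizorkin f -> real_lizorkin (fun x => x * f x).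
Proof.
move=> [Sf f0]; split; first exact: real_schwartzX.
move=> j; rewrite -[RHS](f0 j.+1); apply: eq_Rintegral => x _.
by rewrite exprSr mulrA.
Qed.

Lemma real_lizorkin_derive1 f : real_lizorkin f -> real_lizorkin (derive1 f).
Proof.
move=> [Sf f0]; split; first exact: real_schwartz_derive1.
move=> [|j]; last by rewrite RintegralXn_derive1// f0 mulr0 oppr0.
rewrite -[RHS](Rintegral_derive1_real_schwartz Sf); apply: eq_Rintegral => x _.
by rewrite mul1r.
Qed.

(** The primitive - \int_x^oo f equals \int_{-oo}^x f because the moment of order 0 vanishes, hence
    it decays on both sides. Its j-th moment is the (j + 1)-st of [f] divided by - (j + 1). *)
Lemma real_lizorkin_primitive f : real_lizorkin f ->
  exists2 g, real_lizorkin g & derive1 g = f.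
Proof.
move=> [Sf f0]; have [Ef Ef'] := Sf.
pose g x := -1 * rlint 1 f x.
have Eg : right_schwartz g by apply: right_schwartzZ; apply: right_schwartz_rlint.
have dg : derive1 g = f.
  rewrite /g derive1_mulcf; last by apply: right_schwartz_derivable;
    exact: right_schwartz_rlint.
  apply/funext => x; rewrite derive1_rlint// rlint1_derive1//.
  by rewrite mulN1r opprK.
have Sg : real_schwartz g.
  split => //; suff -> : refl g = rlint 1 (refl f) by exact: right_schwartz_rlint.
  apply/funext => x; have [_] := integrable_Rintegral_real_schwartz (- x) Sf.
  have -> : \int[mu]_t f t = 0.
    by rewrite -[RHS](f0 0%N); apply: eq_Rintegral => t _; rewrite mul1r.
  rewrite [refl (rlint _ _) _]/refl opprK /g /refl => H.
  by rewrite mulN1r; apply/eqP; rewrite -subr_eq0 -opprD oppr_eq0 -H.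
exists g => //; split=> // j.
have := RintegralXn_derive1 j Sg; rewrite dg f0 => /esym/eqP.
by rewrite oppr_eq0 mulf_eq0 pnatr_eq0 /= => /eqP.
Qed.

End lizorkin_class.

(** * Decay of left-sided integrals to the right *)

Section lizorkin_left_integral.
Context {R : realType}.
Local Notation mu := (@lebesgue_measure R).
Local Notation L1 f := (mu.-integrable setT (EFin \o f)).
Implicit Types (a b x s t : R) (f g h : R -> R).

Lemma rlintZ a (c : R) f : 0 < a -> right_schwartz f ->
  rlint a (fun x => c * f x) = (fun x => c * rlint a f x).
Proof.
move=> a0 Ef; apply/funext => x; rewrite /rlint -RintegralZl//.
  by apply: eq_Rintegral => s _; rewrite mulrCA.
exact: integrable_rlint (right_schwartz_measurable Ef)
  (right_schwartz_right_decay Ef).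
Qed.

Lemma rlintD a f g : 0 < a -> right_schwartz f -> right_schwartz g ->
  rlint a (fun x => f x + g x) = (fun x => rlint a f x + rlint a g x).
Proof.
move=> a0 Ef Eg; apply/funext => x; rewrite /rlint -RintegralD//.
- by apply: eq_Rintegral => s _; rewrite mulrDr.
- exact: integrable_rlint (right_schwartz_measurable Ef)
  (right_schwartz_right_decay Ef).
- exact: integrable_rlint (right_schwartz_measurable Eg)
  (right_schwartz_right_decay Eg).
Qed.

Definition rlint_left b f : R -> R := refl (rlint b (refl f)).

Lemma derive1_rlint_left b f : 0 < b -> real_schwartz f ->
  derive1 (rlint_left b f) = rlint_left b (derive1 f).
Proof.
move=> b0 [Ef Ef']; rewrite /rlint_left derive1_refl; last first.
  by apply: right_schwartz_derivable; exact: right_schwartz_rlint.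
rewrite derive1_rlint// refl_derive1; last exact: right_schwartz_derivable.
by rewrite rlintZ//; exact: right_schwartz_derive1.
Qed.

Lemma derivable_rlint_left b f : 0 < b -> real_schwartz f ->
  forall x, derivable (rlint_left b f) x 1.
Proof.
move=> b0 [Ef Ef'] x; apply: is_derive_derivable; apply: is_derive_refl.
by apply: right_schwartz_derivable; exact: right_schwartz_rlint.
Qed.

(* [x = (x - s) + s] under the integral, and [s * rlker b s = rlker (b + 1) s],
   whose extra order is absorbed by the primitive [g] of [f]. *)
Lemma mulX_rlint_left b f g x : 0 < b -> real_schwartz f -> real_schwartz g ->
  derive1 g = f ->
  x * rlint_left b f x = rlint_left b (fun y => y * f y + b * g y) x.
Proof.
move=> b0 [Ef Ef'] [Eg Eg'] gf.
have b10 : 0 < b + 1 by lra.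
pose y := - x; have xy : x = - y by rewrite opprK.
change (x * rlint b (refl f) y = rlint b (refl (fun z => z * f z + b * g z)) y).
rewrite xy.
have i1 : L1 (fun s => rlker b s * refl f (y + s)).
  exact: integrable_rlint (right_schwartz_measurable Ef')
    (right_schwartz_right_decay Ef').
have i2 : L1 (fun s => rlker (b + 1) s * refl f (y + s)).
  exact: integrable_rlint (right_schwartz_measurable Ef')
    (right_schwartz_right_decay Ef').
have i3 : L1 (fun s => rlker b s * refl g (y + s)).
  exact: integrable_rlint (right_schwartz_measurable Eg')
    (right_schwartz_right_decay Eg').
have H : rlint (b + 1) (refl f) y = b * rlint b (refl g) y.
  rewrite -gf refl_derive1; last exact: right_schwartz_derivable.
  rewrite rlintZ//; last exact: right_schwartz_derive1.
  by rewrite rlint_derive1//; ring.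
transitivity (- y * rlint b (refl f) y + (-1 * rlint (b + 1) (refl f) y +
  b * rlint b (refl g) y)).
  by rewrite H; ring.
have j1 := integrable_mulcf (- y) i1; have j2 := integrable_mulcf (-1) i2.
have j3 := integrable_mulcf b i3.
rewrite /rlint -!RintegralZl// -RintegralD// -RintegralD//;
  last exact: integrable_addf.
apply: eq_Rintegral => s _.
have -> : rlker (b + 1) s = rlker b s * s.
  case: (ltP 0 s) => s0; last by rewrite !(rlker_le0E _ s0) mul0r.
  by rewrite -rlkerM powRr1// ltW.
by rewrite /refl; ring.
Qed.

(** The kernel is cut at s = 1: before it, the kernel is integrable and [f] bounded; after it, the
    kernel is at most 1, since b <= 1, and [f] is integrable. *)
Lemma rlint_left_bounded b f : 0 < b <= 1 -> real_schwartz f ->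
  exists C : R, forall x, `|rlint_left b f x| <= C.
Proof.
move=> /andP[b0 b1] [Ef Ef'].
have Sf : real_schwartz (refl f) by split => //; rewrite reflK.
have fB : exists2 B : R, 0 <= B & forall x, `|refl f x| <= B.
  have [C1 H1] := right_schwartz_right_decay Ef 0 0%N;
    have [C2 H2] := right_schwartz_right_decay Ef' 0 0%N.
  exists (`|C1| + `|C2|); first by rewrite addr_ge0.
  move=> x; case: (leP 0 x) => x0.
    have := H2 x x0; rewrite mul1r => H; apply: le_trans H _.
    by apply: le_trans (ler_norm _) _; rewrite lerDr.
  have /H1 : 0 <= - x by rewrite oppr_ge0 ltW.
  rewrite mul1r /refl => H; apply: le_trans H _.
  by apply: le_trans (ler_norm _) _; rewrite lerDl.
have [B B0 HB] := fB.
(* For s <= 1 one has 2 ^ (b + 1) * (1 + s) ^ (- (b + 1)) >= 1, so [K] times the integrable base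
   kernel dominates B * rlker b s. *)
pose K := B * 2 `^ (b + 1).
have K0 : 0 <= K by rewrite mulr_ge0 ?powR_ge0.
have iB := integrable_rlker_base b0.
have in0 : L1 (fun t => `|refl f t|) by have :=
  integrable_norm (integrable_real_schwartz Sf).
have IB : \int[mu]_s (rlker b s * (1 + s) `^ (- (b + 1))) = b^-1.
  by rewrite /Rintegral integral_rlker_base.
exists (K * b^-1 + \int[mu]_t `|refl f t|) => x;
  rewrite /rlint_left [X in `|X|]/refl.
set y := - x.
have i1 : L1 (fun s => rlker b s * refl f (y + s)).
  exact: integrable_rlint (right_schwartz_measurable Ef')
    (right_schwartz_right_decay Ef').
have iy : L1 (fun s => `|refl f (y + s)|).
  have := integrable_affine y (oner_neq0 R) in0; apply: eq_integrable => // s _ /=.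
  by rewrite mul1r addrC.
have <- : \int[mu]_s `|refl f (y + s)| = \int[mu]_t `|refl f t|.
  rewrite /Rintegral; congr fine.
  rewrite -[RHS](@integral_affine1 R 1 y (fun t => `|refl f t|%:E)) ?normr1//;
    last first.
    exact: measurable_int in0.
  by apply: eq_integral => s _; rewrite mul1r addrC.
rewrite -IB -RintegralZl// -RintegralD//; last exact: integrable_mulcf.
apply: le_trans (le_normr_Rintegral measurableT i1) _.
apply: le_Rintegral => //.
- exact: integrable_norm i1.
- by apply: integrable_addf => //; exact: integrable_mulcf.
move=> s _; rewrite normrM (ger0_norm (rlker_ge0 _ _)).
case: (ltP 0 s) => s0; last by rewrite !(rlker_le0E _ s0) !mul0r mulr0 add0r.
have s1 : 0 < 1 + s by lra.
case: (leP s 1) => s2.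
  rewrite -[leLHS]addr0; apply: lerD => //.
  have w1 : 1 <= 2 `^ (b + 1) * (1 + s) `^ (- (b + 1)).
    rewrite powRN ler_pdivlMr ?powR_gt0// mul1r.
    by apply: ge0_ler_powR; rewrite ?nnegrE; lra.
  have -> : K * (rlker b s * (1 + s) `^ (- (b + 1))) =
      rlker b s * B * (2 `^ (b + 1) * (1 + s) `^ (- (b + 1))) by rewrite /K; ring.
  apply: (@le_trans _ _ (rlker b s * B)); first by rewrite ler_wpM2l ?rlker_ge0.
  by rewrite ler_peMr// mulr_ge0 ?rlker_ge0.
rewrite -[leLHS]add0r; apply: lerD; first by rewrite !mulr_ge0 ?rlker_ge0 ?powR_ge0.
rewrite ler_piMl// rlker_gt0E//.
by rewrite -[leRHS](powRr0 s) ler_powR//; lra.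
Qed.

(** Induction on the weight, with [f] general: each extra factor x is traded by [mulX_rlint_left]
    for the new Lizorkin function x f + b g. *)
Lemma rlint_left_bounded_weight b (k : nat) f : 0 < b <= 1 -> real_lizorkin f ->
  exists C : R, forall x, (1 + `|x|) ^+ k * `|rlint_left b f x| <= C.
Proof.
move=> b01; have /andP[b0 _] := b01; elim: k f => [|k IH] f Pf.
  have [C HC] := rlint_left_bounded b01 Pf.1.
  by exists C => x; rewrite mul1r.
have [g Pg gf] := real_lizorkin_primitive Pf.
have [C1 H1] := IH _ Pf.
have [C2 H2] := IH _ (real_lizorkinD (real_lizorkinX Pf) (real_lizorkinZ b Pg)).
exists (C1 + C2) => x; apply: le_trans (lerD (H1 x) (H2 x)).
rewrite -(mulX_rlint_left x b0 Pf.1 Pg.1 gf) normrM exprSr -mulrA -mulrDr.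
by rewrite mulrDl mul1r.
Qed.

Lemma right_schwartz_rlint_left b f : 0 < b <= 1 -> real_lizorkin f ->
  right_schwartz (rlint_left b f).
Proof.
move=> b01 Pf; have /andP[b0 _] := b01.
apply: (@right_schwartz_coind _ (fun h => exists f,
  real_lizorkin f /\ h = rlint_left b f)); last by exists f.
move=> _ [{}f [{}Pf ->]]; split.
- exact: derivable_rlint_left b0 Pf.1.
- move=> A k; have [C HC] := rlint_left_bounded_weight k b01 Pf.
  by exists C => x _; exact: HC.
- by exists (derive1 f); split;
  [exact: real_lizorkin_derive1|apply: derive1_rlint_left b0 Pf.1].
Qed.

End lizorkin_left_integral.

(** * The crossed identity for real functions *)

Section real_operators.
Context {R : realType}.
Implicit Types (a b c x : R) (f g h : R -> R) (n : nat).

Definition rlop a f : R ->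
  R := if a == 0 then f else fun x => (Gamma a)^-1 * rlint a f x.

Definition rl_plus a f : R -> R := if 0 <= a then rlop a f
  else fun x => (- 1) ^+ RL_degree a * derive1n (RL_degree a) (rlop ((RL_degree
    a)%:R + a) f) x.

(** The sign (- 1) ^ n in [rl_plus] cancels the one produced by differentiating a reflected function
    n times, which leaves the unsigned left-sided derivative. *)
Definition rl_minus a f : R -> R := refl (rl_plus a (refl f)).

Lemma rlop0 f : rlop 0 f = f. Proof. by rewrite /rlop eqxx. Qed.

Lemma rlopE a f : 0 < a -> rlop a f = (fun x => (Gamma a)^-1 * rlint a f x).
Proof. by move=> a0; rewrite /rlop gt_eqF. Qed.

Lemma right_schwartz_rlop a f : 0 <= a -> right_schwartz f ->
  right_schwartz (rlop a f).
Proof.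
rewrite le_eqVlt => /predU1P[<-|a0] Ef; first by rewrite rlop0.
by rewrite rlopE//; apply: right_schwartzZ; exact: right_schwartz_rlint.
Qed.

Lemma derive1_rlop a f : 0 <= a -> right_schwartz f ->
  derive1 (rlop a f) = rlop a (derive1 f).
Proof.
rewrite le_eqVlt => /predU1P[<-|a0] Ef; first by rewrite !rlop0.
rewrite !rlopE// derive1_mulcf ?derive1_rlint//.
by apply: right_schwartz_derivable; exact: right_schwartz_rlint.
Qed.

Lemma derive1n_rlop n a f : 0 <= a -> right_schwartz f ->
  derive1n n (rlop a f) = rlop a (derive1n n f).
Proof.
move=> a0 Ef; elim: n => [//|n IH].
by rewrite !derive1nS IH derive1_rlop//; exact: right_schwartz_derive1n.
Qed.

Lemma rlopZ a c f : 0 <= a -> right_schwartz f ->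
  rlop a (fun x => c * f x) = (fun x => c * rlop a f x).
Proof.
rewrite le_eqVlt => /predU1P[<-|a0] Ef; first by rewrite !rlop0.
by rewrite !rlopE// rlintZ//; apply/funext => x; rewrite mulrCA.
Qed.

Lemma rlopD a f g : 0 <= a -> right_schwartz f -> right_schwartz g ->
  rlop a (fun x => f x + g x) = (fun x => rlop a f x + rlop a g x).
Proof.
rewrite le_eqVlt => /predU1P[<-|a0] Ef Eg; first by rewrite !rlop0.
by rewrite !rlopE// rlintD//; apply/funext => x; rewrite mulrDr.
Qed.

Lemma rlopS_derive1 a f : 0 <= a -> right_schwartz f ->
  rlop (a + 1) (derive1 f) = (fun x => - rlop a f x).
Proof.
rewrite le_eqVlt => /predU1P[<-|a0] Ef.
  rewrite add0r rlop0 rlopE// rlint1_derive1// Gamma1.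
  by apply/funext => x; rewrite invr1 mul1r.
rewrite !rlopE ?addr_gt0// rlint_derive1// GammaS//; apply/funext => x.
have G0 : Gamma a != 0 by rewrite gt_eqF// Gamma_gt0.
by field; rewrite G0 gt_eqF.
Qed.

Lemma rlop_rlop a b f : 0 < a -> 0 < b -> right_schwartz f ->
  rlop a (rlop b f) = rlop (a + b) f.
Proof.
move=> a0 b0 Ef; rewrite (rlopE _ a0) (rlopE _ b0) (rlopE _ (addr_gt0 a0 b0)).
rewrite rlintZ//; last exact: right_schwartz_rlint.
apply/funext => x; rewrite rlint_rlint//.
have ab0 := addr_gt0 a0 b0.
move: (lt0r_neq0 (Gamma_gt0 a0)) (lt0r_neq0 (Gamma_gt0 b0)) (lt0r_neq0 (Gamma_gt0
  ab0)).
move: (Gamma a) (Gamma b) (Gamma (a + b)) => Ga Gb Gc na nb nc.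
by field; rewrite na nb nc.
Qed.

Lemma RL_degreeE a : a < 0 -> (RL_degree a)%:R = (Num.ceil (- a))%:~R :> R.
Proof.
move=> a0; rewrite /RL_degree -[in RHS](@gez0_abs (Num.ceil (- a)))//.
by rewrite ceil_ge0; lra.
Qed.

Lemma RL_degree_ge a : a < 0 -> 0 <= (RL_degree a)%:R + a.
Proof. by move=> a0; rewrite RL_degreeE//; have := ceil_ge (- a); lra. Qed.

Lemma RL_degree_min a n : a < 0 -> 0 <= n%:R + a -> (RL_degree a <= n)%N.
Proof.
move=> a0 na; rewrite -(ler_nat R) RL_degreeE// -[n%:R]/(n%:~R) ler_int.
by rewrite ceil_le_int -[n%:~R]/(n%:R); lra.
Qed.

(** Every admissible number of derivatives gives the same operator: one more derivative and one more
    order of integration cancel by [rlopS_derive1]. Order shifts then become a change of [n], free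
    of ceilings. *)
Lemma rl_plusE n a f : 0 <= n%:R + a -> right_schwartz f ->
  rl_plus a f = (fun x => (- 1) ^+ n * rlop (n%:R + a) (derive1n n f) x).
Proof.
pose Q m x := (- 1) ^+ m * rlop (m%:R + a) (derive1n m f) x.
move=> na Ef.
have step m : 0 <= m%:R + a -> Q m.+1 = Q m.
  move=> ma; apply/funext => x;
    rewrite /Q -natr1 -addrA [1 + a]addrC addrA derive1nS.
  by rewrite rlopS_derive1//; [rewrite exprS; ring|exact: right_schwartz_derive1n].
have shift m k : 0 <= m%:R + a -> Q (m + k)%N = Q m.
  move=> ma; elim: k => [|k IH]; first by rewrite addn0.
  rewrite addnS step ?IH// natrD; have : 0 <= k%:R :> R by exact: ler0n.
  by lra.
rewrite -/(Q n) /rl_plus; case: leP => a0.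
  by rewrite -[n]add0n shift ?add0r// /Q; apply/funext => x; rewrite mul1r add0r.
have ma := RL_degree_ge a0; have mn := RL_degree_min a0 na.
rewrite -(subnKC mn) shift// /Q; apply/funext => x.
by rewrite derive1n_rlop.
Qed.

Lemma ex_degree a : exists n, 0 <= n%:R + a :> R.
Proof.
exists (Num.truncn `|a|).+1.
have := truncnS_gt `|a|; have : - a <= `|a| by rewrite -normrN ler_norm.
by lra.
Qed.

Lemma rl_plus_derive1 a f : right_schwartz f ->
  rl_plus a (derive1 f) = (fun x => - rl_plus (a - 1) f x).
Proof.
move=> Ef; have [n na] := ex_degree a.
have na1 : 0 <= n.+1%:R + (a - 1) by rewrite -natr1; lra.
rewrite (rl_plusE na (right_schwartz_derive1 Ef)) (rl_plusE na1 Ef);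
  apply/funext => x.
have -> : n.+1%:R + (a - 1) = n%:R + a by rewrite -natr1; ring.
by rewrite -derive1Sn exprS; ring.
Qed.

Lemma derive1_rl_plus a f : right_schwartz f ->
  derive1 (rl_plus a f) = rl_plus a (derive1 f).
Proof.
move=> Ef; have [n na] := ex_degree a.
rewrite (rl_plusE na (right_schwartz_derive1 Ef)) (rl_plusE na Ef) derive1_mulcf;
  last first.
  by apply: right_schwartz_derivable; apply: right_schwartz_rlop => //;
    exact: right_schwartz_derive1n.
rewrite derive1_rlop//; last exact: right_schwartz_derive1n.
by rewrite -derive1nS derive1Sn.
Qed.

Lemma right_schwartz_rl_plus a f : right_schwartz f -> right_schwartz (rl_plus a f).
Proof.
move=> Ef; have [n na] := ex_degree a; rewrite (rl_plusE na Ef).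
by apply: right_schwartzZ; apply: right_schwartz_rlop => //;
  exact: right_schwartz_derive1n.
Qed.

Lemma derive1n_mulcf n c f : right_schwartz f ->
  derive1n n (fun x => c * f x) = (fun x => c * derive1n n f x).
Proof.
move=> Ef; elim: n => [//|n IH].
by rewrite !derive1nS IH derive1_mulcf//; exact: (Ef n).1.
Qed.

Lemma rl_plusZ a c f : right_schwartz f ->
  rl_plus a (fun x => c * f x) = (fun x => c * rl_plus a f x).
Proof.
move=> Ef; have [n na] := ex_degree a.
rewrite (rl_plusE na Ef) (rl_plusE na (right_schwartzZ c Ef)) derive1n_mulcf//
  rlopZ//; last exact: right_schwartz_derive1n.
by apply/funext => x; rewrite mulrCA.
Qed.

Lemma rl_plus_ge0 a f : 0 <= a -> rl_plus a f = rlop a f.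
Proof. by rewrite /rl_plus => ->. Qed.

Lemma rl_minus_derive1 a f : real_schwartz f ->
  rl_minus a (derive1 f) = rl_minus (a - 1) f.
Proof.
move=> [Ef Ef']; rewrite /rl_minus refl_derive1;
  last exact: right_schwartz_derivable.
rewrite rl_plusZ; last exact: right_schwartz_derive1.
by rewrite rl_plus_derive1//; apply/funext => x; rewrite /refl mulN1r opprK.
Qed.

Lemma derive1_rl_minus a f : real_schwartz f ->
  derive1 (rl_minus a f) = rl_minus a (derive1 f).
Proof.
move=> [Ef Ef']; rewrite /rl_minus derive1_refl;
  last by apply: right_schwartz_derivable; exact: right_schwartz_rl_plus.
rewrite derive1_rl_plus// refl_derive1; last exact: right_schwartz_derivable.
by rewrite rl_plusZ//; exact: right_schwartz_derive1.
Qed.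

Lemma rl_minusE a f : 0 < a ->
  rl_minus a f = (fun x => (Gamma a)^-1 * rlint_left a f x).
Proof. by move=> a0; rewrite /rl_minus rl_plus_ge0 ?ltW// rlopE. Qed.

Lemma right_schwartz_rl_minus a f : 0 <= a <= 1 -> real_lizorkin f ->
  right_schwartz (rl_minus a f).
Proof.
move=> /andP[a0 a1] Pf; move: a0; rewrite le_eqVlt => /predU1P[<-|a0].
  by rewrite /rl_minus rl_plus_ge0// rlop0 reflK; exact: Pf.1.1.
by rewrite rl_minusE//; apply: right_schwartzZ; apply: right_schwartz_rlint_left;
  rewrite ?a0.
Qed.

(** The denominator is cleared so that order shifts carry no side condition. The quantifier over [f]
    is inside because a shift replaces [f] by its derivative or primitive. *)
Definition crossed a b := forall f, real_lizorkin f -> forall x,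
  sin ((a + b) * pi) * rl_plus a (rl_minus b f) x =
  sin (b * pi) * rl_minus (a + b) f x + sin (a * pi) * rl_plus (a + b) f x.

Lemma Gamma_neq0 a : 0 < a -> Gamma a != 0.
Proof. by move=> a0; rewrite gt_eqF// Gamma_gt0. Qed.

Lemma sin_pi_Gamma a : 0 < a -> a < 1 ->
  sin (a * pi) = pi / (Gamma a * Gamma (1 - a)).
Proof.
move=> a0 a1; have a1' : 0 < 1 - a by rewrite subr_gt0.
have GG : Gamma a * Gamma (1 - a) != 0 by rewrite mulf_neq0 ?Gamma_neq0.
apply: (mulfI GG); rewrite Gamma_reflection ?a0// mulrCA mulfV// mulr1.
exact: erefl.
Qed.

(** Relative to the normalised operator of order a + b, the left-sided term has the coefficient
    Gamma (a + b) Gamma (1 - (a + b)) / (Gamma b Gamma (1 - b)), a quotient of sines by reflection;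
    the other term is the same with a in place of b. *)
Lemma crossed_lt1 a b : 0 < a -> 0 < b -> a + b < 1 -> crossed a b.
Proof.
move=> a0 b0 ab f Pf x; have [[Ef Ef'] _] := Pf.
have ab0 : 0 < a + b by exact: addr_gt0.
have a1 : a < 1 by apply: lt_trans ab; rewrite ltrDl.
have b1 : b < 1 by apply: lt_trans ab; rewrite ltrDr.
have a1' : 0 < 1 - a by rewrite subr_gt0.
have b1' : 0 < 1 - b by rewrite subr_gt0.
have ab1' : 0 < 1 - (a + b) by rewrite subr_gt0.
have Eb : right_schwartz (rlint_left b f).
  by apply: right_schwartz_rlint_left => //; rewrite b0 ltW.
rewrite (rl_minusE _ b0) (rl_minusE _ ab0) !rl_plus_ge0 ?ltW// (rlopE _ a0)
  (rlopE _ ab0) (rlintZ _ a0 Eb).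
rewrite (rlint_crossed x a0 b0 ab Ef Ef').
rewrite (sin_pi_Gamma a0 a1) (sin_pi_Gamma b0 b1) (sin_pi_Gamma ab0 ab) /rlint_left.
move: (Gamma_neq0 a0) (Gamma_neq0 b0) (Gamma_neq0 ab0).
move: (Gamma_neq0 a1') (Gamma_neq0 b1') (Gamma_neq0 ab1').
move: (Gamma a) (Gamma b) (Gamma (a +
  b)) (Gamma (1 - a)) (Gamma (1 - b)) (Gamma (1 - (a + b))).
move=> Ga Gb Gc Ga' Gb' Gc' na' nb' nc' na nb nc.
by field; rewrite na nb nc na' nb' nc'.
Qed.

(** With c = a + b - 1, applying order a to the identity for (1 - a, c) turns its terms into W_+^1
    W_-^c f = - W_-^(a + b) f, the wanted W_+^a W_-^b f, and W_+^(a + b) f. Finally sin ((a + b) pi)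
    = - sin (c pi). *)
Lemma crossed_gt1 a b : 0 < a < 1 -> 0 < b < 1 -> 1 < a + b -> crossed a b.
Proof.
move=> /andP[a0 a1] /andP[b0 b1] ab f Pf x; have [[Ef Ef'] _] := Pf.
pose c := a + b - 1.
have c0 : 0 < c by rewrite subr_gt0.
have a10 : 0 < 1 - a by rewrite subr_gt0.
have ab0 : 0 < a + b by exact: addr_gt0.
have sumE : (1 - a) + c = b by rewrite /c; ring.
have H0 : 1 - a + c < 1 by rewrite sumE.
have H := crossed_lt1 a10 c0 H0 Pf; rewrite sumE in H.
have sa : sin ((1 - a) * pi) = sin (a * pi).
  by rewrite mulrBl mul1r addrC sinDpi sinN opprK.
have sc : sin ((a + b) * pi) = - sin (c * pi).
  by rewrite -sinDpi; congr sin; rewrite /c; ring.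
rewrite sa in H.
have Ec : right_schwartz (rl_minus c f) by apply: right_schwartz_rl_minus => //;
  rewrite /c; apply/andP; split; lra.
have Eb : right_schwartz (rl_minus b f) by apply: right_schwartz_rl_minus => //;
  apply/andP; split; lra.
have HE : (fun x => sin (c * pi) * rl_minus b f x) =
    (fun x => sin (b * pi) * rl_plus (1 - a) (rl_minus c f) x +
      - sin (a * pi) * rl_plus b f x).
  by apply/funext => y; rewrite H; ring.
have L : rlop a (fun x => sin (c * pi) * rl_minus b f x) =
  (fun x => sin (c * pi) * rlop a (rl_minus b f) x).
  by rewrite rlopZ// ltW.
have E1 : right_schwartz (rl_plus (1 - a) (rl_minus c f)) by exact:
  right_schwartz_rl_plus.
have E2 : right_schwartz (rl_plus b f) by exact: right_schwartz_rl_plus.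
have L' : rlop a (fun x => sin (b * pi) * rl_plus (1 - a) (rl_minus c f) x +
  - sin (a * pi) * rl_plus b f x) =
   (fun x => sin (b * pi) * rlop 1 (rl_minus c f) x + - sin (a * pi) * rlop (a +
     b) f x).
  rewrite rlopD ?rlopZ ?(ltW a0)//; try exact: right_schwartzZ.
  rewrite (rl_plus_ge0 _ (ltW a10)) (rl_plus_ge0 _ (ltW b0)) (rlop_rlop a0 a10
    Ec) (rlop_rlop a0 b0 Ef).
  by have -> : a + (1 - a) = 1 by ring.
have [g Pg gf] := real_lizorkin_primitive Pf.
(* Written for f = g', the function to integrate is the derivative of [rl_minus c g], whose order
   lies in [0, 1], where decay to the right is known. *)
have M : rlop 1 (rl_minus c f) = (fun x => - rl_minus (a + b) f x).
  have Ecg : right_schwartz (rl_minus c g) by apply: right_schwartz_rl_minus =>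
    //; rewrite /c; apply/andP; split; lra.
  rewrite -{1}gf -derive1_rl_minus; last exact: Pg.1.
  have -> : rlop 1 = rlop (0 + 1) by rewrite add0r.
  by rewrite (rlopS_derive1 (lexx 0) Ecg) rlop0 -gf (rl_minus_derive1 _ Pg.1).
rewrite rl_plus_ge0 ?(ltW a0)// sc mulNr.
have -> : sin (c * pi) * rlop a (rl_minus b f) x =
  rlop a (fun x => sin (c * pi) * rl_minus b f x) x by rewrite L.
rewrite HE L' M (rl_plus_ge0 _ (ltW ab0)); ring.
Qed.

Lemma crossed_unit a b : 0 <= a < 1 -> 0 <= b < 1 -> a + b != 1 -> crossed a b.
Proof.
move=> /andP[a0 a1] /andP[b0 b1] ab.
move: a0; rewrite le_eqVlt => /predU1P[<-|a0].
  by move=> f Pf x; rewrite (rl_plus_ge0 _ (lexx 0)) rlop0 add0r mul0r sin0 mul0r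
    addr0.
move: b0; rewrite le_eqVlt => /predU1P[<-|b0].
  by move=> f Pf x; rewrite addr0 mul0r sin0 mul0r add0r {1}/rl_minus
    (rl_plus_ge0 _ (lexx 0)) rlop0 reflK.
move: ab; rewrite neq_lt => /orP[ab|ab]; first exact: crossed_lt1.
by apply: crossed_gt1; rewrite ?a0 ?b0.
Qed.

Let sinB1 c : sin ((c - 1) * pi) = - sin (c * pi).
Proof.
have H : sin (c * pi) = - sin ((c - 1) * pi) by rewrite -sinDpi; congr sin; ring.
by rewrite H opprK.
Qed.

(** Inserting f' lowers the left-sided orders without a sign and the right-sided one with a minus;
    with the two sines that flip, the whole identity changes sign. Primitives give the converse. *)
Lemma crossed_right_pred a b : crossed a b <-> crossed a (b - 1).
Proof.
split=> H f Pf x.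
  have := H _ (real_lizorkin_derive1 Pf) x; have [Sf _] := Pf; have [Ef _] := Sf.
  rewrite !rl_minus_derive1// rl_plus_derive1// addrA !sinB1 => H'.
  by rewrite mulNr H'; ring.
have [g Pg gf] := real_lizorkin_primitive Pf; have := H _ Pg x; rewrite -gf.
have [Sg _] := Pg; have [Eg _] := Sg.
rewrite !rl_minus_derive1// rl_plus_derive1// addrA !sinB1 => H'.
apply: oppr_inj; rewrite -mulNr H'; ring.
Qed.

(** The derivative is passed through the inner operator and absorbed by the outer one. The range of
    [b] is the one in which [rl_minus b f] is known to be in the domain of the outer operator. *)
Lemma crossed_left_pred a b : 0 <= b < 1 -> crossed a b <-> crossed (a - 1) b.
Proof.
move=> /andP[b0 b1].
have key f x : real_lizorkin f ->
  rl_plus a (rl_minus b (derive1 f)) x = - rl_plus (a - 1) (rl_minus b f) x.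
  move=> Pf; have [Sf _] := Pf; rewrite -derive1_rl_minus// rl_plus_derive1//.
  by apply: right_schwartz_rl_minus => //; rewrite b0 ltW.
split=> H f Pf x.
  have := H _ (real_lizorkin_derive1 Pf) x; have [Sf _] := Pf; have [Ef _] := Sf.
  rewrite key// rl_minus_derive1// rl_plus_derive1// [a - 1 + b]addrAC !sinB1 => H'.
  by rewrite mulNr -mulrN H'; ring.
have [g Pg gf] := real_lizorkin_primitive Pf; have := H _ Pg x; rewrite -gf.
have [Sg _] := Pg; have [Eg _] := Sg.
rewrite key// rl_minus_derive1// rl_plus_derive1// [a - 1 + b]addrAC !sinB1 => H'.
by rewrite mulrN -mulNr H'; ring.
Qed.

Lemma int_shift_iff (Q : R -> Prop) : (forall c, Q c <-> Q (c - 1)) ->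
  forall c (k : int), Q (c - k%:~R) -> Q c.
Proof.
move=> HQ; have up c n : Q c <-> Q (c - n%:R).
  elim: n => [|n IH]; first by rewrite subr0.
  by rewrite IH HQ -addrA -opprD natr1.
move=> c [n|n] /=; first by move/(up c n).2.
rewrite NegzE mulrNz opprK => /(up _ n.+1).1.
by rewrite addrK.
Qed.

Lemma crossed_nonint a b : a + b \isn't a Num.int -> crossed a b.
Proof.
move=> ab; have fl c : 0 <= c - (Num.floor c)%:~R < 1.
  by have := floor_le_tmp c; have := floorD1_gt c; rewrite intrD1; lra.
(* [b] is brought into [0, 1[ first, as [crossed_left_pred] then demands. *)
apply: (int_shift_iff (crossed_right_pred a) (k := Num.floor b)).
have b01 := fl b; set b' := b - _ in b01 *.
apply: (int_shift_iff (fun c => crossed_left_pred c b01) (k := Num.floor a)).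
apply: crossed_unit => //.
apply: contra ab => /eqP e.
have -> : a + b = (Num.floor a + Num.floor b + 1)%:~R.
  by move: e; rewrite /b' !intrD mulr1z; lra.
exact: intr_int.
Qed.

End real_operators.

(** * Complex functions *)

Local Open Scope complex_scope.

Section componentwise.
Context {R : realType}.
Local Notation mu := (@lebesgue_measure R).
Local Notation L1 f := (mu.-integrable setT (EFin \o f)).
Implicit Types (a b c x : R) (f g h : R -> R) (n k : nat).

Lemma sin_pi_neq0 c : c \isn't a Num.int -> sin (c * pi) != 0.
Proof.
move=> cZ; have HQ (d : R) : sin (d * pi) != 0 <-> sin ((d - 1) * pi) != 0.
  have -> : sin (d * pi) = - sin ((d - 1) * pi) by rewrite -sinDpi; congr sin; ring.
  by rewrite oppr_eq0.
apply: (@int_shift_iff R (fun d => sin (d * pi) != 0) HQ c (Num.floor c));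
  rewrite gt_eqF//; apply: sin_gt0_pi.
have f0 : 0 <= c - (Num.floor c)%:~R by have := floor_le_tmp c; lra.
have f1 : c - (Num.floor c)%:~R < 1 by have := floorD1_gt c; rewrite intrD1; lra.
apply/andP; split; last by rewrite -[ltRHS]mul1r ltr_pM2r ?pi_gt0.
rewrite mulr_gt0 ?pi_gt0// lt_neqAle f0 andbT eq_sym subr_eq0.
by apply: contra cZ => /eqP ->; exact: intr_int.
Qed.

(** Boundedness settled the orders in [0, 1]; a derivative or primitive of [f] shifts any other
    order into that range. *)
Lemma right_schwartz_rl_minus_real c f : real_lizorkin f ->
  right_schwartz (rl_minus c f).
Proof.
move: f; have HQ d : (forall f, real_lizorkin f ->
  right_schwartz (rl_minus d f)) <-> (forall f, real_lizorkin f ->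
  right_schwartz (rl_minus (d - 1) f)).
  split=> H f Pf; first by rewrite -rl_minus_derive1;
    [apply/H/real_lizorkin_derive1|exact: Pf.1].
  by have [g Pg <-] := real_lizorkin_primitive Pf; rewrite rl_minus_derive1;
    [exact: H|exact: Pg.1].
apply: (@int_shift_iff R (fun d => forall f, real_lizorkin f ->
  right_schwartz (rl_minus d f)) HQ c (Num.floor c)) => f Pf.
apply: right_schwartz_rl_minus => //.
have := floor_le_tmp c; have := floorD1_gt c; rewrite intrD1; lra.
Qed.

Lemma derive1n_refl n f : right_schwartz f ->
  derive1n n (refl f) = (fun x => (- 1) ^+ n * refl (derive1n n f) x).
Proof.
move=> Ef; elim: n => [|n IH]; first by apply/funext => x; rewrite mul1r.
rewrite !derive1nS IH derive1_mulcf; last first.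
  by move=> x; apply: is_derive_derivable; apply: is_derive_refl; exact: (Ef n).1.
rewrite derive1_refl; last exact: (Ef n).1.
by apply/funext => x; rewrite exprSr mulrA.
Qed.

(** The closed ray contains t = x, where [powR] has a conventional value at 0 while [rlker]
    vanishes; the point is removed as a null set. *)
Lemma RL_plus_rlint a f x : 0 < a -> right_schwartz f ->
  \int[mu]_(t in `[x, +oo[) ((t - x) `^ (a - 1) * f t) = rlint a f x.
Proof.
move=> a0 Ef; have mf := right_schwartz_measurable Ef.
have i1 : L1 (fun s => rlker a s * f (x + s)) :=
  integrable_rlint x a0 mf (right_schwartz_right_decay Ef).
have i2 : L1 (fun t => rlker a (t - x) * f t).
  have := integrable_affine (- x) (oner_neq0 R) i1;
    apply: eq_integrable => // t _ /=.
  by rewrite mul1r subrKC.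
have i3 : mu.-integrable `]x, +oo[ (EFin \o (fun t => (t - x) `^ (a - 1) * f t)).
  have i3' : mu.-integrable `]x, +oo[ (EFin \o (fun t => rlker a (t - x) * f t)).
    by apply: integrableS i2.
  apply: eq_integrable i3' => // t; rewrite inE/= in_itv/= andbT => tx.
  by rewrite rlker_gt0E// subr_gt0.
rewrite -Rintegral_itv_obnd_cbnd// Rintegral_mkcond.
transitivity (\int[mu]_t (rlker a (t - x) * f t)).
  apply: eq_Rintegral => t _; rewrite patchE; case: ifPn.
    by rewrite inE/= in_itv/= andbT => tx; rewrite rlker_gt0E// subr_gt0.
  by rewrite notin_setE/= in_itv/= andbT => /negP; rewrite -leNgt => tx;
    rewrite rlker_le0E ?mul0r// subr_le0.
rewrite /rlint /Rintegral; congr fine.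
rewrite -(@integral_affine1 R 1 (- x) (fun s => (rlker a s * f (x + s))%:E))//.
- by apply: eq_integral => t _; rewrite mul1r subrKC.
- by rewrite normr1.
- exact: measurable_int i1.
Qed.

Lemma RL_minus_rlint a f x : 0 < a -> right_schwartz (refl f) ->
  \int[mu]_(t in `]-oo, x]) ((x - t) `^ (a - 1) * f t) = refl (rlint a (refl f)) x.
Proof.
move=> a0 Ef; rewrite -Rintegral_refl_rlint//.
have i1 : L1 (fun s => rlker a (- s) * f (x + s)) := integrable_refl_rlint x a0 Ef.
have i2 : L1 (fun t => rlker a (x - t) * f t).
  have := integrable_affine (- x) (oner_neq0 R) i1;
    apply: eq_integrable => // t _ /=.
  by rewrite mul1r subrKC opprB.
have i3 : mu.-integrable `]-oo, x[ (EFin \o (fun t => (x - t) `^ (a - 1) * f t)).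
  have i3' : mu.-integrable `]-oo, x[ (EFin \o (fun t => rlker a (x - t) * f t)).
    by apply: integrableS i2.
  apply: eq_integrable i3' => // t; rewrite inE/= in_itv/= => tx.
  by rewrite rlker_gt0E// subr_gt0.
rewrite -Rintegral_itv_bndo_bndc// Rintegral_mkcond.
transitivity (\int[mu]_t (rlker a (x - t) * f t)).
  apply: eq_Rintegral => t _; rewrite patchE; case: ifPn.
    by rewrite inE/= in_itv/= => tx; rewrite rlker_gt0E// subr_gt0.
  by rewrite notin_setE/= in_itv/= => /negP; rewrite -leNgt => tx;
    rewrite rlker_le0E ?mul0r// subr_le0.
rewrite /Rintegral; congr fine.
rewrite -(@integral_affine1 R 1 (- x) (fun s => (rlker a (- s) * f (x + s))%:E))//.
- by apply: eq_integral => t _; rewrite mul1r subrKC opprB.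
- by rewrite normr1.
- exact: measurable_int i1.
Qed.

Local Notation Rep := (fun phi : R -> R[i] => fun x => complex.Re (phi x)).
Local Notation Imp := (fun phi : R -> R[i] => fun x => complex.Im (phi x)).

Lemma mul_real_complex (r : R) (z : R[i]) :
  r%:C * z = (r * complex.Re z) +i* (r * complex.Im z).
Proof. by case: z => u v; apply/eqP;
  rewrite eq_complex /= !mul0r subr0 addr0 !eqxx. Qed.

Lemma RL_integral_plusE a (phi : R -> R[i]) : 0 <= a ->
  right_schwartz (Rep phi) -> right_schwartz (Imp phi) ->
  RL_integral_plus a phi = (fun x => rlop a (Rep phi) x +i* rlop a (Imp phi) x).
Proof.
move=> a0 Er Ei; apply/funext => x; rewrite /RL_integral_plus /rlop.
case: eqP => [_|/eqP an0]; first by case: (phi x).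
have {an0}a0 : 0 < a by rewrite lt_neqAle eq_sym an0.
rewrite mul_real_complex /cintegral /= -!RL_plus_rlint//.
by congr (_ * _ +i* (_ * _)); apply: eq_Rintegral => t _; rewrite mul_real_complex.
Qed.

Lemma RL_integral_minusE a (phi : R -> R[i]) : 0 <= a ->
  right_schwartz (refl (Rep phi)) -> right_schwartz (refl (Imp phi)) ->
  RL_integral_minus a phi =
  (fun x => refl (rlop a (refl (Rep phi))) x +i* refl (rlop a (refl (Imp phi))) x).
Proof.
move=> a0 Er Ei; apply/funext => x; rewrite /RL_integral_minus /rlop.
case: eqP => [_|/eqP an0]; first by rewrite !reflK; case: (phi x).
have {an0}a0 : 0 < a by rewrite lt_neqAle eq_sym an0.
rewrite mul_real_complex /cintegral /=.
rewrite [X in _ = X +i* _]/refl [X in _ = _ +i* X]/refl.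
rewrite -[rlint a (refl (Rep phi)) (- x)]/(refl (rlint a (refl (Rep phi))) x).
rewrite -[rlint a (refl (Imp phi)) (- x)]/(refl (rlint a (refl (Imp phi))) x).
rewrite -!RL_minus_rlint//.
by congr (_ * _ +i* (_ * _)); apply: eq_Rintegral => t _; rewrite mul_real_complex.
Qed.

Lemma W_plusE a (phi : R -> R[i]) : right_schwartz (Rep phi) ->
  right_schwartz (Imp phi) ->
  W_plus a phi = (fun x => rl_plus a (Rep phi) x +i* rl_plus a (Imp phi) x).
Proof.
move=> Er Ei; rewrite /W_plus /rl_plus; case: leP => a0;
  first exact: RL_integral_plusE.
apply/funext => x; rewrite RL_integral_plusE//; last exact: RL_degree_ge.
have -> : (- 1) ^+ RL_degree a =
  ((- 1) ^+ RL_degree a : R)%:C by rewrite rmorphXn rmorphN1.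
by rewrite mul_real_complex.
Qed.

Lemma W_minusE a (phi : R -> R[i]) : right_schwartz (refl (Rep phi)) ->
  right_schwartz (refl (Imp phi)) ->
  W_minus a phi = (fun x => rl_minus a (Rep phi) x +i* rl_minus a (Imp phi) x).
Proof.
move=> Er Ei; rewrite /W_minus /rl_minus /rl_plus; case: leP => a0;
  first exact: RL_integral_minusE.
have na := RL_degree_ge a0.
apply/funext => x; rewrite RL_integral_minusE// /cderivn /=.
rewrite -[fun t => refl _ t]/(refl _) -[fun t => refl (rlop _ (refl (Imp phi)))
  t]/(refl _).
(* The sign from differentiating the reflected integral is the (- 1) ^ n inside [rl_plus]. *)
by rewrite !derive1n_refl//; exact: right_schwartz_rlop.
Qed.

End componentwise.

(** * From the Fourier condition to vanishing moments *)

Section lizorkin_components.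
Context {R : realType}.
Local Notation mu := (@lebesgue_measure R).
Local Notation L1 f := (mu.-integrable setT (EFin \o f)).
Implicit Types (a b c u x : R) (f g h : R -> R) (n k : nat).

Lemma norm_le_normc (z : R[i]) :
  `|complex.Re z| <= Normc.normc z /\ `|complex.Im z| <= Normc.normc z.
Proof.
case: z => a b /=; rewrite -!sqrtr_sqr; split; apply: ler_wsqrtr.
  by rewrite lerDl sqr_ge0.
by rewrite lerDr sqr_ge0.
Qed.

Lemma exp_1Dnorm_le k x : (1 + `|x|) ^+ k <= 2 ^+ k * (1 + `|x| ^+ k).
Proof.
case: (leP `|x| 1) => x1.
  apply: (@le_trans _ _ (2 ^+ k));
    last by rewrite ler_peMr ?exprn_ge0// lerDl exprn_ge0.
  by apply: lerXn2r; rewrite ?nnegrE ?addr_ge0//; lra.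
apply: (@le_trans _ _ ((2 * `|x|) ^+ k)).
  by apply: lerXn2r; rewrite ?nnegrE ?addr_ge0 ?mulr_ge0//; lra.
by rewrite exprMn ler_wpM2l ?exprn_ge0// lerDr.
Qed.

Lemma real_schwartz_bounds f : (forall n x, derivable (derive1n n f) x 1) ->
  (forall k n, exists M, forall x, `|x| ^+ k * `|derive1n n f x| <= M) ->
    real_schwartz f.
Proof.
move=> df bf.
have bf' k n : exists M, forall x, (1 + `|x|) ^+ k * `|derive1n n f x| <= M.
  have [M0 H0] := bf 0%N n; have [Mk Hk] := bf k n.
  exists (2 ^+ k * (M0 + Mk)) => x.
  apply: (@le_trans _ _ (2 ^+ k * (1 + `|x| ^+ k) * `|derive1n n f x|)).
    by rewrite ler_wpM2r// exp_1Dnorm_le.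
  rewrite -mulrA ler_wpM2l ?exprn_ge0// mulrDl; apply: lerD; last exact: Hk.
  by have := H0 x; rewrite expr0.
split; first by move=> n; split; [exact: df|move=> A k; have [M HM] := bf' k n;
  exists M => x _].
(* The scalar c collects the signs that arise when reflected derivatives are differentiated. *)
apply: (@right_schwartz_coind _ (fun h => exists c n,
  h = (fun x => c * refl (derive1n n f) x))); last first.
  by exists 1, 0%N; apply/funext => x; rewrite mul1r.
move=> _ [c [n ->]].
have dr x : derivable (refl (derive1n n f)) x 1.
  by apply: is_derive_derivable; apply: is_derive_refl; exact: df.
split.
- move=> x; exact: is_derive_derivable (is_derive_mulcf c (derivable_is_derive
  (dr x))).
- move=> A k; have [M HM] := bf' k n; exists (`|c| * M) => x _.
  by rewrite normrM mulrCA ler_wpM2l// -[`|x|]normrN HM.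
- exists (- c), n.+1; rewrite (derive1_mulcf c dr) (derive1_refl (df n)).
  by apply/funext => x; rewrite derive1nS mulrA mulrN1.
Qed.

Lemma schwartz_ReIm (phi : R -> R[i]) : schwartz phi ->
  real_schwartz (fun x => complex.Re (phi x)) /\ real_schwartz (fun x =>
    complex.Im (phi x)).
Proof.
move=> [sm bd]; split; apply: real_schwartz_bounds.
- by move=> n x; exact: (sm n x).1.
- move=> k n; have [M HM] := bd k n; exists M => x; apply: le_trans (HM x).
  rewrite ler_wpM2l ?exprn_ge0//.
  exact: (norm_le_normc (cderivn n phi x)).1.
- by move=> n x; exact: (sm n x).2.
- move=> k n; have [M HM] := bd k n; exists M => x; apply: le_trans (HM x).
  rewrite ler_wpM2l ?exprn_ge0//.
  exact: (norm_le_normc (cderivn n phi x)).2.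
Qed.

(** The phase makes the family closed under d/du: a derivative multiplies [f] by x and adds pi / 2
    to c. The phases - pi / 2 and pi / 2 encode sin and - sin in the Fourier transform. *)
Definition osc c f u : R := \int[mu]_x (f x * cos (u * x + c)).

Lemma measurable_osc c u f : measurable_fun setT f ->
  measurable_fun setT (fun x => f x * cos (u * x + c)).
Proof.
move=> mf; apply: measurable_funM => //.
apply: (@measurableT_comp _ _ _ _ _ _ cos).
  by apply: continuous_measurable_fun; exact: continuous_cos.
by apply: measurable_funD => //; exact: measurable_funM.
Qed.

Lemma integrable_osc c u f : real_schwartz f -> L1 (fun x => f x * cos (u * x + c)).
Proof.
move=> Sf; apply: le_integrable (integrable_real_schwartz Sf) => //.
  by apply/measurable_EFinP; apply: measurable_osc;
    exact: right_schwartz_measurable Sf.1.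
by move=> x _ /=; rewrite lee_fin normrM ler_piMr// cos_max.
Qed.

Lemma is_derive_osc c f u : real_schwartz f ->
  is_derive u 1 (osc c f) (osc (c + pi / 2) (fun x => x * f x) u).
Proof.
move=> Sf; pose F u x := f x * cos (u * x + c).
pose G x := `|x * f x|.
have dF (v x : R) : is_derive v 1 (F ^~ x) (x * f x * cos (v * x + (c + pi / 2))).
  have d1 := is_derive_addf (is_derive_mulf (is_derive_idf v) (is_derive_cstf x
    v)) (is_derive_cstf c v).
  have d2 := @is_derive_compf _ cos (fun v => v * x + c) v _ _ (is_derive_cos _) d1.
  apply: is_derive_eq (is_derive_mulcf (f x) d2) _.
  by rewrite addrA cosDpihalf; ring.
have G0 x : 0 <= G x by rewrite /G.
have iG : L1 G by have :=
  integrable_norm (integrable_real_schwartz (real_schwartzX Sf)).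
have xI : `](u - 1), (u + 1)[%classic u by rewrite /= in_itv/=; lra.
have iF (y : R) : `](u - 1), (u + 1)[%classic y -> L1 (F y) by move=> _;
  exact: integrable_osc.
have dF' (y s : R) : `](u - 1), (u + 1)[%classic y -> setT s ->
  derivable (F ^~ s) y 1.
  by move=> _ _; exact: is_derive_derivable (dF y s).
have GF (y s : R) : `](u - 1), (u + 1)[%classic y -> setT s ->
  `|partial1of2 F y s| <= G s.
  move=> _ _; rewrite /partial1of2 (is_derive_derive1 (dF y s)) /G.
  by rewrite normrM ler_piMr// cos_max.
have der := @derivable_under_integral R _ _ mu F setT measurableT u _ _ xI iF dF'
  G G0 iG GF.
have := @differentiation_under_integral R _ _ mu F setT measurableT u _ _ xI iF
  dF' G G0 iG GF.
rewrite derive1E => dE; apply: DeriveDef; first exact: der.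
apply: etrans dE _; apply: eq_Rintegral => s _.
exact: is_derive_derive1 (dF u s).
Qed.

Lemma derive1n_osc n a b f g : real_schwartz f -> real_schwartz g ->
  derive1n n (fun u => osc a f u + osc b g u) =
  (fun u => osc (a + n%:R * (pi / 2)) (fun x => x ^+ n * f x) u +
            osc (b + n%:R * (pi / 2)) (fun x => x ^+ n * g x) u).
Proof.
move=> Sf Sg; elim: n => [|n IH].
  rewrite mul0r !addr0 /=; apply/funext => u.
  by congr (osc _ _ _ + osc _ _ _); apply/funext => x; rewrite mul1r.
rewrite derive1nS IH; apply/funext => u; apply: is_derive_derive1.
have e c : c + n.+1%:R * (pi / 2) = c + n%:R * (pi / 2) + pi / 2.
  by rewrite -natr1; ring.
have eX h : (fun x => x ^+ n.+1 * h x) = (fun x => x * (x ^+ n * h x)).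
  by apply/funext => x; rewrite exprS mulrA.
rewrite !e !eX; apply: is_derive_addf; apply: is_derive_osc; exact: real_schwartzXn.
Qed.

Lemma osc0 c f : real_schwartz f -> osc c f 0 = cos c * \int[mu]_x f x.
Proof.
move=> Sf; rewrite /osc -RintegralZl//; last exact: integrable_real_schwartz.
by apply: eq_Rintegral => x _; rewrite mul0r add0r mulrC.
Qed.

Lemma fourierE (phi : R -> R[i]) u : schwartz phi ->
  let f x := complex.Re (phi x) in let g x := complex.Im (phi x) in
  fourier phi u = (osc 0 f u + osc (pi / 2) g u) +i* (osc (- (pi / 2)) f u +
    osc 0 g u).
Proof.
move=> /schwartz_ReIm[Sf Sg] f g; rewrite /fourier /cintegral.
have E x : phi x * (cos (u * x) +i* sin (u * x)) =
    (f x * cos (u * x + 0) + g x * cos (u * x + pi / 2)) +i*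
    (f x * cos (u * x + - (pi / 2)) + g x * cos (u * x + 0)).
  rewrite /f /g; case: (phi x) => p q /=.
  rewrite !addr0 cosDpihalf cosBpihalf; apply/eqP; rewrite eq_complex /=.
  by rewrite mulrN !eqxx /=.
rewrite -!RintegralD//; try exact: integrable_osc.
by congr (_ +i* _); apply: eq_Rintegral => x _; rewrite E.
Qed.

Lemma lizorkin_ReIm (phi : R -> R[i]) : lizorkin phi ->
  real_lizorkin (fun x => complex.Re (phi x)) /\ real_lizorkin (fun x =>
    complex.Im (phi x)).
Proof.
move=> [Sphi [_ D0]]; have [Sf Sg] := schwartz_ReIm Sphi.
set f := fun x => complex.Re (phi x) in Sf *;
  set g := fun x => complex.Im (phi x) in Sg *.
suff H n : \int[mu]_x (x ^+ n * f x) = 0 /\ \int[mu]_x (x ^+ n * g x) = 0.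
  by split; split => // n; have [] := H n.
have := D0 n; rewrite /cderivn.
have -> : (fun t => complex.Re (fourier phi t)) =
  (fun u => osc 0 f u + osc (pi / 2) g u).
  by apply/funext => u; rewrite fourierE.
have -> : (fun t => complex.Im (fourier phi t)) =
  (fun u => osc (- (pi / 2)) f u + osc 0 g u).
  by apply/funext => u; rewrite fourierE.
rewrite !derive1n_osc// => -[]; rewrite !osc0; try exact: real_schwartzXn.
(* The vector (p, q) of n-th moments, rotated by the angle t (the factor i ^ n), is zero; rotating
   back gives p = q = 0. *)
set t := n%:R * (pi / 2); set p := \int[mu]_x _; set q := \int[mu]_x _.
rewrite !add0r [pi / 2 + t]addrC [- (pi / 2) +
  t]addrC cosDpihalf cosBpihalf => e1 e2.
have cs := cos2Dsin2 t.
have -> : p = (cos t ^+ 2 + sin t ^+ 2) * p by rewrite cs mul1r.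
have -> : q = (cos t ^+ 2 + sin t ^+ 2) * q by rewrite cs mul1r.
split.
  transitivity (cos t * (cos t * p + - sin t * q) + sin t * (sin t * p +
    cos t * q)); first by ring.
  by rewrite e1 e2 !mulr0 addr0.
transitivity (cos t * (sin t * p + cos t * q) - sin t * (cos t * p +
  - sin t * q)); first by ring.
by rewrite e1 e2 !mulr0 subr0.
Qed.

Lemma crossed_complex a b f g x : a + b \isn't a Num.int -> real_lizorkin f ->
  real_lizorkin g ->
  let phi x := f x +i* g x in
  W_plus a (W_minus b phi) x =
  (sin (b * pi) / sin ((a + b) * pi))%:C * W_minus (a + b) phi x +
  (sin (a * pi) / sin ((a + b) * pi))%:C * W_plus (a + b) phi x.
Proof.
move=> abZ Pf Pg phi; have [[Ef Ef'] _] := Pf; have [[Eg Eg'] _] := Pg.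
have mE c : W_minus c phi =
  (fun x => rl_minus c f x +i* rl_minus c g x) by exact: (@W_minusE _ c phi Ef'
  Eg').
have pE c : W_plus c phi =
  (fun x => rl_plus c f x +i* rl_plus c g x) by exact: (@W_plusE _ c phi Ef Eg).
have pmE h j : right_schwartz h -> right_schwartz j ->
    W_plus a (fun x => h x +i* j x) = (fun x => rl_plus a h x +i* rl_plus a j x).
  by move=> Eh Ej; exact: (@W_plusE _ a (fun x => h x +i* j x) Eh Ej).
rewrite !mE pE (pmE _ _ (right_schwartz_rl_minus_real b Pf)
  (right_schwartz_rl_minus_real b Pg)) !mul_real_complex.
have s0 := sin_pi_neq0 abZ.
have solve (w y z : R) : sin ((a + b) * pi) * w =
  sin (b * pi) * y + sin (a * pi) * z ->
    w = sin (b * pi) / sin ((a + b) * pi) * y + sin (a * pi) / sin ((a +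
      b) * pi) * z.
  by move=> H; apply: (mulfI s0); rewrite H; field.
by congr (_ +i* _); apply: solve;
  [exact: crossed_nonint abZ f Pf x|exact: crossed_nonint abZ g Pg x].
Qed.

End lizorkin_components.

Theorem proposition1p7 (R : realType) (lambda mu : R) (phi : R -> R[i])
    (hlm : lambda + mu \isn't a Num.int) (hphi : lizorkin phi) :
  forall x : R,
    W_plus lambda (W_minus mu phi) x =
      (sin (mu * pi) / sin ((lambda + mu) * pi))%:C *
        W_minus (lambda + mu) phi x +
      (sin (lambda * pi) / sin ((lambda + mu) * pi))%:C *
        W_plus (lambda + mu) phi x.
Proof.
have [Pf Pg] := lizorkin_ReIm hphi; move=> x.
have -> : phi = (fun x => complex.Re (phi x) +i* complex.Im (phi x)).
  by apply/funext => y; case: (phi y).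
exact: crossed_complex.
Qed.
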